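(* Let $f(z,w)$ define a smooth affine plane curve of projective degree $d\geq1$, and let $\Delta$ be its Newton polygon; after multiplication by a monomial if necessary, $\Delta\subset d\Delta_2=\operatorname{conv}\{(0,0),(d,0),(0,d)\}$. Assume that $C_f\in\mathscr C_\Delta$ and that the ramification points of the critical-value map $\mathrm{Log}|_{S_f}$ are isolated. Then $$\kappa(f)\leq 4d^4+8d^3-6d^2\leq\frac{13}{2}d^4.$$ For $d\geq3$ one has the stronger uniform estimate $\kappa(f)\leq 6d^4$, and asymptotically, as $d\to\infty$, one has $\kappa(f)\leq(4+O(d^{-1}))d^4$ (with an absolute implied constant).
   Context: Let $\Delta$ be a two-dimensional lattice polygon, $f$ have Newton polygon $\Delta$, $C_f=\{f=0\}\subset(\mathbb C^* )^2$, and let $\overline C_f$ be its closure in the toric surface $X_\Delta$. Let $\mathrm{Log}(z,w)=(\log|z|,\log|w|)$. $S_f\subset C_f$ denotes the critical locus of $\mathrm{Log}|_{C_f}$ (the points where the real differential of $\mathrm{Log}|_{C_f}$ has rank less than $2$), and the contour of the amoeba is $\mathcal K_f=\mathrm{Log}(S_f)$. $\mathscr C_\Delta$ is the set of those $C_f$ (with $f$ of Newton polygon $\Delta$) for which $C_f$ is smooth, $S_f$ is a smooth real one-dimensional manifold, and $\overline C_f$ is a smooth torically nondegenerate curve meeting every toric boundary divisor transversely and away from the zero-dimensional torus orbits. A cusp lift is a point of $S_f$ at which the derivative of $\mathrm{Log}|_{S_f}:S_f\to\mathbb R^2$ vanishes (a ramification point); its image in $\mathcal K_f$ is a cusp value.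 $\kappa(f)$ is the number of distinct cusp values of the contour $\mathcal K_f$. *)

(* Defs.v *)
From HB Require Import structures.
From mathcomp Require Import all_boot all_order all_algebra finmap complex.
From mathcomp Require Import all_classical all_reals all_analysis.
Set Implicit Arguments.
Unset Strict Implicit.
Unset Printing Implicit Defensive.
Import Order.TTheory GRing.Theory Num.Theory numFieldNormedType.Exports.
Local Open Scope classical_set_scope.
Local Open Scope complex_scope.
Local Open Scope ring_scope.

(* A Laurent polynomial in z, w is the family of its coefficients, indexed by
   the exponents in Z^2. *)
Notation laurent R := {fsfun (int * int)%type -> R[i] with 0}.

Section LaurentPolynomials.
Context {R : realType}.
Implicit Types (f : laurent R) (p : R[i] * R[i]) (a : int * int).

Definition torus : set (R[i] * R[i]) := [set p | p.1 != 0 /\ p.2 != 0].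

Definition monomial a p : R[i] := p.1 ^ a.1 * p.2 ^ a.2.

Definition eval f p : R[i] := \sum_(a <- finsupp f) f a * monomial a p.

Definition eval_dz f p : R[i] :=
  \sum_(a <- finsupp f) f a * a.1%:~R * monomial (a.1 - 1, a.2) p.

Definition eval_dw f p : R[i] :=
  \sum_(a <- finsupp f) f a * a.2%:~R * monomial (a.1, a.2 - 1) p.

Definition smooth_in_torus f :=
  forall p, torus p -> eval f p = 0 -> eval_dz f p != 0 \/ eval_dw f p != 0.

(* Degree of the closure in P^2 of the curve {f = 0} of the torus: the total
   degree of the monomial multiple of f that is a polynomial divisible by
   neither z nor w. *)
Definition has_projective_degree f (d : nat) :=
  exists m : int * int,
  [/\ forall a, a \in finsupp f -> 0 <= a.1 + m.1 /\ 0 <= a.2 + m.2,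
      exists2 a, a \in finsupp f & a.1 + m.1 = 0,
      exists2 a, a \in finsupp f & a.2 + m.2 = 0,
      forall a, a \in finsupp f -> (a.1 + m.1) + (a.2 + m.2) <= d%:Z
    & exists2 a, a \in finsupp f & (a.1 + m.1) + (a.2 + m.2) = d%:Z].

End LaurentPolynomials.

Section Polygons.
Context {R : realType}.
Implicit Types (f : laurent R) (D G K : set 'rV[R]_2) (v : 'rV[R]_2).

Definition lattice_point (a : int * int) : 'rV[R]_2 :=
  \row_(i < 2) (if i == 0 then a.1%:~R else a.2%:~R).

Definition convex_hull (A : set 'rV[R]_2) : set 'rV[R]_2 :=
  smallest (@convex_set R 'rV[R]_2) A.

Definition lattice_polygon D :=
  exists A : {fset int * int},
    D = convex_hull [set lattice_point a | a in [set` A]].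

Definition two_dimensional D := interior D !=set0.

Definition newton_polygon f : set 'rV[R]_2 :=
  convex_hull [set lattice_point a | a in [set` finsupp f]].

Definition dotp (u v : 'rV[R]_2) : R := \sum_(i < 2) u 0 i * v 0 i.

(* Face on which u is minimal; u = 0 gives D itself. *)
Definition face D (u : 'rV[R]_2) : set 'rV[R]_2 :=
  [set a | D a /\ forall b, D b -> dotp u a <= dotp u b].

Definition is_vertex D v := exists u, face D u = [set v].

Definition is_edge D G :=
  (exists2 u, u != 0 & G = face D u) /\
  (exists a b, [/\ G a, G b & a != b]).

Definition truncation f G : laurent R :=
  [fsfun a in [fset b in finsupp f | `[< G (lattice_point b) >]]%fset
     => f a | 0].

Definition torically_nondegenerate D f :=
  forall u, smooth_in_torus (truncation f (face D u)).

(* Lattice points of the cone spanned by K - v. *)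
Definition cone_monoid K v : set (int * int) :=
  [set m | exists2 lam : R, 0 <= lam &
     exists2 a, K a & lattice_point m = lam *: (a - v)].

End Polygons.

(* The toric surface X_D of a lattice polygon D is covered by the affine charts
   Spec C[S_v], v a vertex of D, with S_v := cone_monoid D v.  The complex
   points of this chart are the monoid morphisms from S_v to (C, x), extended
   here by 0 outside S_v.  Its coordinate ring consists of the Laurent
   polynomials with exponents in S_v. *)
Section ToricSurface.
Context {R : realType}.
Local Notation C := R[i].
Local Notation ambient := {ptws (int * int)%type -> C^o}.
Implicit Types (f g : laurent R) (D G : set 'rV[R]_2) (v : 'rV[R]_2).
Implicit Types (Z : set ambient) (chi delta : int * int -> C).

Definition chart D v : set ambient :=
  [set chi | [/\ chi 0 = 1,
     forall m n, cone_monoid D v m -> cone_monoid D v n ->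
       chi (m + n) = chi m * chi n
   & forall m, ~ cone_monoid D v m -> chi m = 0]].

Definition torus_embedding D v (p : C * C) : ambient :=
  fun m => if `[< cone_monoid D v m >] then monomial m p else 0.

(* Trace on the chart at v of the closure in X_D of the curve {f = 0}. *)
Definition curve_closure D v f : set ambient :=
  chart D v `&`
  closure [set torus_embedding D v p | p in [set p | torus p /\ eval f p = 0]].

Definition fixed_point : int * int -> C := fun m => (m == 0)%:R.

(* Trace on the chart at v of the boundary divisor of an edge G through v. *)
Definition boundary_divisor D v G : set ambient :=
  [set chi | chart D v chi /\
     forall m, cone_monoid D v m -> ~ cone_monoid G v m -> chi m = 0].

Definition pairing g chi : C := \sum_(m <- finsupp g) g m * chi m.

Definition vanishing_ideal D v Z : set (laurent R) :=
  [set g | (forall m, m \in finsupp g -> cone_monoid D v m) /\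
           (forall chi, Z chi -> pairing g chi = 0)].

(* Zariski tangent space at chi of a subset Z of the chart at v: the point
   derivations at chi of the coordinate ring, given by their values on
   monomials, that annihilate the ideal of Z. *)
Definition zariski_tangent D v Z chi : set (int * int -> C) :=
  [set delta |
    [/\ forall m n, cone_monoid D v m -> cone_monoid D v n ->
          delta (m + n) = chi m * delta n + chi n * delta m,
        forall m, ~ cone_monoid D v m -> delta m = 0
      & forall g, vanishing_ideal D v Z g -> pairing g delta = 0]].

Definition is_line (L : set (int * int -> C)) :=
  exists2 delta0, delta0 <> (fun=> 0) &
    L = [set delta | exists c : C, delta = (fun m => c * delta0 m)].

Definition closure_smooth D f :=
  forall v, is_vertex D v -> forall chi, curve_closure D v f chi ->
    is_line (zariski_tangent D v (curve_closure D v f) chi).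

Definition closure_avoids_fixed_points D f :=
  forall v, is_vertex D v -> ~ curve_closure D v f fixed_point.

Definition closure_transverse_to_boundary D f :=
  forall v, is_vertex D v -> forall G, is_edge D G -> G v ->
  forall chi, curve_closure D v f chi -> boundary_divisor D v G chi ->
  forall delta, zariski_tangent D v (chart D v) chi delta ->
  exists delta1 delta2,
    [/\ zariski_tangent D v (curve_closure D v f) chi delta1,
        zariski_tangent D v (boundary_divisor D v G) chi delta2
      & delta = (fun m => delta1 m + delta2 m)].

End ToricSurface.

(* Embedded smooth curves of R^4. *)
Section SmoothArcs.
Context {R : realType}.
Implicit Types (S : set 'rV[R]_4) (x : 'rV[R]_4) (gamma : R -> 'rV[R]_4).

(* gamma is a regular smooth parametrization by R, and a homeomorphism, of a
   neighborhood of x in S. *)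
Definition local_param S x gamma :=
  exists U : set 'rV[R]_4,
  [/\ open_nbhs x U, gamma 0 = x, range gamma = S `&` U,
      (forall n t, derivable (derive1n n gamma) t 1) /\
      (forall t, derive1 gamma t != 0)
    & exists2 inv : 'rV[R]_4 -> R,
        {within S `&` U, continuous inv} & cancel gamma inv].

Definition smooth_1manifold S :=
  forall x, S x -> exists gamma, local_param S x gamma.

End SmoothArcs.

Section Contour.
Context {R : realType}.
Implicit Types (f : laurent R) (x : 'rV[R]_4) (D : set 'rV[R]_2).

(* C^2 is identified with R^4 by (z, w) = (x_0 + i x_1, x_2 + i x_3). *)
Definition cpoint x : R[i] * R[i] :=
  (x 0 0 +i* x 0 1, x 0 2 +i* x 0 3).

Definition curve f : set 'rV[R]_4 :=
  [set x | torus (cpoint x) /\ eval f (cpoint x) = 0].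

Definition real_eval f x : 'rV[R]_2 :=
  let c := eval f (cpoint x) in
  \row_(i < 2) (if i == 0 then complex.Re c else complex.Im c).

Definition Log x : 'rV[R]_2 :=
  let p := cpoint x in
  \row_(i < 2) ln (Normc.normc (if i == 0 then p.1 else p.2)).

(* The real tangent space of the curve at x is the kernel of the differential
   of f.  Jacobian matrices act on row vectors, so its image by the
   differential of Log is the row space of the product below. *)
Definition critical_locus f : set 'rV[R]_4 :=
  [set x | curve f x /\
     (\rank (kermx ('J (real_eval f) x) *m 'J Log x) < 2)%N].

Definition contour f : set 'rV[R]_2 := [set Log x | x in critical_locus f].

Definition ramification_points f : set 'rV[R]_4 :=
  [set x | critical_locus f x /\
     exists2 gamma, local_param (critical_locus f) x gamma
       & derive1 (Log \o gamma) 0 = 0].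

Definition cusp_values f : set 'rV[R]_2 :=
  [set Log x | x in ramification_points f].

Definition kappa f : \bar R := counting (cusp_values f).

Definition curve_class D f :=
  [/\ newton_polygon f = D,
      smooth_in_torus f,
      smooth_1manifold (critical_locus f),
      closure_smooth D f /\ torically_nondegenerate D f
    & closure_transverse_to_boundary D f /\ closure_avoids_fixed_points D f].

End Contour.

(* Main.v *)
(* Let A = z f_z and B = w f_w, so that the critical locus S is the set of
   points of the curve where A / B is real.  The vector field
   -B z d/dz + A w d/dw is tangent to the curve; let W = B A' - A B' be the
   Wronskian for the derivation along it, of degree 3 d, and phi = W / B^3.
   At a ramification point Re phi = 0, and the converse holds where W <> 0.
   The zeros of W on S are isolated: otherwise a real linear combination of A
   and B would vanish on an open piece of the curve, which would lie in the
   one-dimensional manifold S.  So the zeros of Re phi on S are isolated.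

   On S the functions t = A / B and phi satisfy a polynomial relation
   P(t, phi) = 0.  Give t and phi the weights 1 and 3; since polynomials of
   degree k restricted to the curve span a space of dimension about d k, the
   generator P of these relations has weight M <= 3 d^2.  As t is real on S,
   Re phi = e implies that phi is also a root of y |-> conj(P)(t, 2 e - y).
   After clearing denominators this becomes a polynomial of degree d M in z and
   w, which for generic e has at most d (d M) <= 3 d^4 zeros on S.

   Finally an isolated zero of Re phi on an arc of S splits into at least two
   zeros of (Re phi)^2 - e^2 for small e, one on each side, so that there are
   at most 3 d^4 ramification points.  This is below every bound of the
   theorem, and the function h can be taken to be 0. *)

Require Import Defs.
From mathcomp Require Import all_boot all_order all_algebra finmap complex polyXY.
From mathcomp Require Import all_classical all_reals all_analysis.
From mathcomp Require Import zify ring lra.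
(* Restores the names [cpoint] and [eval] of Defs. *)
Import Defs.
Set Implicit Arguments.
Unset Strict Implicit.
Unset Printing Implicit Defensive.
Import Order.TTheory GRing.Theory Num.Theory numFieldNormedType.Exports.
Local Open Scope ring_scope.

(** * Bivariate polynomials and weighted degrees *)

(** No irreducibility of the curve is assumed, and functions are compared only on [S], a union of
    real arcs; so neither a function field nor Bezout's theorem is used. They are replaced by linear
    algebra and one torsion-freeness property: if the product of G with a nonzero polynomial in the
    slope vanishes at the points of [S] where the slope is finite, then G vanishes on [S]. It makes
    the ideal of relations principal, shows that its generator involves phi, and makes the reflected
    polynomials non-zero-divisors on [S]. It comes from the arcs: a value of the slope is taken at
    isolated points of [S], and no point of [S] is isolated.

    Origin of 3 d^2: about M k / 3 monomials of weight at most k avoid multiples of the top monomial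
    of P; times B^k they have degree d k, hence lie in dimension about d^2 k. So M / 3 is at most
    d^2.

    The values e and -e of Re phi are treated together, by a product of degree 2 d M. Its at most 2
    d^2 M zeros on [S] include two for each ramification point, and the factors 2 cancel.

    B may vanish at a ramification point. The shear B + c A, with c real, changes neither W nor the
    reality of the slope. *)

Lemma dependent_rows (K : fieldType) (I E : finType) (M : I -> E -> K) :
  (#|E| < #|I|)%N ->
  exists2 c : I -> K, exists i, c i != 0 & forall e, \sum_i c i * M i e = 0.
Proof.
move=> lt_EI.
pose N := \matrix_(i < #|I|, e < #|E|) M (enum_val i) (enum_val e).
have /rowV0Pn[v /sub_kermxP vN0 v0]: kermx N != 0.
  rewrite kermx_eq0 /row_free neq_ltn; apply/orP; left.
  by apply: leq_ltn_trans lt_EI; apply: rank_leq_col.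
exists (fun i => v 0 (enum_rank i)).
  by have /rV0Pn[i vi] := v0; exists (enum_val i); rewrite enum_valK.
move=> e; have := congr1 (fun A : 'rV[K]_#|E| => A 0 (enum_rank e)) vN0.
rewrite !mxE; apply: etrans.
rewrite (reindex (@enum_val I I)) /=; last first.
  by exists enum_rank => i _; rewrite ?enum_valK ?enum_rankK.
by apply: eq_bigr => i _; rewrite !mxE enum_valK enum_rankK.
Qed.

Section Bivariate.
Variable K : comNzRingType.
Implicit Types (F G : {poly {poly K}}) (p : K * K).

Definition ev F p : K := F.[p.2%:P].[p.1].

Lemma evD F G p : ev (F + G) p = ev F p + ev G p.
Proof. by rewrite /ev !hornerE. Qed.

Lemma evM F G p : ev (F * G) p = ev F p * ev G p.
Proof. by rewrite /ev !hornerE. Qed.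

Lemma evC c p : ev c%:P p = c.[p.1].
Proof. by rewrite /ev !hornerE. Qed.

Lemma evCC c p : ev c%:P%:P p = c.
Proof. by rewrite /ev !hornerE. Qed.

Lemma ev_X p : ev 'X p = p.2.
Proof. by rewrite /ev !hornerE. Qed.

Lemma evZ c F p : ev (c *: F) p = c.[p.1] * ev F p.
Proof. by rewrite -mul_polyC evM evC. Qed.

Lemma evN F p : ev (- F) p = - ev F p.
Proof. by rewrite /ev !hornerE. Qed.

Lemma ev_sum I (r : seq I) (P : pred I) (F : I -> {poly {poly K}}) p :
  ev (\sum_(i <- r | P i) F i) p = \sum_(i <- r | P i) ev (F i) p.
Proof. by rewrite /ev !horner_sum. Qed.

Lemma ev_prod I (r : seq I) (P : pred I) (F : I -> {poly {poly K}}) p :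
  ev (\prod_(i <- r | P i) F i) p = \prod_(i <- r | P i) ev (F i) p.
Proof. by rewrite /ev !horner_prod. Qed.

Lemma evX F n p : ev (F ^+ n) p = ev F p ^+ n.
Proof. by rewrite /ev !hornerE. Qed.

Definition mono (a : nat * nat) : {poly {poly K}} := ('X^(a.1))%:P * 'X^(a.2).

Lemma coef_mono a i j : (mono a)`_j`_i = (a == (i, j))%:R.
Proof.
case: a => a b; rewrite /mono coefCM coefXn /= xpair_eqE [b == j]eq_sym.
by case: eqP => _; rewrite ?mulr1 ?mulr0 ?coefXn ?coef0 ?andbT ?andbF 1?eq_sym.
Qed.

Lemma coefC_mono c a i j : (c%:P%:P * mono a)`_j`_i = c * (a == (i, j))%:R.
Proof. by rewrite 2!coefCM coef_mono. Qed.

Lemma ev_mono a p : ev (mono a) p = p.1 ^+ a.1 * p.2 ^+ a.2.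
Proof. by rewrite /mono evM evC evX ev_X hornerXn. Qed.

Lemma bipoly_eq F G : (forall i j, F`_j`_i = G`_j`_i) -> F = G.
Proof. by move=> eFG; apply/polyP => j; apply/polyP => i. Qed.

(* Weighted degree bound: the inner variable has weight 1, the outer one
   weight [w]. *)
Definition wdeg_le (w k : nat) F :=
  forall i j, (k < i + w * j)%N -> F`_j`_i = 0.

Lemma wdeg_le0 w k : wdeg_le w k 0.
Proof. by move=> i j _; rewrite !coef0. Qed.

Lemma wdeg_leD w k F G : wdeg_le w k F -> wdeg_le w k G -> wdeg_le w k (F + G).
Proof. by move=> hF hG i j h; rewrite !coefD hF ?hG ?addr0. Qed.

Lemma wdeg_leN w k F : wdeg_le w k F -> wdeg_le w k (- F).
Proof. by move=> hF i j h; rewrite !coefN hF ?oppr0. Qed.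

Lemma wdeg_leM w k l F G :
  wdeg_le w k F -> wdeg_le w l G -> wdeg_le w (k + l) (F * G).
Proof.
move=> hF hG i j h; rewrite coefM coef_sum big1 // => -[b /= b_lt] _.
rewrite coefM big1 // => -[a /= a_lt] _.
case: (ltnP k (a + w * b)) => [/hF->|ha]; first by rewrite mul0r.
rewrite hG ?mulr0 // -(ltn_add2l k) (leq_trans h) //.
have -> : (i + w * j = (a + w * b) + (i - a + w * (j - b)))%N by nia.
by rewrite leq_add2r.
Qed.

Lemma wdeg_leW w k l F : (k <= l)%N -> wdeg_le w k F -> wdeg_le w l F.
Proof. by move=> kl hF i j h; apply: hF; apply: leq_ltn_trans h. Qed.

Lemma wdeg_le1 w : wdeg_le w 0 1.
Proof.
move=> i [|j] h; rewrite coef1 /= ?coef0 // coef1.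
by case: i h => //; rewrite muln0.
Qed.

Lemma wdeg_leX w k n F : wdeg_le w k F -> wdeg_le w (k * n) (F ^+ n).
Proof.
move=> hF; elim: n => [|n IH]; first by rewrite muln0; apply: wdeg_le1.
by rewrite exprS mulnS; apply: wdeg_leM.
Qed.

Lemma wdeg_le_sum w k I (r : seq I) (P : pred I) (F : I -> {poly {poly K}}) :
  (forall i, P i -> wdeg_le w k (F i)) -> wdeg_le w k (\sum_(i <- r | P i) F i).
Proof.
by move=> hF; elim/big_rec: _ => [|i x Pi]; [apply: wdeg_le0|
  apply: wdeg_leD; apply: hF].
Qed.

Lemma wdeg_leC w c : wdeg_le w 0 c%:P%:P.
Proof.
by move=> i [|j] h; rewrite coefC /= ?coef0 // coefC; case: i h => //; rewrite muln0.
Qed.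

Lemma wdeg_leCM w k c F : wdeg_le w k F -> wdeg_le w k (c%:P%:P * F).
Proof. by move=> hF; rewrite -[k]add0n; apply: wdeg_leM => //; apply: wdeg_leC. Qed.

Lemma wdeg_le_mono w a : wdeg_le w (a.1 + w * a.2) (mono a).
Proof.
move=> i j h; rewrite coef_mono; case: eqP => // e; move: h.
by rewrite e /= ltnn.
Qed.

Lemma wdeg_le_outer w : wdeg_le w w 'X.
Proof.
have -> : 'X = mono (0%N, 1%N) by rewrite /mono expr0 expr1 mul1r.
by move=> i j h; apply: (@wdeg_le_mono w (0%N, 1%N)); rewrite /= muln1.
Qed.

Lemma wdeg_le_inner w : wdeg_le w 1 ('X)%:P.
Proof.
have -> : ('X)%:P = mono (1%N, 0%N) by rewrite /mono expr0 expr1 mulr1.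
by move=> i j h; apply: (@wdeg_le_mono w (1%N, 0%N)); rewrite /= muln0.
Qed.

Lemma wdeg_leB w k F G : wdeg_le w k F -> wdeg_le w k G -> wdeg_le w k (F - G).
Proof. by move=> hF hG; apply: wdeg_leD => //; apply: wdeg_leN. Qed.

Lemma wdeg_le_prod w k I (r : seq I) (P : pred I) (F : I -> {poly {poly K}}) :
  (forall i, P i -> wdeg_le w k (F i)) ->
  wdeg_le w (k * count P r) (\prod_(i <- r | P i) F i).
Proof.
move=> hF; elim: r => [|a r IH]; first by rewrite big_nil muln0; apply: wdeg_le1.
rewrite big_cons /=; case: ifP => Pa; last by rewrite add0n.
by rewrite add1n mulnS; apply: wdeg_leM => //; apply: hF.
Qed.

End Bivariate.

Notation tdeg_le := (wdeg_le 1).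
Notation wt_le := (wdeg_le 3).

(** * Dimension counts and a substitute for Bezout's theorem *)

Section Counting.
Variable K : closedFieldType.
Implicit Types (F G : {poly {poly K}}) (p : K * K).

(** The sigma type indexes the exponents (i, j) with i + j <= k, a basis of the polynomials of
    degree at most [k]. *)
Lemma card_triangle k :
  #|{: {i : 'I_k.+1 & 'I_(k - i).+1}}| = (\sum_(i < k.+1) i.+1)%N.
Proof.
rewrite card_tagged sumnE big_map big_enum /=.
rewrite (reindex_inj rev_ord_inj) /=; apply: eq_bigr => i _.
by rewrite card_ord subSS subKn // -ltnS.
Qed.

(** The triangle of size d + e exceeds that of size e by d diagonals of at most d + e + 1 exponents.
    The smaller triangle accounts for the multiples of a polynomial of degree d. *)
Lemma card_triangle_le d e :
  (#|{: {i : 'I_(d + e).+1 & 'I_(d + e - i).+1}}|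
     <= #|{: {i : 'I_e.+1 & 'I_(e - i).+1}}| + d * (d + e).+1)%N.
Proof.
rewrite !card_triangle; elim: d => [|d IH]; first by rewrite addn0.
rewrite addSn big_ord_recr /=; move: IH; set s := \sum_(i < _) _; set s' := \sum_(i < _) _.
nia.
Qed.

(* That is, polynomials of degree at most [k] restricted to [f = 0] span a space
   of dimension at most [d * (k + 1)]. *)
Lemma dependent_mod d k f (I : finType) (F : I -> {poly {poly K}}) :
  f != 0 -> tdeg_le d f -> (d <= k)%N -> (forall i, tdeg_le k (F i)) ->
  (d * k.+1 < #|I|)%N ->
  exists2 c : I -> K, exists i, c i != 0 &
    exists G, \sum_i (c i)%:P%:P * F i = f * G.
Proof.
move=> f0 fd dk Fk cI; pose e := (k - d)%N.
have ek : k = (d + e)%N by rewrite subnKC.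
pose T n := {i : 'I_n.+1 & 'I_(n - i).+1}.
pose pos n (t : T n) : nat * nat := (tag t : nat, tagged t : nat).
have posk n (t : T n) : ((pos n t).1 + 1 * (pos n t).2 <= n)%N.
  case: t => i j /=; have := ltn_ord i; have := ltn_ord j; lia.
have posS n i j : (i + 1 * j <= n)%N -> exists t : T n, pos n t = (i, j).
  move=> h; have hi : (i < n.+1)%N by lia.
  have hj : (j < (n - Ordinal hi).+1)%N by rewrite /=; lia.
  by exists (Tagged (fun i : 'I_n.+1 => 'I_(n - i).+1) (Ordinal hj)).
have posI n (s t : T n) : pos n s = pos n t -> s = t.
  case: s t => i j [i' j'] /= [/val_inj ei]; case: i' / ei j' => j' /val_inj ej.
  by rewrite ej.
(* The coefficients of the quotient [G] are unknowns too: one linear system in the [c i] and in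
   these, with an equation for each exponent of degree at most [k]. *)
pose c' (x : I + T e) : {poly {poly K}} :=
  match x with inl i => F i | inr s => - (f * mono K (pos e s)) end.
have [|c [x cx] c0] := @dependent_rows K (I + T e)%type (T k)
    (fun x t => (c' x)`_(pos k t).2`_(pos k t).1).
  have h := card_triangle_le d e; rewrite -ek in h.
  by rewrite card_sum addnC; apply: leq_ltn_trans h _; rewrite ltn_add2l.
have sum0 : \sum_x (c x)%:P%:P * c' x = 0.
  apply: bipoly_eq => i j; rewrite !coef0.
  have deg : tdeg_le k (\sum_x (c x)%:P%:P * c' x).
    apply: wdeg_le_sum => y _; apply: wdeg_leCM; case: y => [y|s] //=.
    apply: wdeg_leN; rewrite ek; apply: wdeg_leM => //.
    by apply: (@wdeg_leW _ _ _ _ _ _ (@wdeg_le_mono _ 1 (pos e s))); apply: posk.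
  case: (ltnP k (i + 1 * j)) => [/deg //|/posS[t et]].
  rewrite !coef_sum -[RHS](c0 t) et /=.
  by apply: eq_bigr => y _; rewrite !coefCM.
have {}sum0 : \sum_i (c (inl i))%:P%:P * F i =
    f * \sum_s (c (inr s))%:P%:P * mono K (pos e s).
  apply: subr0_eq; rewrite -[RHS]sum0 big_sumType /= mulr_sumr -sumrN.
  by congr (_ + _); apply: eq_bigr => s _; ring.
exists (fun i => c (inl i)); last by exists (\sum_s (c (inr s))%:P%:P * mono K (pos e s)).
case: (pickP (fun i => c (inl i) != 0)) => [i ci|c_0]; first by exists i.
(* If all [c i] vanished, f times the quotient would be 0; as f is nonzero, the coefficients of the
   quotient would vanish as well. *)
exfalso; move: cx sum0; rewrite big1; last first.
  by move=> i _; have /negbFE/eqP-> := c_0 i; rewrite mul0r.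
case: x => [i|s cs /esym/eqP]; first by rewrite c_0.
rewrite mulf_eq0 (negPf f0) /= => /eqP /(congr1 (fun P : {poly {poly K}} => P`_(pos e s).2`_(pos e s).1)).
have coef_pos t : ((c (inr t))%:P%:P * mono K (pos e t))`_(pos e s).2`_(pos e s).1
    = c (inr t) * (t == s)%:R.
  rewrite coefC_mono; congr (_ * _%:R); congr nat_of_bool.
  by apply/eqP/eqP => [|->//]; rewrite -surjective_pairing => /posI.
rewrite !coef0 !coef_sum (bigD1 s) // big1 => [|t ne]; last first.
  by rewrite coef_pos (negPf ne) mulr0.
by rewrite coef_pos eqxx mulr1 Monoid.mulm1 => /eqP; rewrite (negPf cs).
Qed.

(** One linear factor for each other point: [l a b] defines a line through [a], parallel to a
    coordinate axis, that misses [b]. The axis depends on which coordinate separates the two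
    points. *)
Lemma interpolation n (y : 'I_n -> K * K) : injective y ->
  exists e : 'I_n -> {poly {poly K}},
  [/\ forall i, tdeg_le n (e i), forall i, ev (e i) (y i) != 0
    & forall i j, i != j -> ev (e i) (y j) = 0].
Proof.
move=> inj_y.
pose l (a b : K * K) : {poly {poly K}} :=
  if a.1 == b.1 then 'X - a.2%:P%:P else ('X - a.1%:P)%:P.
have l0 a b : ev (l a b) a = 0.
  by rewrite /l; case: ifP => _; rewrite /ev !hornerE subrr.
have lN a b : a != b -> ev (l a b) b != 0.
  case: a b => a1 a2 [b1 b2]; rewrite xpair_eqE /l /=; case: eqP => /= e ne;
  by rewrite /ev !hornerE subr_eq0 eq_sym //; apply/eqP.
have ld a b : tdeg_le 1 (l a b).
  have cst (k : K) : tdeg_le 1 k%:P%:P.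
    by apply: (@wdeg_leW _ _ 0) => //; apply: wdeg_leC.
  rewrite /l; case: ifP => _; rewrite ?polyCB.
    by apply: wdeg_leB; [apply: wdeg_le_outer|apply: cst].
  by apply: wdeg_leB; [apply: wdeg_le_inner|apply: cst].
exists (fun i => \prod_(j < n | j != i) l (y j) (y i)); split=> [i|i|i j ij].
- apply: wdeg_leW; last by apply: (wdeg_le_prod (k := 1)) => j _; apply: ld.
  rewrite mul1n (leq_trans (count_size _ _)) //.
  by rewrite /index_enum -enumT size_enum_ord.
- rewrite ev_prod; apply/prodf_neq0 => j ji; apply: lN.
  by apply: contra_neq ji => /inj_y.
- by rewrite eq_sym in ij; rewrite ev_prod (bigD1 j) //= l0 mul0r.
Qed.

(* If [Pi] is not a zero divisor among functions on [S], the products of its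
   powers with polynomials separating its zeros are independent on [S]. *)
Lemma zeros_bound d D f (S : K * K -> Prop) Pi n (y : 'I_n -> K * K) :
  f != 0 -> tdeg_le d f -> (forall p, S p -> ev f p = 0) ->
  tdeg_le D Pi ->
  (forall F, (forall p, S p -> ev (Pi * F) p = 0) -> forall p, S p -> ev F p = 0) ->
  injective y -> (forall i, S (y i)) -> (forall i, ev Pi (y i) = 0) ->
  (n <= d * D)%N.
Proof.
move=> f0 fd fS PiD Pireg inj_y yS Piy; rewrite leqNgt; apply/negP => lt_n.
have [e [ed e0 eN]] := interpolation inj_y.
(* If n > d D, the m n products below outnumber the dimension bound d (d + n + D m + 1) as soon as m
   > d (d + n + 1). *)
pose m := (d * (d + n).+1).+1.
pose F (x : 'I_m * 'I_n) := Pi ^+ x.1 * e x.2.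
have dk : (d <= d + n + D * m)%N by rewrite -addnA leq_addr.
have [[a i]||c [x cx] [G sumG]] :=
  @dependent_mod _ _ _ ('I_m * 'I_n)%type F f0 fd dk.
- apply: (@wdeg_leW _ _ (D * a + n)%N); first by have := ltn_ord a => /=; nia.
  by apply: wdeg_leM => //; apply: wdeg_leX.
- rewrite card_prod !card_ord /m; nia.
(* Induction on the power of [Pi]: once the lower coefficients vanish, Pi^a factors out of the
   relation and is cancelled by [Pireg]. Evaluation at [y i] then leaves the single term c (a, i)
   e_i(y_i). *)
have c0 a : forall i : 'I_n, forall h : (a < m)%N, c (Ordinal h, i) = 0.
  elim/ltn_ind: a => a IH i h.
  pose R := \sum_(x : 'I_m * 'I_n | (a <= x.1)%N)
               (c x)%:P%:P * (Pi ^+ (x.1 - a) * e x.2).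
  have RS : forall p, S p -> ev R p = 0.
    have : forall p, S p -> ev (Pi ^+ a * R) p = 0.
      move=> p Sp; have -> : Pi ^+ a * R = f * G.
        rewrite -sumG mulr_sumr [RHS](bigID (fun x : 'I_m * 'I_n => a <= x.1)%N) /=.
        rewrite [X in _ = _ + X]big1 ?addr0 => [|[b j] /=]; last first.
          rewrite -ltnNge => /IH cb; have := cb j (ltn_ord b).
          rewrite (_ : Ordinal _ = b); last exact: val_inj.
          by move=> ->; rewrite mul0r.
        apply: eq_bigr => -[b j] /= ab.
        by rewrite /F /= -{2}(subnK ab) exprD; ring.
      by rewrite evM fS ?mul0r.
    elim: a {IH h} R => [|b IH] R RS p Sp; first by rewrite -(RS p Sp) expr0 mul1r.
    apply: Pireg Sp => q Sq; apply: (IH (Pi * R)) => // q' Sq'.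
    by rewrite mulrA -exprSr RS.
  have := RS _ (yS i); rewrite ev_sum (bigD1 (Ordinal h, i)) //= big1.
    rewrite subnn expr0 mul1r addr0 evM evCC => /eqP.
    by rewrite mulf_eq0 (negPf (e0 i)) orbF => /eqP.
  move=> [b j] /= /andP[ab ne]; rewrite evM evM evX Piy.
  case: (eqVneq (b : nat) a) => [eb|nb].
    rewrite eN ?mulr0 //; apply: contra_neq ne => ->; congr (_, _); exact: val_inj.
  by rewrite expr0n subn_eq0 leqNgt ltn_neqAle eq_sym nb ab /= mul0r mulr0.
case: x cx => a i; rewrite (_ : a = Ordinal (ltn_ord a)); last exact: val_inj.
by rewrite c0 eqxx.
Qed.

End Counting.

(** * Weighted relations between two functions on a curve *)

Lemma ex_min_nat (Q : nat -> Prop) : (exists n, Q n) ->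
  exists2 n, Q n & forall m, Q m -> (n <= m)%N.
Proof.
move=> [n0 Qn0]; have exQ : exists n, `[< Q n >] by exists n0; apply/asboolP.
case: (ex_minnP exQ) => n /asboolP Qn min_n; exists n => // m Qm.
by apply: min_n; apply/asboolP.
Qed.

Section Weight.
Variable K : fieldType.
Implicit Types (P Q U : {poly {poly K}}).

(* The coefficient of [T^n y^j] is that of [t^(n - 3j) y^j] in P: the degree in
   T is the weight. *)
Definition weighted P : {poly {poly K}} := swapXY (P \Po ('X^3 *: 'X)).

Lemma coef_weighted P n j :
  (weighted P)`_n`_j = if (n < 3 * j)%N then 0 else P`_j`_(n - 3 * j).
Proof.
rewrite /weighted coef_swapXY comp_polyE coef_sum.
rewrite (eq_bigr (fun i : 'I_(size P) => P`_i * 'X^(3 * i) * (j == i)%:R)); last first.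
  by move=> i _; rewrite exprZn -exprM coefZ coefZ coefXn mulrA.
case: (ltnP j (size P)) => hj.
  rewrite (bigD1 (Ordinal hj)) //= eqxx mulr1 big1 ?addr0 ?coefMXn // => i.
  by rewrite -val_eqE /= eq_sym => /negPf->; rewrite mulr0.
rewrite big1 => [|i _]; last first.
  by have := ltn_ord i; case: eqP => [<-|]; rewrite ?mulr0 // ltnNge hj.
by rewrite [P`_j]nth_default // !coef0; case: ifP.
Qed.

Lemma weightedM P Q : weighted (P * Q) = weighted P * weighted Q.
Proof. by rewrite /weighted comp_polyM rmorphM. Qed.

Lemma weighted_eq0 P : (weighted P == 0) = (P == 0).
Proof.
apply/eqP/eqP => [P0|->]; last by rewrite /weighted comp_poly0 rmorph0.
apply: bipoly_eq => i j; have := coef_weighted P (i + 3 * j) j.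
by rewrite P0 !coef0 ltnNge leq_addl addnK /= => <-.
Qed.

Definition weight P := (size (weighted P)).-1.
(** Among the monomials of largest weight, the top one has the largest power of y. This is a
    monomial order, so top monomials multiply. *)
Definition top_y P := (size (lead_coef (weighted P))).-1.
Definition top_t P := (weight P - 3 * top_y P)%N.

Lemma wt_le_weight P : wt_le (weight P) P.
Proof.
move=> i j lt_ij; have := coef_weighted P (i + 3 * j) j.
rewrite ltnNge leq_addl addnK /= => <-.
by rewrite [(weighted P)`__]nth_default ?coef0 //; exact: leq_trans (leqSpred _) lt_ij.
Qed.

Lemma top_coef P : P != 0 ->
  weight P = (top_t P + 3 * top_y P)%N /\ P`_(top_y P)`_(top_t P) != 0.
Proof.
move=> P0; have := coef_weighted P (weight P) (top_y P).
rewrite /weight /top_y -lead_coefE -lead_coefE.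
have w0 : lead_coef (lead_coef (weighted P)) != 0.
  by rewrite !lead_coef_eq0 weighted_eq0.
case: ltnP => [_ /eqP|le e]; first by rewrite (negPf w0).
by rewrite /top_t /weight /top_y subnK // -e.
Qed.

Lemma topM P U : U * P != 0 ->
  top_y (U * P) = (top_y U + top_y P)%N /\ weight (U * P) = (weight U + weight P)%N.
Proof.
rewrite mulf_eq0 negb_or => /andP[U0 P0].
rewrite /top_y /weight weightedM lead_coefM.
rewrite !size_mul ?lead_coef_eq0 ?weighted_eq0 //.
have pred_add a b : (0 < a)%N -> (0 < b)%N -> (a + b).-1.-1 = (a.-1 + b.-1)%N by lia.
by rewrite !pred_add // size_poly_gt0 ?lead_coef_eq0 weighted_eq0.
Qed.

(** The monomial found is the top monomial of the product. Consequently, a polynomial supported off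
    the multiples of the top monomial of [P] is not a nonzero multiple of [P]. *)
Lemma multiple_top_coef P U : U * P != 0 ->
  exists i j, [/\ (top_t P <= i)%N, (top_y P <= j)%N & (U * P)`_j`_i != 0].
Proof.
move=> UP0; have [e1 e2] := topM UP0; have [e3 c0] := top_coef UP0.
move: (UP0); rewrite mulf_eq0 negb_or => /andP[U0 P0].
have [eU _] := top_coef U0; have [eP _] := top_coef P0.
by exists (top_t (U * P)), (top_y (U * P)); split=> //; lia.
Qed.

End Weight.

Section Gauss.
Variable K : closedFieldType.
Implicit Types (P Q U : {poly {poly K}}).

Lemma vanishing_fiber U a : map_poly (horner_eval a) U = 0 ->
  exists U', U = ('X - a%:P) *: U'.
Proof.
move=> U0; exists (\poly_(j < size U) (U`_j %/ ('X - a%:P))).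
apply/polyP => j; rewrite coefZ coef_poly.
case: ltnP => hj; last by rewrite mulr0 nth_default.
rewrite mulrC divpK // dvdp_XsubCl; apply/rootP.
by have := congr1 (fun V : {poly K} => V`_j) U0; rewrite coef_map coef0.
Qed.

(** Gauss's lemma. Over an algebraically closed field, [P] is primitive when it vanishes identically
    on no line t = a. The linear factors of [c] are cancelled one by one: at a root a of [c] the
    product U P vanishes on the line t = a, hence so does U, which is then divisible by t - a. *)
Lemma gauss_dvd P Q U c :
  (forall a, map_poly (horner_eval a) P != 0) -> c != 0 -> c *: Q = U * P ->
  exists U', Q = U' * P.
Proof.
move=> primP; elim: {c}(size c) {-2}c (leqnn (size c)) U => [|n IH] c cn U c0 e.
  by move: cn; rewrite leqn0 size_poly_eq0 (negPf c0).
have [c1|] := boolP (size c == 1%N).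
  have /size_poly1P[k k0 ck] := c1.
  exists ((k^-1)%:P *: U); rewrite -scalerAl -e scalerA ck -polyCM mulVf //.
  by rewrite scale1r.
move=> /closed_rootP[a /factor_theorem[c' ec]].
have c'0 : c' != 0 by apply: contra_neq c0; rewrite ec => ->; rewrite mul0r.
have : map_poly (horner_eval a) U * map_poly (horner_eval a) P = 0.
  rewrite -rmorphM -e ec -mul_polyC rmorphM /= map_polyC /= /horner_eval.
  by rewrite !hornerE subrr mulr0 mul0r.
move=> /eqP; rewrite mulf_eq0 (negPf (primP a)) orbF => /eqP/vanishing_fiber[U' eU].
apply: (IH c' _ U') => //.
  by move: cn; rewrite ec size_Mmonic ?monicXsubC // size_XsubC addn2.
have Xa0 : ('X - a%:P)%:P != 0 :> {poly {poly K}} by rewrite polyC_eq0 polyXsubC_eq0.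
apply: (mulfI Xa0); rewrite !mul_polyC.
by rewrite scalerA mulrC -ec e eU scalerAl.
Qed.

End Gauss.

(** * The ideal of relations between the slope and phi *)

Section Relations.
Variable K : closedFieldType.
Implicit Types (P Q U F : {poly {poly K}}) (p : K * K).

Lemma ev_wide n P p : (size P <= n)%N -> (forall j, size (P`_j)%R <= n)%N ->
  ev P p = \sum_(j < n) \sum_(i < n) P`_j`_i * p.1 ^+ i * p.2 ^+ j.
Proof.
move=> sP sPj; rewrite /ev (horner_coef_wide _ sP) horner_sum.
apply: eq_bigr => j _; rewrite !hornerE.
by rewrite (horner_coef_wide _ (sPj j)) mulr_suml.
Qed.

Lemma wt_le_size k P : wt_le k P ->
  (size P <= k.+1)%N /\ forall j, (size (P`_j)%R <= k.+1)%N.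
Proof.
move=> Pk; split=> [|j]; apply/leq_sizeP => i ki.
  by apply/polyP => m; rewrite coef0 Pk //; lia.
by rewrite Pk //; lia.
Qed.

Variables (d : nat) (f A B W : {poly {poly K}}) (S : K * K -> Prop).

(* The slope t = A / B and phi = W / B^3. *)
Definition chart_point p : K * K := (ev A p / ev B p, ev W p / ev B p ^+ 3).

(** This is B^k P(A / B, W / B^3) with denominators cleared. The truncated exponent of [B] is
    harmless under [wt_le k P], where the terms of larger weight have coefficient 0. *)
Definition homog k P : {poly {poly K}} :=
  \sum_(j < k.+1) \sum_(i < k.+1)
    (P`_j`_i)%:P%:P * (A ^+ i * W ^+ j * B ^+ (k - (i + 3 * j))).

Lemma ev_homog k P p : wt_le k P -> ev B p != 0 ->
  ev (homog k P) p = ev B p ^+ k * ev P (chart_point p).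
Proof.
move=> Pk B0; have [s1 s2] := wt_le_size Pk.
rewrite (ev_wide _ s1 s2) ev_sum mulr_sumr; apply: eq_bigr => j _.
rewrite ev_sum mulr_sumr; apply: eq_bigr => i _.
rewrite evM evCC /=; case: (ltnP k (i + 3 * j)) => [/Pk->|h].
  by rewrite !mul0r mulr0.
rewrite !evM !evX; move: (nat_of_ord i) (nat_of_ord j) h => i' j' h.
by rewrite -{2}(subnK h) exprD exprD !expr_div_n exprM; field; rewrite !expf_neq0.
Qed.

Hypotheses (Ad : tdeg_le d A) (Bd : tdeg_le d B) (Wd : tdeg_le (3 * d) W).

Lemma tdeg_monomial k i j : (i + 3 * j <= k)%N ->
  tdeg_le (d * k) (A ^+ i * W ^+ j * B ^+ (k - (i + 3 * j))).
Proof.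
move=> h; apply: (@wdeg_leW _ _ (d * i + 3 * d * j + d * (k - (i + 3 * j)))).
  nia.
by apply: wdeg_leM; [apply: wdeg_leM|]; apply: wdeg_leX.
Qed.

Lemma tdeg_homog k P : wt_le k P -> tdeg_le (d * k) (homog k P).
Proof.
move=> Pk; apply: wdeg_le_sum => j _; apply: wdeg_le_sum => i _.
case: (ltnP k (i + 3 * j)) => [/Pk->|h].
  by rewrite !polyC0 mul0r; apply: wdeg_le0.
by apply: wdeg_leCM; apply: tdeg_monomial.
Qed.

Hypotheses (f0 : f != 0) (fd : tdeg_le d f) (fS : forall p, S p -> ev f p = 0).
(** Plays the part of irreducibility. The conclusion holds on all of [S], also where [B] vanishes
    and the slope is infinite. *)
Hypothesis torsion_free : forall (r : {poly K}) F, r != 0 ->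
  (forall p, S p -> ev B p != 0 -> r.[ev A p / ev B p] * ev F p = 0) ->
  forall p, S p -> ev F p = 0.

Definition relation P := forall p, S p -> ev B p != 0 -> ev P (chart_point p) = 0.

(** [homog] turns [P] into a polynomial in z and w, to which [torsion_free] applies. *)
Lemma relation_torsion r P : r != 0 -> relation (r *: P) -> relation P.
Proof.
move=> r0 rP p Sp B0.
have Pk := @wt_le_weight _ P; set k := weight P in Pk.
have hP : ev (homog k P) p = 0.
  apply: (torsion_free r0) Sp => q Sq Bq0; rewrite ev_homog // mulrCA.
  by have := rP q Sq Bq0; rewrite evZ /= => ->; rewrite mulr0.
move: hP; rewrite ev_homog // => /eqP; rewrite mulf_eq0 expf_eq0.
by rewrite (negPf B0) andbF => /eqP.
Qed.

(** Multiplied by B^k, a monomial of weight at most [k] in t and phi becomes a polynomial of degree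
    at most d k in z and w, so [dependent_mod] applies to any large enough set of exponents.
    Prescribing the support is what later allows multiples of the top monomial to be avoided. *)
Lemma dependent_relation k (I : finType) (pos : I -> nat * nat) :
  injective pos -> (forall x, (pos x).1 + 3 * (pos x).2 <= k)%N ->
  (0 < k)%N -> (d * (d * k).+1 < #|I|)%N ->
  exists P, [/\ relation P, P != 0 &
    forall i j, P`_j`_i != 0 -> exists x, pos x = (i, j)].
Proof.
move=> inj_pos posk k0 cI.
pose F x := A ^+ (pos x).1 * W ^+ (pos x).2 * B ^+ (k - ((pos x).1 + 3 * (pos x).2)).
have [|x|c [x cx] [G e]] := @dependent_mod _ d (d * k) f I F f0 fd _ _ cI.
- by rewrite leq_pmulr.
- exact: tdeg_monomial.
pose P := \sum_x (c x)%:P%:P * mono K (pos x).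
have coefP i j : P`_j`_i = \sum_x c x * (pos x == (i, j))%:R.
  by rewrite !coef_sum; apply: eq_bigr => y _; rewrite coefC_mono.
exists P; split=> [p Sp B0||i j].
- rewrite ev_sum; apply: (mulfI (expf_neq0 k B0)); rewrite mulr0.
  transitivity (ev (f * G) p); last by rewrite evM fS ?mul0r.
  rewrite -e ev_sum mulr_sumr; apply: eq_bigr => y _.
  rewrite evM [in RHS]evM !evCC ev_mono /F !evM !evX /=.
  by rewrite -{1}(subnK (posk y)) exprD exprD !expr_div_n exprM; field; rewrite !expf_neq0.
- apply: contra_neq cx => P0; have := coefP (pos x).1 (pos x).2.
  rewrite P0 !coef0 (bigD1 x) //= -surjective_pairing eqxx mulr1 big1 ?addr0 //.
  by move=> y yx; rewrite (inj_eq inj_pos) (negPf yx) mulr0.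
- rewrite coefP => ne0; case: (pickP (fun y => pos y == (i, j))) => [y /eqP|none].
    by exists y.
  by case/eqP: ne0; rewrite big1 // => y _; rewrite none mulr0.
Qed.

Hypothesis d0 : (0 < d)%N.

Lemma relation_nonzero : exists2 P, relation P & P != 0.
Proof.
(* With this [n], the 3 n^2 exponents below, all of weight at most 6 n, outnumber d (6 d n + 1). *)
pose n := (3 * d ^ 2).+1.
pose pos (x : 'I_(3 * n) * 'I_n) : nat * nat := (x.1 : nat, x.2 : nat).
have [||||P [rP P0 _]] := @dependent_relation (6 * n) _ pos; last by exists P.
- by move=> [i j] [i' j'] [/val_inj-> /val_inj->].
- by move=> [i j] /=; have := ltn_ord i; have := ltn_ord j; lia.
- by rewrite /n; lia.
- rewrite card_prod !card_ord /n; nia.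
Qed.

(** [P] has least degree in y and, among those, a leading coefficient of least degree in t. It is
    primitive, since by [relation_torsion] a factor t - a could be removed. The pseudo-remainder of
    a relation by [P] is a relation of smaller y-degree, hence 0, and [gauss_dvd] removes the power
    of the leading coefficient. *)
Lemma relation_generator : exists P, [/\ relation P, P != 0 &
  forall Q, relation Q -> exists U, Q = U * P].
Proof.
have [P0 rP0 P00] := relation_nonzero.
have [|n [P1 [rP1 P10 sP1]] min_n] :=
  @ex_min_nat (fun n => exists P, [/\ relation P, P != 0 & size P = n]).
  by exists (size P0), P0.
have [|m [P [rP Pn0 sP lP]] min_m] := @ex_min_nat (fun m => exists P,
    [/\ relation P, P != 0, size P = n & size (lead_coef P) = m]).
  by exists (size (lead_coef P1)), P1.
exists P; split=> // Q rQ.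
have prim a : map_poly (horner_eval a) P != 0.
  apply/eqP => /vanishing_fiber[P' eP].
  have Xa0 : 'X - a%:P != 0 by rewrite polyXsubC_eq0.
  have P'0 : P' != 0 by apply: contra_neq Pn0; rewrite eP => ->; rewrite scaler0.
  have eP' : P = ('X - a%:P)%:P * P' by rewrite mul_polyC.
  have Xa0' : ('X - a%:P)%:P != 0 :> {poly {poly K}} by rewrite polyC_eq0.
  have /min_m : exists P, [/\ relation P, P != 0, size P = n
      & size (lead_coef P) = size (lead_coef P')].
    exists P'; split=> //; first by apply: relation_torsion Xa0 _; rewrite -eP.
    by rewrite -sP eP' size_Cmul.
  rewrite -lP eP' lead_coefM lead_coefC size_monicM ?lead_coef_eq0 ?monicXsubC //.
  by rewrite size_XsubC ltnn.
have c0 : lead_coef P ^+ Pdiv.Idomain.scalp Q P != 0 by rewrite expf_neq0 ?lead_coef_eq0.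
apply: (gauss_dvd prim c0); rewrite Pdiv.Idomain.divp_eq.
suff -> : Pdiv.Idomain.modp Q P = 0 by rewrite addr0.
apply/eqP; apply: contraT => R0.
have /min_n : exists P', [/\ relation P', P' != 0 &
    size P' = size (Pdiv.Idomain.modp Q P)].
  exists (Pdiv.Idomain.modp Q P); split=> // p Sp B0.
  have := congr1 (fun F => ev F (chart_point p)) (Pdiv.Idomain.divp_eq Q P).
  by rewrite evD evM evZ rP // rQ // !mulr0 add0r => <-.
by rewrite -sP leqNgt ltn_modp Pn0.
Qed.

(* The restrictions to [S] of the monomials not divisible by the top monomial
   of the generator are independent; comparing their number with
   [dependent_mod] bounds the weight of the generator. *)
Lemma relation_weight : exists P M,
  [/\ relation P, P != 0, wt_le M P & (M <= 3 * d ^ 2)%N].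
Proof.
have [P [rP P0 genP]] := relation_generator.
exists P, (weight P); split=> //; first exact: wt_le_weight.
have [eM _] := top_coef P0; rewrite leqNgt; apply/negP => lt_M.
set a := top_t P in eM; set b := top_y P in eM.
(* The exponents (i, j) with i < a or j < b contain two rectangles, of weight at most 3 x and total
   size x (a + 3 b) - (a^2 + 3 b^2 + a b). As a + 3 b > 3 d^2, this exceeds d (3 d x + 1) once x >
   a^2 + 3 b^2 + a b + d; the additional a + b keeps the truncated subtractions exact. *)
pose x := (a ^ 2 + 3 * b ^ 2 + a * b + d + a + b + 1)%N.
pose I := (('I_a * 'I_(x - a)) + ('I_(3 * (x - b) - a) * 'I_b))%type.
pose pos (u : I) : nat * nat := match u with
  | inl v => (v.1 : nat, v.2 : nat) | inr v => ((a + v.1)%N, v.2 : nat) end.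
have [|u||| Q [rQ Q0 suppQ]] := @dependent_relation (3 * x) I pos.
- move=> [[i j]|[i j]] [[i' j']|[i' j']] /= [].
  + by move=> /val_inj-> /val_inj->.
  + by move=> e; have := ltn_ord i; rewrite e ltnNge leq_addr.
  + by move=> e; have := ltn_ord i'; rewrite -e ltnNge leq_addr.
  + by move=> /eqP; rewrite eqn_add2l => /eqP/val_inj-> /val_inj->.
- case: u => -[i j] /=; have := ltn_ord i; have := ltn_ord j; rewrite /x; nia.
- by rewrite /x; lia.
- rewrite card_sum !card_prod !card_ord.
  have h1 : (3 * d ^ 2 + 1 <= a + 3 * b)%N by rewrite addn1 -eM.
  have -> : (a * (x - a) + (3 * (x - b) - a) * b =
     x * (a + 3 * b) - (a ^ 2 + 3 * b ^ 2 + a * b))%N by rewrite /x; nia.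
  have : (x * (3 * d ^ 2 + 1) <= x * (a + 3 * b))%N by rewrite leq_mul2l h1 orbT.
  rewrite /x; nia.
have [U eQ] := genP Q rQ; rewrite eQ in Q0 suppQ.
have [i [j [ai bj /suppQ[[[i' j']|[i' j']] /= [ei ej]]]]] := multiple_top_coef Q0.
  by have := ltn_ord i'; rewrite ei ltnNge ai.
by have := ltn_ord j'; rewrite ej ltnNge bj.
Qed.

End Relations.

(** * Reflected polynomials *)

Section Reflected.
Variable C : numClosedFieldType.
Implicit Types (P Q U V : {poly {poly C}}) (e t : C) (p : C * C).

Lemma wt_le_comp k P E : wt_le k P -> wt_le 3 E -> wt_le k (P \Po E).
Proof.
move=> Pk E3; rewrite comp_polyE; apply: wdeg_le_sum => j _.
rewrite -mul_polyC; case: (leqP (3 * j) k) => hj.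
  rewrite -(subnK hj); apply: wdeg_leM; last exact: wdeg_leX.
  move=> i [|l] h; rewrite coefC /= ?coef0 //.
  by apply: Pk; move: h; rewrite muln0 addn0 ltn_subLR 1?addnC.
have -> : P`_j = 0 by apply/polyP => i; rewrite coef0 Pk // ltn_addl.
by rewrite polyC0 mul0r; apply: wdeg_le0.
Qed.

Definition conj_poly P : {poly {poly C}} := map_poly (map_poly Num.conj) P.

(* At a real parameter [t], the reflection of the root set of P(t, .) in the
   line [Re y = e / 2]. *)
Definition reflected e P := conj_poly P \Po (e%:P%:P - 'X).

Lemma coef_conj_poly P i j : (conj_poly P)`_j`_i = (P`_j`_i)^*.
Proof. by rewrite !coef_map. Qed.

Lemma ev_conj_poly P p : ev (conj_poly P) (p.1^*, p.2^*) = (ev P p)^*.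
Proof.
rewrite /ev /conj_poly /=.
have -> : (p.2^*)%:P = map_poly Num.conj (p.2)%:P :> {poly C} by rewrite map_polyC.
by rewrite horner_map horner_map.
Qed.

Lemma ev_reflected e P p : ev (reflected e P) p = ev (conj_poly P) (p.1, e - p.2).
Proof. by rewrite /ev /reflected horner_comp !hornerE /= polyCB. Qed.

Lemma wt_reflected k e P : wt_le k P -> wt_le k (reflected e P).
Proof.
move=> Pk; apply: wt_le_comp => [i j h|]; first by rewrite coef_conj_poly Pk ?conjC0.
apply: wdeg_leB; last exact: wdeg_le_outer.
by apply: (@wdeg_leW _ _ 0) => //; apply: wdeg_leC.
Qed.

(** Fix t where the leading coefficients of [P] and of its conjugate are nonzero. A common root y of
    the two fibres gives e = y + (e - y), a sum of a root of P(t, .) and a root of the conjugate,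
    which leaves finitely many bad [e]. Otherwise the resultant is nonzero at t, and it lies in the
    ideal of the two polynomials. *)
Lemma reflected_coprime P : (1 < size P)%N -> exists bad : seq C,
  forall e, e \notin bad -> exists r U V, r != 0 /\ U * P + V * reflected e P = r%:P.
Proof.
move=> sP; have P0 : P != 0 by rewrite -size_poly_gt0 ltnW.
have cP0 : lead_coef (conj_poly P) != 0.
  by rewrite /conj_poly lead_coef_map_id0 ?map_poly_eq0 ?rmorph0 ?lead_coef_eq0.
have scP : size (conj_poly P) = size P.
  by rewrite /conj_poly size_map_poly_id0 // map_poly_eq0 lead_coef_eq0.
have lP0 : lead_coef P != 0 by rewrite lead_coef_eq0.
have /closed_nonrootP[t] := mulf_neq0 lP0 cP0.
rewrite rootM negb_or => /andP[/rootP/eqP lP /rootP/eqP lcP].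
pose at_t Q : {poly C} := map_poly (horner_eval t) Q.
have atP0 : at_t P != 0 by rewrite -size_poly_gt0 size_map_poly_id0 ?size_poly_gt0.
have atcP0 : at_t (conj_poly P) != 0.
  by rewrite -size_poly_gt0 size_map_poly_id0 // scP ltnW.
have [rs eP] := closed_field_poly_normal (at_t P).
have [rcs ecP] := closed_field_poly_normal (at_t (conj_poly P)).
have mem_rs y : root (at_t P) y -> y \in rs.
  by rewrite eP rootZ ?lead_coef_eq0 // root_prod_XsubC.
have mem_rcs y : root (at_t (conj_poly P)) y -> y \in rcs.
  by rewrite ecP rootZ ?lead_coef_eq0 // root_prod_XsubC.
exists [seq a + b | a <- rs, b <- rcs] => e e_ok.
pose E : {poly {poly C}} := e%:P%:P - 'X.
have sE : size E = 2 by rewrite /E -opprB size_polyN size_XsubC.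
have lE : lead_coef E = -1 by rewrite /E -opprB lead_coefN lead_coefXsubC.
have leadQ : lead_coef (reflected e P) =
    lead_coef (conj_poly P) * (-1) ^+ (size P).-1.
  by rewrite /reflected lead_coef_comp ?sE // lE scP.
have sQ : size (reflected e P) = size P.
  by rewrite /reflected size_comp_poly2 ?sE.
have sQ1 : (1 < size (reflected e P))%N by rewrite sQ.
have [[U V] _ /= eUV] := resultant_in_ideal sP sQ1.
exists (resultant P (reflected e P)), U, V; split; last by rewrite -eUV.
have lQ : horner_eval t (lead_coef (reflected e P)) != 0.
  rewrite leadQ /horner_eval hornerM mulf_neq0 //.
  by rewrite -signr_odd; case: odd; rewrite ?expr0 ?expr1 ?hornerN !hornerC ?oppr_eq0 oner_eq0.
suff : horner_eval t (resultant P (reflected e P)) != 0.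
  by apply: contra_neq => ->; rewrite rmorph0.
rewrite map_resultant // resultant_eq0 -leqNgt.
suff /eqP-> : coprimep (at_t P) (at_t (reflected e P)) by [].
apply/Pdiv.ClosedField.coprimepP => y /mem_rs y_rs; move: e_ok; apply: contraNN.
have -> : at_t (reflected e P) = at_t (conj_poly P) \Po (e%:P - 'X).
  rewrite /at_t /reflected map_comp_poly rmorphB /= map_polyX map_polyC /=.
  by rewrite /horner_eval hornerC.
rewrite horner_comp !hornerE => /mem_rcs ye.
by apply/allpairsP; exists (y, e - y); split=> //=; rewrite addrC subrK.
Qed.

End Reflected.

(** * Complex-valued functions *)

Local Open Scope classical_set_scope.
Local Open Scope complex_scope.
Local Open Scope ring_scope.

Local Notation Re := complex.Re.
Local Notation Im := complex.Im.

Section ComplexParts.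
Variable R : realType.
Implicit Types x y : R[i].

Lemma cReD x y : Re (x + y) = Re x + Re y. Proof. by case: x y => ? ? []. Qed.
Lemma cImD x y : Im (x + y) = Im x + Im y. Proof. by case: x y => ? ? []. Qed.
Lemma cReN x : Re (- x) = - Re x. Proof. by case: x. Qed.
Lemma cImN x : Im (- x) = - Im x. Proof. by case: x. Qed.
Lemma cReM x y : Re (x * y) = Re x * Re y - Im x * Im y.
Proof. by case: x y => ? ? []. Qed.
Lemma cImM x y : Im (x * y) = Re x * Im y + Im x * Re y.
Proof. by case: x y => ? ? []. Qed.

Lemma complex_eqP x y : x = y <-> Re x = Re y /\ Im x = Im y.
Proof. by case: x y => a b [c d] /=; split=> [[-> ->]|[-> ->]]. Qed.

Definition sqnorm x : R := Re x ^+ 2 + Im x ^+ 2.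

Lemma sqnorm_ge0 x : 0 <= sqnorm x.
Proof. by rewrite addr_ge0 ?sqr_ge0. Qed.

Lemma sqnorm_eq0 x : (sqnorm x == 0) = (x == 0).
Proof. by rewrite /sqnorm paddr_eq0 ?sqr_ge0 // !sqrf_eq0 eq_complex. Qed.

Lemma sqnorm_gt0 x : (0 < sqnorm x) = (x != 0).
Proof. by rewrite lt_def sqnorm_eq0 sqnorm_ge0 andbT. Qed.

Lemma cReV x : Re x^-1 = Re x / sqnorm x. Proof. by case: x. Qed.
Lemma cImV x : Im x^-1 = - (Im x / sqnorm x). Proof. by case: x. Qed.

Lemma ln_normc x : ln (Normc.normc x) = 2^-1 * ln (sqnorm x).
Proof.
have -> : Normc.normc x = Num.sqrt (sqnorm x) by case: x.
have [->|q0] := eqVneq (sqnorm x) 0; first by rewrite sqrtr0 ln0 ?mulr0.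
have qp : 0 < sqnorm x by rewrite lt_def q0 sqnorm_ge0.
have {2}-> : sqnorm x = Num.sqrt (sqnorm x) ^+ 2 by rewrite sqr_sqrtr // ltW.
by rewrite lnXn ?sqrtr_gt0 //; lra.
Qed.

End ComplexParts.

Section ComplexDerivative.
Variables (R : realType) (V : normedModType R).
Implicit Types (u w : V -> R[i]) (x v : V) (du dw : R[i]).

Definition cderiv u x v du :=
  is_derive x v (fun y => Re (u y)) (Re du) /\
  is_derive x v (fun y => Im (u y)) (Im du).

Lemma cderiv_unique u x v du dw : cderiv u x v du -> cderiv u x v dw -> du = dw.
Proof.
move=> [[_ r1] [_ i1]] [[_ r2] [_ i2]]; apply/complex_eqP.
by rewrite -r1 -i1 -r2 -i2.
Qed.

Lemma cderiv_cst c x v : cderiv (fun=> c) x v 0.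
Proof. by split; apply: is_derive_cst. Qed.

Lemma cderivD u w x v du dw : cderiv u x v du -> cderiv w x v dw ->
  cderiv (fun y => u y + w y) x v (du + dw).
Proof.
move=> [u1 u2] [w1 w2]; split.
- rewrite cReD (_ : (fun _ => _) = (fun y => Re (u y)) + (fun y => Re (w y))).
    exact: is_deriveD.
  by apply/funext => y; rewrite cReD.
- rewrite cImD (_ : (fun _ => _) = (fun y => Im (u y)) + (fun y => Im (w y))).
    exact: is_deriveD.
  by apply/funext => y; rewrite cImD.
Qed.

Lemma cderivM u w x v du dw : cderiv u x v du -> cderiv w x v dw ->
  cderiv (fun y => u y * w y) x v (du * w x + u x * dw).
Proof.
move=> [u1 u2] [w1 w2]; split.
- rewrite (_ : (fun _ => _) = (fun y => Re (u y)) * (fun y => Re (w y)) -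
      (fun y => Im (u y)) * (fun y => Im (w y))); last first.
    by apply/funext => y; rewrite cReM.
  apply: (is_derive_eq (is_deriveB (is_deriveM u1 w1) (is_deriveM u2 w2))).
  by rewrite cReD !cReM /GRing.scale /=; ring.
- rewrite (_ : (fun _ => _) = (fun y => Re (u y)) * (fun y => Im (w y)) +
      (fun y => Im (u y)) * (fun y => Re (w y))); last first.
    by apply/funext => y; rewrite cImM.
  apply: (is_derive_eq (is_deriveD (is_deriveM u1 w2) (is_deriveM u2 w1))).
  by rewrite cImD !cImM /GRing.scale /=; ring.
Qed.

Lemma cderiv_horner (q : {poly R[i]}) u x v du : cderiv u x v du ->
  cderiv (fun y => q.[u y]) x v (q^`().[u x] * du).
Proof.
move=> ud; elim/poly_ind: q => [|q c IH].
  rewrite deriv0 horner0 mul0r (_ : (fun _ => _) = fun=> 0); first exact: cderiv_cst.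
  by apply/funext => y; rewrite horner0.
rewrite (_ : (fun _ => _) = fun y => q.[u y] * u y + c); last first.
  by apply/funext => y; rewrite hornerMXaddC.
have -> : (q * 'X + c%:P)^`().[u x] * du =
    (q^`().[u x] * du * u x + q.[u x] * du) + 0.
  by rewrite derivD derivM derivX derivC !hornerE; ring.
by apply: cderivD; [apply: cderivM|apply: cderiv_cst].
Qed.

End ComplexDerivative.

Section BivariateDerivatives.
Variable K : comNzRingType.
Implicit Types F G : {poly {poly K}}.

Definition dz F : {poly {poly K}} := map_poly (@deriv K) F.
Definition dw F : {poly {poly K}} := F^`().

Lemma coef_dz F i j : (dz F)`_j`_i = F`_j`_i.+1 *+ i.+1.
Proof. by rewrite /dz coef_map_id0 ?deriv0 // coef_deriv. Qed.

Lemma coef_dw F i j : (dw F)`_j`_i = F`_j.+1`_i *+ j.+1.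
Proof. by rewrite coef_deriv coefMn. Qed.

Lemma dz_MXaddC F c : dz (F * 'X + c%:P) = dz F * 'X + (c^`())%:P.
Proof.
apply/polyP => j; rewrite /dz coef_map_id0 ?deriv0 // !coefD !coefMX derivD.
by case: j => [|j] /=; rewrite ?coefC /= ?coef_map_id0 ?deriv0.
Qed.

End BivariateDerivatives.

Section ComplexDerivative2.
Variables (R : realType) (V : normedModType R).
Implicit Types (F : {poly {poly R[i]}}) (u w : V -> R[i]) (x v : V).

Lemma cderiv_ev F u w x v du dv : cderiv u x v du -> cderiv w x v dv ->
  cderiv (fun y => ev F (u y, w y)) x v
    (ev (dz F) (u x, w x) * du + ev (dw F) (u x, w x) * dv).
Proof.
move=> ud wd; elim/poly_ind: F => [|F c IH].
  rewrite /dz /dw map_poly0 deriv0 (_ : (fun _ => _) = fun=> 0).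
    by rewrite /ev !hornerE; apply: cderiv_cst.
  by apply/funext => y; rewrite /ev !hornerE.
rewrite (_ : (fun _ => _) = fun y => ev F (u y, w y) * w y + c.[u y]); last first.
  by apply/funext => y; rewrite evD evM ev_X evC.
rewrite dz_MXaddC /dw derivD derivM derivX derivC addr0 mulr1 !evD !evM ev_X evC /=.
have e : (ev (dz F) (u x, w x) * w x + c^`().[u x]) * du +
    (ev F^`() (u x, w x) * w x + ev F (u x, w x)) * dv =
  ((ev (dz F) (u x, w x) * du + ev (dw F) (u x, w x) * dv) * w x +
    ev F (u x, w x) * dv) + c^`().[u x] * du by rewrite /dw; ring.
rewrite e; apply: cderivD; last exact: cderiv_horner.
exact: cderivM.
Qed.

End ComplexDerivative2.

Section LineDerivative.
Variables (R : realType).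

Lemma is_derive_line (V W : normedModType R) (f : V -> W) x v df :
  is_derive x v f df <-> is_derive (0 : R) 1 (fun h => f (h *: v + x)) df.
Proof.
have e : (fun h => h^-1 *: ((f \o shift x) (h *: v) - f x)) =
    (fun h => h^-1 *: (((fun h => f (h *: v + x)) \o shift 0) (h *: 1) -
       (fun h => f (h *: v + x)) 0)).
  by apply/funext => h /=; rewrite addr0 scale0r add0r [_%:A]mulr1.
by split=> -[a b]; apply: DeriveDef; move: a b; rewrite /derivable /derive e.
Qed.

(** Locally log|u| is the real part of a branch of log u, whose derivative is u' / u; the
    computation goes through (1/2) log |u|^2. *)
Lemma is_derive_ln_normc (u : R -> R[i]) s du : cderiv u s 1 du -> u s != 0 ->
  is_derive s (1 : R) (fun h => ln (Normc.normc (u h))) (Re (du / u s)).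
Proof.
move=> [ru iu] us0.
pose q := (fun h => Re (u h)) * (fun h => Re (u h)) +
          (fun h => Im (u h)) * (fun h => Im (u h)).
have qE h : q h = sqnorm (u h) by rewrite /q /sqnorm !expr2.
rewrite (_ : (fun h => _) = (2^-1 : R) *: (@ln R \o q)); last first.
  by apply/funext => h; rewrite ln_normc -qE.
have q0 : 0 < q s by rewrite qE sqnorm_gt0.
have dq : is_derive s (1 : R) q (2 * (Re (u s) * Re du + Im (u s) * Im du)).
  apply: (is_derive_eq (is_deriveD (is_deriveM ru ru) (is_deriveM iu iu))).
  by rewrite /GRing.scale /=; ring.
have dl := is_derive1_ln q0.
have dc := is_derive1_comp dl dq.
apply: (is_derive_eq (is_deriveZ _ dc)); rewrite cReM cReV cImV -!qE /GRing.scale /=.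
by field; rewrite gt_eqF.
Qed.

End LineDerivative.

Section ComplexDifferentiable.
Variables (R : realType) (V : normedModType R).
Implicit Types (g h : V -> R[i]) (x : V).

Definition cdiff g x :=
  differentiable (fun y => Re (g y)) x /\ differentiable (fun y => Im (g y)) x.

Lemma cdiff_cst c x : cdiff (fun=> c) x.
Proof. by split; apply: differentiable_cst. Qed.

Lemma cdiffD g h x : cdiff g x -> cdiff h x -> cdiff (fun y => g y + h y) x.
Proof.
move=> [g1 g2] [h1 h2]; split.
- rewrite (_ : (fun _ => _) = (fun y => Re (g y)) + (fun y => Re (h y))).
    exact: differentiableD.
  by apply/funext => y; rewrite cReD.
- rewrite (_ : (fun _ => _) = (fun y => Im (g y)) + (fun y => Im (h y))).
    exact: differentiableD.
  by apply/funext => y; rewrite cImD.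
Qed.

Lemma cdiffM g h x : cdiff g x -> cdiff h x -> cdiff (fun y => g y * h y) x.
Proof.
move=> [g1 g2] [h1 h2]; split.
- rewrite (_ : (fun _ => _) = (fun y => Re (g y)) * (fun y => Re (h y)) -
      (fun y => Im (g y)) * (fun y => Im (h y))).
    by apply: differentiableB; apply: differentiableM.
  by apply/funext => y; rewrite cReM.
- rewrite (_ : (fun _ => _) = (fun y => Re (g y)) * (fun y => Im (h y)) +
      (fun y => Im (g y)) * (fun y => Re (h y))).
    by apply: differentiableD; apply: differentiableM.
  by apply/funext => y; rewrite cImM.
Qed.

Lemma cdiffV g x : cdiff g x -> g x != 0 -> cdiff (fun y => (g y)^-1) x.
Proof.
move=> [g1 g2] g0.
pose q := (fun y => Re (g y)) * (fun y => Re (g y)) +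
          (fun y => Im (g y)) * (fun y => Im (g y)).
have qE p : q p = sqnorm (g p) by rewrite /q /sqnorm !expr2.
have dq : differentiable q x by apply: differentiableD; apply: differentiableM.
have dqV : differentiable (fun y => (q y)^-1) x.
  by apply: differentiableV => //; rewrite qE sqnorm_eq0.
split.
- rewrite (_ : (fun _ => _) = (fun y => Re (g y)) * (fun y => (q y)^-1)).
    exact: differentiableM.
  by apply/funext => y; rewrite cReV -qE.
- rewrite (_ : (fun _ => _) = - ((fun y => Im (g y)) * (fun y => (q y)^-1))).
    by apply: differentiableN; apply: differentiableM.
  by apply/funext => y; rewrite cImV -qE.
Qed.

Lemma cdiffX g n x : cdiff g x -> cdiff (fun y => g y ^+ n) x.
Proof.
move=> dg; elim: n => [|n IH].
  rewrite (_ : (fun _ => _) = fun=> 1); first exact: cdiff_cst.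
  by apply/funext => y; rewrite expr0.
rewrite (_ : (fun _ => _) = fun y => g y * g y ^+ n); first exact: cdiffM.
by apply/funext => y; rewrite exprS.
Qed.

Lemma cdiff_exprz g (n : int) x : cdiff g x -> g x != 0 ->
  cdiff (fun y => g y ^ n) x.
Proof.
move=> dg g0; case: n => n; first exact: cdiffX.
by apply: cdiffV; [apply: cdiffX|rewrite expf_neq0].
Qed.

Lemma cdiff_sum (I : Type) (r : seq I) (G : I -> V -> R[i]) x :
  (forall i, cdiff (G i) x) -> cdiff (fun y => \sum_(i <- r) G i y) x.
Proof.
move=> dG; elim: r => [|i r IH].
  rewrite (_ : (fun _ => _) = fun=> 0); first exact: cdiff_cst.
  by apply/funext => y; rewrite big_nil.
rewrite (_ : (fun _ => _) = fun y => G i y + \sum_(j <- r) G j y).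
  exact: cdiffD.
by apply/funext => y; rewrite big_cons.
Qed.

Lemma cdiff_cderiv g x v : cdiff g x ->
  cderiv g x v ('D_v (fun y => Re (g y)) x +i* 'D_v (fun y => Im (g y)) x).
Proof. by move=> [g1 g2]; split; apply/derivableP/diff_derivable. Qed.

Lemma cdiff_continuous g x : cdiff g x ->
  {for x, continuous (fun y => Re (g y))} /\ {for x, continuous (fun y => Im (g y))}.
Proof. by move=> [g1 g2]; split; apply: differentiable_continuous. Qed.

End ComplexDifferentiable.

Section RealFourSpace.
Variable R : realType.
Implicit Types (x y v : 'rV[R]_4) (f : laurent R).

Lemma cdiff_cpoint1 x : cdiff (fun y => (cpoint y).1) x.
Proof. by split; apply: differentiable_coord. Qed.

Lemma cdiff_cpoint2 x : cdiff (fun y => (cpoint y).2) x.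
Proof. by split; apply: differentiable_coord. Qed.

Lemma cdiff_ev (F : {poly {poly R[i]}}) x : cdiff (fun y => ev F (cpoint y)) x.
Proof.
elim/poly_ind: F => [|F c IH].
  rewrite (_ : (fun _ => _) = fun=> 0); first exact: cdiff_cst.
  by apply/funext => y; rewrite /ev !hornerE.
rewrite (_ : (fun _ => _) =
    fun y => ev F (cpoint y) * (cpoint y).2 + c.[(cpoint y).1]); last first.
  by apply/funext => y; rewrite evD evM ev_X evC.
apply: cdiffD; first by apply: cdiffM => //; apply: cdiff_cpoint2.
elim/poly_ind: c => [|c k IHc].
  rewrite (_ : (fun _ => _) = fun=> 0); first exact: cdiff_cst.
  by apply/funext => y; rewrite hornerE.
rewrite (_ : (fun _ => _) =
    fun y => c.[(cpoint y).1] * (cpoint y).1 + k); last first.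
  by apply/funext => y; rewrite hornerMXaddC.
apply: cdiffD; last exact: cdiff_cst.
by apply: cdiffM => //; apply: cdiff_cpoint1.
Qed.

Lemma cderiv_cpoint (V : normedModType R) (M : V -> 'rV[R]_4) (t e : V) :
  derivable M t e ->
  cderiv (fun s => (cpoint (M s)).1) t e (cpoint ('D_e M t)).1 /\
  cderiv (fun s => (cpoint (M s)).2) t e (cpoint ('D_e M t)).2.
Proof.
move=> dM; have dMij i j := (derivable_mxP M t e).1 dM i j.
by rewrite (derive_mx dM); split; split; rewrite /= mxE; apply/derivableP.
Qed.

Lemma cdiff_monomial (a : int * int) x : torus (cpoint x) ->
  cdiff (fun y => monomial a (cpoint y)) x.
Proof.
move=> [x1 x2]; apply: cdiffM; apply: cdiff_exprz => //.
  exact: cdiff_cpoint1.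
exact: cdiff_cpoint2.
Qed.

Lemma cdiff_eval f x : torus (cpoint x) -> cdiff (fun y => eval f (cpoint y)) x.
Proof.
move=> Tx; apply: cdiff_sum => a.
by apply: cdiffM; [apply: cdiff_cst|apply: cdiff_monomial].
Qed.

Lemma row2E (a b : R) :
  \row_(i < 2) (if i == 0 then a else b) = a *: delta_mx 0 0 + b *: delta_mx 0 1.
Proof.
apply/rowP => i; rewrite !mxE /=.
by case: i => -[|[|//]] h /=; rewrite ?mulr1 ?mulr0 ?addr0 ?add0r.
Qed.

Lemma differentiable_real_eval f x : torus (cpoint x) -> differentiable (real_eval f) x.
Proof.
move=> /(cdiff_eval f)[d1 d2].
rewrite (_ : real_eval f = (fun y => Re (eval f (cpoint y)) *: delta_mx 0 0) +
    (fun y => Im (eval f (cpoint y)) *: delta_mx 0 1)).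
  by apply: differentiableD; apply: differentiableZl.
by apply/funext => y; rewrite /real_eval row2E.
Qed.

Lemma differentiable_ln_normc (V : normedModType R) (g : V -> R[i]) (x : V) :
  cdiff g x -> g x != 0 -> differentiable (fun p => ln (Normc.normc (g p))) x.
Proof.
move=> [g1 g2] g0.
pose q := (fun p => Re (g p)) * (fun p => Re (g p)) +
          (fun p => Im (g p)) * (fun p => Im (g p)).
have qE p : q p = sqnorm (g p) by rewrite /q /sqnorm !expr2.
have dq : differentiable q x by apply: differentiableD; apply: differentiableM.
have q0 : 0 < q x by rewrite qE sqnorm_gt0.
rewrite (_ : (fun _ => _) = (2^-1 : R) *: (@ln R \o q)); last first.
  by apply/funext => h; rewrite ln_normc -qE.
apply: differentiableZ; apply: differentiable_comp => //.
by apply/derivable1_diffP; have [] := is_derive1_ln q0.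
Qed.

Lemma differentiable_Log x : torus (cpoint x) -> differentiable (@Log R) x.
Proof.
move=> [x1 x2].
have d1 := differentiable_ln_normc (cdiff_cpoint1 x) x1.
have d2 := differentiable_ln_normc (cdiff_cpoint2 x) x2.
rewrite (_ : @Log R = (fun y => ln (Normc.normc (cpoint y).1) *: delta_mx 0 0) +
    (fun y => ln (Normc.normc (cpoint y).2) *: delta_mx 0 1)).
  by apply: differentiableD; apply: differentiableZl.
apply/funext => y; rewrite -[RHS]/(_ *: _ + _ *: _) -row2E /Log.
by apply/rowP => i; rewrite !mxE; case: ifP.
Qed.

End RealFourSpace.

(** * The critical locus *)

Section LogarithmicDerivatives.
Variable K : comNzRingType.
Implicit Types F G : {poly {poly K}}.

(** [zdz] and [wdw] are the Euler operators, the derivatives in the coordinates log z and log w.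
    They only rescale coefficients, so they keep degree bounds. *)
Definition zdz F : {poly {poly K}} := ('X)%:P * dz F.
Definition wdw F : {poly {poly K}} := 'X * dw F.

Lemma coef_zdz F i j : (zdz F)`_j`_i = F`_j`_i *+ i.
Proof.
by rewrite coefCM coefXM; case: i => [|i] /=; rewrite ?mulr0n // coef_dz.
Qed.

Lemma coef_wdw F i j : (wdw F)`_j`_i = F`_j`_i *+ j.
Proof.
by rewrite coefXM; case: j => [|j] /=; rewrite ?mulr0n ?coef0 // coef_dw.
Qed.

Lemma zdzD F G : zdz (F + G) = zdz F + zdz G.
Proof. by apply: bipoly_eq => i j; rewrite coef_zdz !coefD !coef_zdz mulrnDl. Qed.

Lemma wdwD F G : wdw (F + G) = wdw F + wdw G.
Proof. by apply: bipoly_eq => i j; rewrite coef_wdw !coefD !coef_wdw mulrnDl. Qed.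

Lemma zdzCM c F : zdz (c%:P%:P * F) = c%:P%:P * zdz F.
Proof.
apply: bipoly_eq => i j; rewrite coef_zdz (coefCM c%:P F) (coefCM c).
by rewrite (coefCM c%:P (zdz F)) (coefCM c) coef_zdz mulrnAr.
Qed.

Lemma wdwCM c F : wdw (c%:P%:P * F) = c%:P%:P * wdw F.
Proof.
apply: bipoly_eq => i j; rewrite coef_wdw (coefCM c%:P F) (coefCM c).
by rewrite (coefCM c%:P (wdw F)) (coefCM c) coef_wdw mulrnAr.
Qed.

Lemma ev_zdz F p : ev (zdz F) p = p.1 * ev (dz F) p.
Proof. by rewrite evM evC hornerX. Qed.

Lemma ev_wdw F p : ev (wdw F) p = p.2 * ev (dw F) p.
Proof. by rewrite evM ev_X. Qed.

Lemma wdeg_le_zdz w k F : wdeg_le w k F -> wdeg_le w k (zdz F).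
Proof. by move=> Fk i j h; rewrite coef_zdz Fk ?mul0rn. Qed.

Lemma wdeg_le_wdw w k F : wdeg_le w k F -> wdeg_le w k (wdw F).
Proof. by move=> Fk i j h; rewrite coef_wdw Fk ?mul0rn. Qed.

End LogarithmicDerivatives.

Section PolynomialModel.
Variable R : realType.
Implicit Types (f : laurent R) (p : R[i] * R[i]).

Lemma monomialD (a b : int * int) p : torus p ->
  monomial (a.1 + b.1, a.2 + b.2) p = monomial a p * monomial b p.
Proof.
by move=> [p1 p2]; rewrite /monomial /= !expfzDr // mulrACA.
Qed.

(** Multiplication by a monomial changes z f_z and w f_w by a common nonzero factor and by multiples
    of f. The latter vanish on the curve, so the ratio A / B there is that of [f]. *)
Lemma polynomial_model f d : has_projective_degree f d ->
  exists (F : {poly {poly R[i]}}) (m : int * int), [/\ tdeg_le d F, F != 0,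
    forall p, torus p -> ev F p = monomial m p * eval f p,
    forall p, torus p -> ev (zdz F) p =
      monomial m p * (p.1 * eval_dz f p + m.1%:~R * eval f p)
  & forall p, torus p -> ev (wdw F) p =
      monomial m p * (p.2 * eval_dw f p + m.2%:~R * eval f p)].
Proof.
move=> [m [m_ge0 [a0 a0f _] _ m_le _]].
pose pos (a : int * int) : nat * nat := (absz (a.1 + m.1), absz (a.2 + m.2)).
have posE a : a \in finsupp f ->
    (pos a).1%:Z = a.1 + m.1 /\ (pos a).2%:Z = a.2 + m.2.
  by move=> /m_ge0[h1 h2]; rewrite /pos /= !gez0_abs.
pose F : {poly {poly R[i]}} := \sum_(a <- finsupp f) (f a)%:P%:P * mono _ (pos a).
have ev_pos a p : a \in finsupp f -> torus p ->
    ev (mono _ (pos a)) p = monomial a p * monomial m p.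
  move=> /posE[h1 h2] Tp; rewrite -monomialD // ev_mono /monomial /= -h1 -h2.
  by rewrite -!exprnP.
have dzE : zdz F = \sum_(a <- finsupp f) (f a *+ (pos a).1)%:P%:P * mono _ (pos a).
  apply: bipoly_eq => i j; rewrite coef_zdz !coef_sum -sumrMnl.
  apply: eq_bigr => a _; rewrite !coefC_mono.
  by case: eqP => [->|]; rewrite ?mulr0 ?mul0rn // !mulr1.
have dwE : wdw F = \sum_(a <- finsupp f) (f a *+ (pos a).2)%:P%:P * mono _ (pos a).
  apply: bipoly_eq => i j; rewrite coef_wdw !coef_sum -sumrMnl.
  apply: eq_bigr => a _; rewrite !coefC_mono.
  by case: eqP => [->|]; rewrite ?mulr0 ?mul0rn // !mulr1.
have shift1 (z : R[i]) (n : int) : z != 0 -> z * z ^ (n - 1) = z ^ n.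
  by move=> z0; rewrite -{1}[z]expr1z -expfzDr // addrC subrK.
exists F, m; split=> [||p Tp|p Tp|p Tp].
- rewrite /F big_seq; apply: wdeg_le_sum => a af; apply: wdeg_leCM.
  apply: (@wdeg_leW _ _ ((pos a).1 + 1 * (pos a).2)%N); last exact: wdeg_le_mono.
  by have [h1 h2] := posE _ af; have := m_le _ af; rewrite -h1 -h2; lia.
- have cF : F`_(pos a0).2`_(pos a0).1 = f a0.
    have cm a : ((f a)%:P%:P * mono R[i] (pos a))`_(pos a0).2`_(pos a0).1 =
        f a * (pos a == pos a0)%:R by rewrite coefC_mono -surjective_pairing.
    rewrite !coef_sum (bigD1_seq a0) // cm eqxx.
    rewrite mulr1 big_seq_cond big1 => [|a /andP[af ne]]; first by rewrite Monoid.mulm1.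
    rewrite cm; case: eqP => [e|]; last by rewrite mulr0.
    have [h1 h2] := posE _ af; have [h3 h4] := posE _ a0f.
    move: ne; rewrite -pair_eqE /= -(inj_eq (addIr m.1)) -[a.2 == _](inj_eq (addIr m.2)).
    by rewrite -h1 -h2 -h3 -h4 e !eqxx.
  apply/eqP => F0; move: a0f; rewrite mem_finsupp -cF F0 !coef0 eqxx //.
- rewrite ev_sum /eval mulr_sumr big_seq [RHS]big_seq; apply: eq_bigr => a af.
  by rewrite evM evCC ev_pos //; ring.
- have [p1 p2] := Tp; rewrite dzE ev_sum /eval /eval_dz !mulr_sumr -big_split mulr_sumr /=.
  rewrite big_seq [RHS]big_seq; apply: eq_bigr => a af.
  rewrite evM evCC ev_pos // -mulr_natr -[_%:R]/((pos a).1%:Z%:~R) (posE _ af).1.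
  by rewrite intrD /monomial /= -(shift1 p.1 a.1) //; ring.
- have [p1 p2] := Tp; rewrite dwE ev_sum /eval /eval_dw !mulr_sumr -big_split mulr_sumr /=.
  rewrite big_seq [RHS]big_seq; apply: eq_bigr => a af.
  rewrite evM evCC ev_pos // -mulr_natr -[_%:R]/((pos a).2%:Z%:~R) (posE _ af).2.
  by rewrite intrD /monomial /= -(shift1 p.2 a.2) //; ring.
Qed.

End PolynomialModel.

Section ComplexContinuity.
Variables (R : realType) (T : topologicalType).
Implicit Types (u w : T -> R[i]) (x : T).

Definition ccont u x :=
  {for x, continuous (fun y => Re (u y))} /\ {for x, continuous (fun y => Im (u y))}.

Lemma ccont_cst c x : ccont (fun=> c) x.
Proof. by split; apply: cvg_cst. Qed.

Lemma ccontD u w x : ccont u x -> ccont w x -> ccont (fun y => u y + w y) x.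
Proof.
move=> [u1 u2] [w1 w2]; split.
- rewrite (_ : (fun _ => _) = fun y => Re (u y) + Re (w y)).
    exact: (continuousD u1 w1).
  by apply/funext => y; rewrite cReD.
- rewrite (_ : (fun _ => _) = fun y => Im (u y) + Im (w y)).
    exact: (continuousD u2 w2).
  by apply/funext => y; rewrite cImD.
Qed.

Lemma ccontM u w x : ccont u x -> ccont w x -> ccont (fun y => u y * w y) x.
Proof.
move=> [u1 u2] [w1 w2]; split.
- rewrite (_ : (fun _ => _) = fun y => Re (u y) * Re (w y) - Im (u y) * Im (w y)).
    exact: (continuousB (continuousM u1 w1) (continuousM u2 w2)).
  by apply/funext => y; rewrite cReM.
- rewrite (_ : (fun _ => _) = fun y => Re (u y) * Im (w y) + Im (u y) * Re (w y)).
    exact: (continuousD (continuousM u1 w2) (continuousM u2 w1)).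
  by apply/funext => y; rewrite cImM.
Qed.

Lemma ccont_sqnorm u x : ccont u x -> {for x, continuous (fun y => sqnorm (u y))}.
Proof.
move=> [u1 u2].
rewrite (_ : (fun _ => _) = fun y => Re (u y) * Re (u y) + Im (u y) * Im (u y)).
  exact: (continuousD (continuousM u1 u1) (continuousM u2 u2)).
by apply/funext => y; rewrite /sqnorm !expr2.
Qed.

Lemma ccontV u x : ccont u x -> u x != 0 -> ccont (fun y => (u y)^-1) x.
Proof.
move=> du u0; have [u1 u2] := du; have n := ccont_sqnorm du.
have nx : sqnorm (u x) != 0 by rewrite sqnorm_eq0.
split.
- rewrite (_ : (fun _ => _) = fun y => Re (u y) * (sqnorm (u y))^-1).
    by apply: cvgM => //; apply: cvgV.
  by apply/funext => y; rewrite cReV.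
- rewrite (_ : (fun _ => _) = fun y => - (Im (u y) * (sqnorm (u y))^-1)).
    by apply: cvgN; apply: cvgM => //; apply: cvgV.
  by apply/funext => y; rewrite cImV.
Qed.

Lemma near_neq0 u x : ccont u x -> u x != 0 -> \forall y \near x, u y != 0.
Proof.
move=> du u0; have n := ccont_sqnorm du.
have : \forall y \near x, 0 < sqnorm (u y).
  by apply: (cvgr_gt (sqnorm (u x))) => //; rewrite sqnorm_gt0.
by apply: filterS => y; rewrite sqnorm_gt0.
Qed.

Lemma near_sqnorm_lt u x e : ccont u x -> u x = 0 -> 0 < e ->
  \forall y \near x, sqnorm (u y) < e.
Proof.
move=> du u0 e0; have n := ccont_sqnorm du.
have ex : sqnorm (u x) < e by rewrite u0 /sqnorm /= expr0n addr0.
exact: (cvgr_lt _ n _ ex).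
Qed.

End ComplexContinuity.

Lemma ccont_comp (R : realType) (T U : topologicalType) (g : T -> U) (u : U -> R[i]) x :
  {for x, continuous g} -> ccont u (g x) -> ccont (fun y => u (g y)) x.
Proof.
move=> cg [u1 u2]; split.
  by apply: (@continuous_comp _ _ _ g (fun y => Re (u y))).
by apply: (@continuous_comp _ _ _ g (fun y => Im (u y))).
Qed.

Lemma cderiv_near (R : realType) (V : normedModType R) (u w : V -> R[i]) x v d :
  (\forall y \near x, u y = w y) -> cderiv u x v d -> cderiv w x v d.
Proof.
move=> e [d1 d2]; split.
- by apply: near_eq_is_derive d1; apply: filterS e => y ->.
- by apply: near_eq_is_derive d2; apply: filterS e => y ->.
Qed.

(** A space of rows of length 2 has rank less than 2 exactly when a nonzero linear form [c] kills
    it. *)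
Lemma rank_kermx_lt2 (K : fieldType) n m (J : 'M[K]_(n, m)) (L : 'M[K]_(n, 2)) :
  (\rank (kermx J *m L) < 2)%N <->
  exists2 c : 'cV_2, c != 0 & forall v : 'rV_n, v *m J = 0 -> v *m L *m c = 0.
Proof.
set M := kermx J *m L.
have -> : (\rank M < 2)%N = (kermx M^T != 0).
  by rewrite kermx_eq0 /row_free mxrank_tr neq_ltn [(2 < _)%N]ltnNge rank_leq_col orbF.
split=> [/rowV0Pn[u /sub_kermxP uM u0]|[c c0 cL]].
  exists u^T; first by apply: contra_neq u0 => e; rewrite -[u]trmxK e trmx0.
  move=> v /sub_kermxP/submxP[w ->]; rewrite -(mulmxA w) -/M -(mulmxA w).
  by rewrite -[M *m _]trmxK trmx_mul trmxK uM trmx0 mulmx0.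
apply/rowV0Pn; exists c^T.
  apply/sub_kermxP; rewrite -trmx_mul (_ : M *m c = 0) ?trmx0 //.
  apply/row_matrixP => i; rewrite row0 /M -mulmxA row_mul mulmxA.
  by apply: cL; apply/sub_kermxP; apply: row_sub.
by apply: contra_neq c0 => e; rewrite -[c]trmxK e trmx0.
Qed.

Section CriticalLocus.
Variables (R : realType) (f : laurent R) (F : {poly {poly R[i]}}) (m : int * int).
Implicit Types (x v : 'rV[R]_4) (p : R[i] * R[i]).

Hypothesis evF : forall p, torus p -> ev F p = monomial m p * eval f p.
Hypothesis evAF : forall p, torus p -> ev (zdz F) p =
  monomial m p * (p.1 * eval_dz f p + m.1%:~R * eval f p).
Hypothesis evBF : forall p, torus p -> ev (wdw F) p =
  monomial m p * (p.2 * eval_dw f p + m.2%:~R * eval f p).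

(* The imaginary part of the product of a and the conjugate of b. *)
Definition cross (a b : R[i]) : R := Im a * Re b - Re a * Im b.

Lemma monomial_neq0 p : torus p -> monomial m p != 0.
Proof. by move=> [p1 p2]; rewrite mulf_neq0 ?expfz_neq0. Qed.

Lemma curveP x : curve f x <-> torus (cpoint x) /\ ev F (cpoint x) = 0.
Proof.
split=> -[Tx e]; split=> //; first by rewrite evF // e mulr0.
move: e; rewrite evF // => /eqP.
by rewrite mulf_eq0 (negPf (monomial_neq0 Tx)) => /eqP.
Qed.

Lemma log_gradient_neq0 x : smooth_in_torus f -> curve f x ->
  ev (zdz F) (cpoint x) != 0 \/ ev (wdw F) (cpoint x) != 0.
Proof.
move=> sm [Tx fx]; have M0 := monomial_neq0 Tx; have [x1 x2] := Tx.
rewrite evAF ?evBF // fx !mulr0 !addr0.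
by have [] := sm _ Tx fx => e; [left|right]; apply: mulf_neq0 => //; apply: mulf_neq0.
Qed.

Lemma near_torus x : torus (cpoint x) -> \forall y \near x, torus (cpoint y).
Proof.
move=> [x1 x2]; have c1 := cdiff_continuous (cdiff_cpoint1 x).
have c2 := cdiff_continuous (cdiff_cpoint2 x).
have n1 := near_neq0 c1 x1; have n2 := near_neq0 c2 x2.
by near=> y; split; [near: y; exact: n1|near: y; exact: n2].
Unshelve. all: by end_near. Qed.

(** On the curve, dF is the nonvanishing monomial times df, and its components on dz / z and dw / w
    are z F_z and w F_w. *)
Lemma ker_jacobian_eval x v : curve f x ->
  v *m 'J (real_eval f) x = 0 <->
  ev (zdz F) (cpoint x) * ((cpoint v).1 / (cpoint x).1) +
  ev (wdw F) (cpoint x) * ((cpoint v).2 / (cpoint x).2) = 0.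
Proof.
move=> [Tx fx]; have [x1 x2] := Tx.
have df := differentiable_real_eval f Tx.
have de := cdiff_cderiv v (cdiff_eval f Tx).
set e := (X in cderiv _ _ _ X) in de.
have Jv : v *m 'J (real_eval f) x = \row_(i < 2) (if i == 0 then Re e else Im e).
  rewrite -deriveEjacobian // derive_mx; last exact: diff_derivable.
  have -> : e = 'D_v (fun y => Re (eval f (cpoint y))) x
      +i* 'D_v (fun y => Im (eval f (cpoint y))) x by [].
  apply/rowP => i; rewrite [LHS]mxE [RHS]mxE.
  by case: ifP => i0 /=; congr (derive _ _ _); apply/funext => y; rewrite mxE i0.
have [c1 c2] := cderiv_cpoint (@derivable_id _ _ x v).
rewrite derive_id in c1 c2.
have dF : cderiv (fun y => ev F (cpoint y)) x v
    (ev (dz F) (cpoint x) * (cpoint v).1 + ev (dw F) (cpoint x) * (cpoint v).2).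
  exact: (@cderiv_ev R _ F (fun y => (cpoint y).1) (fun y => (cpoint y).2) x v _ _ c1 c2).
have dmon := cdiff_cderiv v (cdiff_monomial m Tx).
have := cderivM dmon de; rewrite fx mulr0 add0r => dF'.
have {}dF' : cderiv (fun y => ev F (cpoint y)) x v (monomial m (cpoint x) * e).
  apply: cderiv_near dF'; near=> y; rewrite evF //.
  by near: y; apply: near_torus.
have eq1 := cderiv_unique dF dF'.
have eq2 : ev (zdz F) (cpoint x) * ((cpoint v).1 / (cpoint x).1) +
    ev (wdw F) (cpoint x) * ((cpoint v).2 / (cpoint x).2) = monomial m (cpoint x) * e.
  by rewrite -eq1 ev_zdz ev_wdw; field; rewrite x1 x2.
rewrite eq2 Jv; split=> [/rowP e0|/eqP].
  have -> : e = 0; last by rewrite mulr0.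
  by apply/complex_eqP; have := e0 0; have := e0 1; rewrite !mxE /= => -> ->.
rewrite mulf_eq0 (negPf (monomial_neq0 Tx)) orFb => /eqP->.
by apply/rowP => i; rewrite !mxE; case: ifP.
Unshelve. all: by end_near. Qed.

Lemma mul_jacobian_Log x v : torus (cpoint x) ->
  v *m 'J (@Log R) x = \row_(i < 2) (if i == 0 then Re ((cpoint v).1 / (cpoint x).1)
                                 else Re ((cpoint v).2 / (cpoint x).2)).
Proof.
move=> Tx; have [x1 x2] := Tx; have dL := differentiable_Log Tx.
rewrite -deriveEjacobian // derive_mx; last exact: diff_derivable.
have dline : derivable (fun h : R => h *: v + x) 0 1.
  exact: ((derivable1P id x v).1 (@derivable_id _ _ x v)).
have e : 'D_1 (fun h : R => h *: v + x) 0 = v.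
  by have [_] := (@is_derive_line R _ _ id x v v).1 (is_derive_id x v).
have [] := cderiv_cpoint dline; rewrite e => c1 c2.
have e0 : (0 : R) *: v + x = x by rewrite scale0r add0r.
apply/rowP => i; rewrite !mxE; case: ifP => i0; apply: derive_val;
  apply/is_derive_line.
- have := is_derive_ln_normc c1; rewrite e0 => /(_ x1).
  by congr (is_derive _ _ _ _); apply/funext => h; rewrite mxE i0.
- have := is_derive_ln_normc c2; rewrite e0 => /(_ x2).
  by congr (is_derive _ _ _ _); apply/funext => h; rewrite mxE i0.
Qed.

(** In logarithmic coordinates the tangent line is spanned over the complex numbers by (-B, A), and
    the differential of Log takes real parts. A real linear form killing Re (s (-B, A)) for every
    complex s is a real linear relation between A and B: the logarithmic Gauss map is real. *)
Lemma critical_locusP x : smooth_in_torus f ->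
  critical_locus f x <-> curve f x /\
    cross (ev (zdz F) (cpoint x)) (ev (wdw F) (cpoint x)) = 0.
Proof.
move=> sm; rewrite /critical_locus /=.
split=> -[Cx]; have [Tx _] := Cx; have [x1 x2] := Tx.
  move=> /rank_kermx_lt2[c c0 cL]; split=> //.
  set a := ev _ _; set b := ev _ _.
  (* [v] is the tangent vector whose logarithmic coordinates are s (-B, A). The values s = 1 and s =
     i then give the real and imaginary parts of the relation. *)
  have key (s : R[i]) : Re (- (s * b)) * c 0 0 + Re (s * a) * c 1 0 = 0.
    pose v1 := - (s * b) * (cpoint x).1; pose v2 := s * a * (cpoint x).2.
    pose v : 'rV[R]_4 := \row_(i < 4) nth 0 [:: Re v1; Im v1; Re v2; Im v2] i.
    have e1 : (cpoint v).1 = v1 by apply/complex_eqP; rewrite /= !mxE.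
    have e2 : (cpoint v).2 = v2 by apply/complex_eqP; rewrite /= !mxE.
    have : v *m 'J (real_eval f) x = 0.
      apply/ker_jacobian_eval => //; rewrite e1 e2 /v1 /v2 !mulfK // -/a -/b; ring.
    move=> /cL/matrixP/(_ 0 0); rewrite mul_jacobian_Log // !mxE.
    rewrite !big_ord_recl big_ord0 !mxE e1 e2 /v1 /v2 !mulfK // addr0.
    by rewrite (_ : lift ord0 ord0 = 1 :> 'I_2) //; apply: val_inj.
  have := key 1; have := key (0 +i* 1); rewrite !(cReM, cReN) /= /cross.
  have cN0 : c 0 0 != 0 \/ c 1 0 != 0.
    apply/orP; rewrite -negb_and; apply: contra_neqN c0 => /andP[/eqP h0 /eqP h1].
    apply/colP => i; rewrite mxE; case: i => -[|[|//]] h.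
      by rewrite -[RHS]h0; congr (c _ _); apply: val_inj.
    by rewrite -[RHS]h1; congr (c _ _); apply: val_inj.
  move: (c 0 0) (c 1 0) cN0 => c0' c1' cN0 h1 h2.
  have h3 : c0' * Re b = c1' * Re a by lra.
  have h4 : c0' * Im b = c1' * Im a by lra.
  case: cN0 => n0; apply: (mulfI n0); rewrite mulr0.
    by rewrite mulrBr !mulrA mulrAC h3 [c0' * _ * _]mulrAC h4; ring.
  by rewrite mulrBr !mulrA -h3 -h4; ring.
move=> ab0; split=> //; apply/rank_kermx_lt2.
move: ab0; set a := ev _ _; set b := ev _ _ => ab0.
have [al [be [mu [ea eb ne]]]] : exists (al be : R) (mu : R[i]),
    [/\ a = mu * al%:C, b = mu * be%:C & (al != 0) || (be != 0)].
  have [b0|b0] := eqVneq b 0.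
    exists 1, 0, a; rewrite mulr0 mulr1 oner_neq0; split=> //.
  exists (Re (a / b)), 1, b; rewrite mulr1 oner_neq0 orbT; split=> //.
  apply: (mulIf (invr_neq0 b0)); rewrite [RHS]mulrAC divff // mul1r.
  apply/complex_eqP; split=> //=; rewrite cImM cReV cImV.
  move: ab0; rewrite /cross; set n := sqnorm b => ab0.
  have -> : Re a * - (Im b / n) + Im a * (Re b / n) = (Im a * Re b - Re a * Im b) / n by ring.
  by rewrite ab0 mul0r.
have mu0 : mu != 0.
  apply/eqP => m0; have := log_gradient_neq0 sm Cx; rewrite -/a -/b ea eb m0 !mul0r eqxx.
  by case.
exists (\col_(i < 2) (if i == 0 then al else be)).
  apply/eqP => /colP e; have := e 0; have := e 1; rewrite !mxE /= => e1 e0.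
  by move: ne; rewrite e0 e1 eqxx.
move=> v /(ker_jacobian_eval v Cx); rewrite -/a -/b ea eb.
set w1 := _ / _; set w2 := _ / _ => e.
have {}e : al%:C * w1 + be%:C * w2 = 0.
  by apply: (mulfI mu0); rewrite mulr0 -e; ring.
apply/matrixP => i j; rewrite mul_jacobian_Log // !mxE !big_ord_recl big_ord0 !mxE /=.
rewrite -/w1 -/w2 addr0.
have := congr1 (@complex.Re R) e; rewrite cReD !cReM /= !mul0r !subr0 => <-; ring.
Qed.

End CriticalLocus.

(** * Local structure of the critical locus *)

Section Roots.
Variable R : realType.
Local Notation C := R[i].

Lemma log_derivative_prod (rs : seq C) w : w \notin rs ->
  (\prod_(r <- rs) ('X - r%:P))^`().[w] =
  (\prod_(r <- rs) ('X - r%:P)).[w] * \sum_(r <- rs) (w - r)^-1.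
Proof.
elim: rs => [|r rs IH]; first by rewrite !big_nil mulr0 derivC horner0.
rewrite inE negb_or => /andP[wr /IH e].
rewrite !big_cons derivM hornerD !hornerM e derivXsubC hornerC hornerXsubC.
have wr0 : w - r != 0 by rewrite subr_eq0.
by field.
Qed.

Lemma norm_sqnorm (z : C) : `|z| ^+ 2 = (sqnorm z)%:C.
Proof. by rewrite -add_Re2_Im2. Qed.

(* Q'/Q is the sum of the (w - r)^-1 over the roots r of Q, so that some root is
   at distance at most (deg Q) |Q / Q'| from w. *)
Lemma root_close (Q : {poly C}) (w : C) n : (size Q <= n)%N -> Q^`().[w] != 0 ->
  exists2 r, root Q r &
    sqnorm (w - r) * sqnorm (Q^`().[w]) <= n%:R ^+ 2 * sqnorm (Q.[w]).
Proof.
move=> sQ Q'0.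
have [Qw|Qw] := eqVneq Q.[w] 0.
  exists w; first by apply/rootP.
  by rewrite subrr Qw /sqnorm /= expr0n /= !addr0 mul0r mulr0.
have [rs eQ] := closed_field_poly_normal Q.
have Q0 : Q != 0 by apply: contra_neq Qw => ->; rewrite horner0.
have root_rs r : r \in rs -> root Q r.
  by move=> h; rewrite eQ rootZ ?lead_coef_eq0 // root_prod_XsubC.
have wrs : w \notin rs by apply: contra Qw => /root_rs.
have szQ : size rs = (size Q).-1.
  by rewrite {1}eQ size_scale ?lead_coef_eq0 // size_prod_XsubC.
have nrs : (size rs < n)%N.
  by rewrite szQ prednK // size_poly_gt0.
have dQ : Q^`().[w] = Q.[w] * \sum_(r <- rs) (w - r)^-1.
  move: eQ; move: (lead_coef Q) => c ->.
  by rewrite derivZ !hornerZ log_derivative_prod // mulrA.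
suff [r rrs le_r] : exists2 r, r \in rs & `|w - r| * `|Q^`().[w]| <= n%:R * `|Q.[w]|.
  exists r; first exact: root_rs.
  have : (`|w - r| * `|Q^`().[w]|) ^+ 2 <= (n%:R * `|Q.[w]|) ^+ 2.
    by rewrite ler_pXn2r // ?nnegrE ?mulr_ge0.
  rewrite !exprMn !norm_sqnorm -(rmorph_nat (real_complex R)) -rmorphXn.
  by rewrite -!rmorphM lecR.
apply: contrapT => /forall2NP all_r.
have far r : r \in rs -> n%:R * `|Q.[w]| < `|w - r| * `|Q^`().[w]|.
  move=> rrs; have [//|/negP] := all_r r.
  by rewrite -real_ltNge // realM ?normr_real ?realn.
have n0 : (0 : C) < n%:R by rewrite ltr0n (leq_ltn_trans _ nrs).
have Qw0 : 0 < `|Q.[w]| by rewrite normr_gt0.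
have Q'p : 0 < `|Q^`().[w]| by rewrite normr_gt0.
have : `|Q^`().[w]| <= \sum_(r <- rs) `|Q^`().[w]| / n%:R.
  rewrite {1}dQ normrM (le_trans (ler_wpM2l _ (ler_norm_sum _ _ _))) //.
  rewrite mulr_sumr big_seq [leRHS]big_seq; apply: ler_sum => r rrs.
  rewrite normfV ler_pdivlMr // mulrAC ler_pdivrMr ?normr_gt0.
    by rewrite mulrC [leRHS]mulrC ltW ?far.
  by rewrite subr_eq0; apply: contraNneq wrs => ->.
rewrite big_const_seq count_predT iter_addr_0 -[leRHS]mulr_natr mulrAC.
by rewrite ler_pdivlMr // ler_pM2l // ler_nat leqNgt nrs.
Qed.

Lemma poly_isolated_root (T : topologicalType) (q : {poly C}) (u : T -> C) x :
  q != 0 -> ccont u x -> \forall y \near x, q.[u y] = 0 -> u y = u x.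
Proof.
move=> q0 cu; have [k [r rx eq]] := multiplicity_XsubC q (u x).
rewrite q0 /= in rx.
have cr : ccont (fun y => r.[u y]) x.
  elim/poly_ind: {q q0 eq rx} r => [|r c IH].
    by rewrite (_ : (fun _ => _) = fun=> 0); [apply: ccont_cst|apply/funext => y; rewrite horner0].
  rewrite (_ : (fun _ => _) = fun y => r.[u y] * u y + c).
    by apply: ccontD; [apply: ccontM|apply: ccont_cst].
  by apply/funext => y; rewrite hornerMXaddC.
have := near_neq0 cr rx; apply: filterS => y ry.
rewrite eq hornerM horner_exp !hornerE => /eqP.
by rewrite mulf_eq0 (negPf ry) expf_eq0 subr_eq0 /= => /andP[_ /eqP].
Qed.

Lemma horner_map_eval (F : {poly {poly C}}) z w :
  (map_poly (horner_eval z) F).[w] = ev F (z, w).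
Proof.
by rewrite -[w in LHS](hornerC w z) -[w%:P.[z]]/(horner_eval z w%:P) horner_map.
Qed.

Lemma deriv_fiber_w (F : {poly {poly C}}) z w :
  (map_poly (horner_eval z) F)^`().[w] = ev (dw F) (z, w).
Proof. by rewrite deriv_map horner_map_eval. Qed.

Lemma deriv_fiber_z (F : {poly {poly C}}) z w :
  (F.[w%:P])^`().[z] = ev (dz F) (z, w).
Proof.
elim/poly_ind: F => [|F c IH].
  by rewrite /dz map_poly0 /ev !hornerE derivC !hornerE.
rewrite dz_MXaddC evD evM ev_X evC /= -IH hornerMXaddC derivD derivM derivC.
by rewrite mulr0 addr0 !hornerE.
Qed.

Lemma size_fiber_z (F : {poly {poly C}}) (w : C) :
  (size (F.[w%:P]) <= \max_(j < size F) size (F`_j)%R)%N.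
Proof.
rewrite horner_coef; apply: (leq_trans (size_sum _ _ _)).
apply/bigmax_leqP => j _; rewrite -polyC_exp mulrC mul_polyC.
by apply: (leq_trans (size_scale_leq _ _)); apply: leq_bigmax.
Qed.

End Roots.

(** * Local branches of the curve *)

Section Branches.
Variable R : realType.
Local Notation C := R[i].
Implicit Types (x y v : 'rV[R]_4) (F : {poly {poly C}}).

Definition mkpt (z w : C) : 'rV[R]_4 :=
  \row_(i < 4) nth 0 [:: Re z; Im z; Re w; Im w] i.

Lemma cpoint_mkpt z w : cpoint (mkpt z w) = (z, w).
Proof. by rewrite /cpoint !mxE /=; case: z w => ? ? []. Qed.

Lemma cpoint_inj : injective (@cpoint R).
Proof.
move=> x y [e0 e1 e2 e3]; apply/rowP => i.
case: i => -[|[|[|[|//]]]] h.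
- by rewrite (_ : Ordinal h = 0) //; apply: val_inj.
- by rewrite (_ : Ordinal h = 1) //; apply: val_inj.
- by rewrite (_ : Ordinal h = 2) //; apply: val_inj.
- by rewrite (_ : Ordinal h = 3) //; apply: val_inj.
Qed.

Lemma sqnorm_small (z : C) (r : R) : 0 < r -> sqnorm z < r ^+ 2 ->
  `|Re z| < r /\ `|Im z| < r.
Proof.
move=> r0 h; have lt_r (a : R) : a ^+ 2 <= sqnorm z -> `|a| < r.
  move=> /le_lt_trans/(_ h); rewrite -[a ^+ 2]real_normK ?num_real //.
  by rewrite ltr_pXn2r // ?nnegrE // ltW.
by split; apply: lt_r; rewrite /sqnorm ?lerDl ?lerDr sqr_ge0.
Qed.

Lemma nbhs_cpoint (V : set 'rV[R]_4) y : nbhs y V ->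
  exists2 e : R, 0 < e & forall x, sqnorm ((cpoint x).1 - (cpoint y).1) < e ->
    sqnorm ((cpoint x).2 - (cpoint y).2) < e -> V x.
Proof.
move=> /nbhs_ballP[r /= r0 rV]; exists (r ^+ 2); first exact: exprn_gt0.
move=> x /(sqnorm_small r0)[h0 h1] /(sqnorm_small r0)[h2 h3].
move: h0 h1 h2 h3; rewrite /cpoint /= => h0 h1 h2 h3; apply: rV; split=> // i j.
rewrite /ball /= (ord1 i) distrC.
case: j => -[|[|[|[|//]]]] h.
- by rewrite (_ : Ordinal h = 0) //; apply: val_inj.
- by rewrite (_ : Ordinal h = 1) //; apply: val_inj.
- by rewrite (_ : Ordinal h = 2) //; apply: val_inj.
- by rewrite (_ : Ordinal h = 3) //; apply: val_inj.
Qed.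

(** [root_close] applies: Q_t(w) tends to 0 while Q_t'(w) stays away from 0, and [n] bounds the
    degree uniformly in t. *)
Lemma root_continuous (Q : R -> {poly C}) n w e :
  (forall t, (size (Q t) <= n)%N) -> ccont (fun t => (Q t).[w]) 0 ->
  ccont (fun t => (Q t)^`().[w]) 0 -> (Q 0).[w] = 0 -> (Q 0)^`().[w] != 0 ->
  0 < e -> \forall t \near (0 : R), exists2 r, root (Q t) r & sqnorm (r - w) < e.
Proof.
move=> sQ cQ cQ' Q0 Q'0 e0.
pose D := sqnorm (Q 0)^`().[w]; have D0 : 0 < D by rewrite sqnorm_gt0.
have n1 : \forall t \near (0 : R), D / 2 < sqnorm (Q t)^`().[w].
  apply: (cvgr_gt _ (ccont_sqnorm cQ')); rewrite -/D; lra.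
have n0 : 0 < n%:R ^+ 2 + 1 :> R by rewrite ltr_wpDl ?sqr_ge0.
have n2 : \forall t \near (0 : R), sqnorm (Q t).[w] < e * D / 2 / (n%:R ^+ 2 + 1).
  by apply: (near_sqnorm_lt cQ Q0); rewrite !divr_gt0 // mulr_gt0.
near=> t.
have t1 : D / 2 < sqnorm (Q t)^`().[w] by near: t; exact: n1.
have t2 : sqnorm (Q t).[w] < e * D / 2 / (n%:R ^+ 2 + 1) by near: t; exact: n2.
have Q't : (Q t)^`().[w] != 0 by rewrite -sqnorm_gt0; lra.
have [r rr h] := root_close (sQ t) Q't; exists r => //.
have -> : sqnorm (r - w) = sqnorm (w - r).
  by rewrite -opprB /sqnorm cReN cImN !sqrrN.
rewrite ltr_pdivlMr // in t2.
have := sqnorm_ge0 (w - r); have := sqnorm_ge0 (Q t).[w].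
move: h t1 t2; move: (sqnorm _) (sqnorm _) (sqnorm _) => a b c h t1 t2 a0 b0.
nra.
Unshelve. all: by end_near. Qed.

Lemma ccont_line (u : 'rV[R]_4 -> C) y v : ccont u y ->
  ccont (fun t : R => u (t *: v + y)) 0.
Proof.
move=> cu; apply: (@ccont_comp _ _ _ (fun t : R => t *: v + y)).
  apply: cvgD; last exact: cvg_cst.
  exact: scalel_continuous.
by rewrite scale0r add0r.
Qed.

Lemma ccont_ev F y : ccont (fun x => ev F (cpoint x)) y.
Proof. exact: cdiff_continuous (cdiff_ev F y). Qed.

(** The existence half of the implicit function theorem, restricted to one real direction [e] of the
    z-plane: this is all that [arc_one_direction] requires. *)
Lemma branch_w F y (e : C) (V : set 'rV[R]_4) :
  ev F (cpoint y) = 0 -> ev (dw F) (cpoint y) != 0 -> nbhs y V ->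
  \forall t \near (0 : R), exists x,
    [/\ V x, ev F (cpoint x) = 0 & (cpoint x).1 - (cpoint y).1 = t%:C * e].
Proof.
move=> Fy Fwy /nbhs_cpoint[r r0 rV].
pose v := mkpt e 0; pose z0 := (cpoint y).1; pose w0 := (cpoint y).2.
have lineE t : cpoint (t *: v + y) = (z0 + t%:C * e, w0).
  rewrite /cpoint !mxE /z0 /w0 /=.
  by congr (_, _); apply/complex_eqP; case: (e) => a b /=; split; ring.
pose Q t := map_poly (horner_eval (z0 + t%:C * e)) F.
have QE t : (Q t).[w0] = ev F (cpoint (t *: v + y)).
  by rewrite horner_map_eval lineE.
have Q'E t : (Q t)^`().[w0] = ev (dw F) (cpoint (t *: v + y)).
  by rewrite deriv_fiber_w lineE.
have n1 : \forall t \near (0 : R), exists2 r', root (Q t) r' & sqnorm (r' - w0) < r.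
  apply: (@root_continuous Q (size F)) => //.
  - by move=> t; rewrite size_poly.
  - by rewrite (funext QE); exact: (ccont_line v (ccont_ev F y)).
  - by rewrite (funext Q'E); exact: (ccont_line v (ccont_ev (dw F) y)).
  - by rewrite QE scale0r add0r.
  - by rewrite Q'E scale0r add0r.
have n2 : \forall t \near (0 : R), sqnorm (t%:C * e) < r.
  apply: near_sqnorm_lt => //; last by rewrite mul0r.
  apply: ccontM; last exact: ccont_cst.
  by split; [exact: cvg_id|exact: cvg_cst].
near=> t.
have [w /rootP Qw wr] : exists2 r', root (Q t) r' & sqnorm (r' - w0) < r.
  by near: t; exact: n1.
have tr : sqnorm (t%:C * e) < r by near: t; exact: n2.
exists (mkpt (z0 + t%:C * e) w); rewrite cpoint_mkpt; split.
- by apply: rV; rewrite cpoint_mkpt //= addrAC subrr add0r.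
- by rewrite -horner_map_eval.
- by rewrite /= addrAC subrr add0r.
Unshelve. all: by end_near. Qed.

Lemma branch_z F y (e : C) (V : set 'rV[R]_4) :
  ev F (cpoint y) = 0 -> ev (dz F) (cpoint y) != 0 -> nbhs y V ->
  \forall t \near (0 : R), exists x,
    [/\ V x, ev F (cpoint x) = 0 & (cpoint x).2 - (cpoint y).2 = t%:C * e].
Proof.
move=> Fy Fzy /nbhs_cpoint[r r0 rV].
pose v := mkpt 0 e; pose z0 := (cpoint y).1; pose w0 := (cpoint y).2.
have lineE t : cpoint (t *: v + y) = (z0, w0 + t%:C * e).
  rewrite /cpoint !mxE /z0 /w0 /=.
  by congr (_, _); apply/complex_eqP; case: (e) => a b /=; split; ring.
pose Q t := F.[(w0 + t%:C * e)%:P].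
have QE t : (Q t).[z0] = ev F (cpoint (t *: v + y)) by rewrite lineE.
have Q'E t : (Q t)^`().[z0] = ev (dz F) (cpoint (t *: v + y)).
  by rewrite deriv_fiber_z lineE.
have n1 : \forall t \near (0 : R), exists2 r', root (Q t) r' & sqnorm (r' - z0) < r.
  apply: (@root_continuous Q (\max_(j < size F) size (F`_j)%R)) => //.
  - by move=> t; apply: size_fiber_z.
  - by rewrite (funext QE); exact: (ccont_line v (ccont_ev F y)).
  - by rewrite (funext Q'E); exact: (ccont_line v (ccont_ev (dz F) y)).
  - by rewrite QE scale0r add0r.
  - by rewrite Q'E scale0r add0r.
have n2 : \forall t \near (0 : R), sqnorm (t%:C * e) < r.
  apply: near_sqnorm_lt => //; last by rewrite mul0r.
  apply: ccontM; last exact: ccont_cst.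
  by split; [exact: cvg_id|exact: cvg_cst].
near=> t.
have [z /rootP Qz zr] : exists2 r', root (Q t) r' & sqnorm (r' - z0) < r.
  by near: t; exact: n1.
have tr : sqnorm (t%:C * e) < r by near: t; exact: n2.
exists (mkpt z (w0 + t%:C * e)); rewrite cpoint_mkpt; split.
- by apply: rV; rewrite cpoint_mkpt //= addrAC subrr add0r.
- exact: Qz.
- by rewrite /= addrAC subrr add0r.
Unshelve. all: by end_near. Qed.

End Branches.

Section LocalParam.
Variables (R : realType) (S : set 'rV[R]_4).
Implicit Types (x y : 'rV[R]_4) (gamma : R -> 'rV[R]_4).

Lemma local_param_derivable x gamma : local_param S x gamma ->
  forall s, derivable gamma s 1.
Proof. by move=> [U [_ _ _ [/(_ 0%N)]]]. Qed.

Lemma local_param_continuous x gamma : local_param S x gamma ->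
  forall t, {for t, continuous gamma}.
Proof.
move=> lp t; apply: differentiable_continuous; apply/derivable1_diffP.
exact: (@local_param_derivable _ _ lp t).
Qed.

Lemma local_param_neq0 x gamma : local_param S x gamma ->
  forall s, 'D_1 gamma s != 0.
Proof. by move=> [U [_ _ _ [_ h] _]] s; rewrite -derive1E. Qed.

Lemma local_param_in x gamma : local_param S x gamma -> forall s, S (gamma s).
Proof.
by move=> [U [_ _ eU _ _]] s; have : range gamma (gamma s) by []; rewrite eU => -[].
Qed.

Lemma local_param0 x gamma : local_param S x gamma -> gamma 0 = x.
Proof. by move=> [U []]. Qed.

Lemma local_param_inj x gamma : local_param S x gamma -> injective gamma.
Proof. by move=> [U [_ _ _ _ [inv _ /can_inj]]]. Qed.

(** Rests on the continuity of the inverse parametrization; injectivity of [gamma] would not exclude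
    remote parameters whose points return close to [x]. *)
Lemma local_param_onto x gamma d : local_param S x gamma -> 0 < d ->
  \forall y \near x, S y -> exists2 s, `|s| < d & gamma s = y.
Proof.
move=> [U [[oU Ux] g0 eU _ [inv cinv invK]]] d0.
have Ax : (S `&` U) x by rewrite -eU -g0.
have nU : nbhs x U by apply: open_nbhs_nbhs.
have := cinv x; rewrite /continuous_at => cx.
have inv0 : inv x = 0 by rewrite -g0 invK.
have : nbhs_subspace (A := S `&` U) x (fun y => `|inv x - inv y| < d).
  by move/cvgrPdist_lt : cx; apply.
rewrite -(nbhs_subspace_in Ax) /within /= => near_inv; near=> y => Sy.
have Ay : (S `&` U) y by split=> //; near: y.
have : `|inv x - inv y| < d by move: Ay; near: y.
rewrite inv0 sub0r normrN => lt_d.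
have : range gamma y by rewrite eU.
by move=> [s _ gs]; exists (inv y) => //; rewrite -gs invK.
Unshelve. all: by end_near. Qed.

End LocalParam.

Arguments local_param_derivable {R S x gamma} _ s.
Arguments local_param_continuous {R S x gamma} _ t.

Section Tangent.
Variables (R : realType) (F : {poly {poly R[i]}}).
Local Notation C := R[i].

(* The derivation along the vector field [-B z d/dz + A w d/dw], tangent to
   [F = 0], where [A = zdz F] and [B = wdw F]. *)
Definition dlog (G : {poly {poly C}}) := wdw G * zdz F - zdz G * wdw F.

(** In logarithmic coordinates the velocity is annihilated by the nonzero row (A, B), hence is a
    complex multiple [sg] of (-B, A). *)
Lemma log_velocity (gamma : R -> 'rV[R]_4) s :
  torus (cpoint (gamma s)) -> (forall t, ev F (cpoint (gamma t)) = 0) ->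
  (ev (zdz F) (cpoint (gamma s)) != 0 \/ ev (wdw F) (cpoint (gamma s)) != 0) ->
  derivable gamma s 1 ->
  exists sg : C, [/\
    (cpoint ('D_1 gamma s)).1 / (cpoint (gamma s)).1 =
       - (sg * ev (wdw F) (cpoint (gamma s))),
    (cpoint ('D_1 gamma s)).2 / (cpoint (gamma s)).2 =
       sg * ev (zdz F) (cpoint (gamma s))
    & forall G, cderiv (fun t => ev G (cpoint (gamma t))) s (1 : R)
                  (sg * ev (dlog G) (cpoint (gamma s)))].
Proof.
move=> [z0 w0] FC grad dg; have [c1 c2] := cderiv_cpoint dg.
set z := (cpoint (gamma s)).1 in z0 *; set w := (cpoint (gamma s)).2 in w0 *.
set z' := (cpoint _).1 in c1 *; set w' := (cpoint _).2 in c2 *.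
set p := cpoint (gamma s) in grad *.
have dG G : cderiv (fun t => ev G (cpoint (gamma t))) s (1 : R)
    (ev (zdz G) p * (z' / z) + ev (wdw G) p * (w' / w)).
  have -> : ev (zdz G) p * (z' / z) + ev (wdw G) p * (w' / w) =
      ev (dz G) p * z' + ev (dw G) p * w'.
    by rewrite ev_zdz ev_wdw -/z -/w; field; rewrite z0 w0.
  exact: (@cderiv_ev R _ G (fun t => (cpoint (gamma t)).1)
    (fun t => (cpoint (gamma t)).2) s 1 z' w' c1 c2).
have F0 : ev (zdz F) p * (z' / z) + ev (wdw F) p * (w' / w) = 0.
  apply: cderiv_unique (dG F) _; rewrite (funext FC); exact: cderiv_cst.
set a := ev (zdz F) p in F0 grad *; set b := ev (wdw F) p in F0 grad *.
have [sg e1 e2] : exists2 sg, z' / z = - (sg * b) & w' / w = sg * a.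
  case: grad => n0.
  - exists (w' / w / a); last by rewrite divfK.
    apply: (mulfI n0); apply: (addIr (b * (w' / w))); rewrite F0; field.
    by rewrite w0 n0.
  - exists (- (z' / z) / b); first by rewrite divfK // opprK.
    apply: (mulfI n0); apply: (addrI (a * (z' / z))); rewrite F0; field.
    by rewrite z0 n0.
exists sg; split=> // G.
have -> : sg * ev (dlog G) p = ev (zdz G) p * (z' / z) + ev (wdw G) p * (w' / w).
  by rewrite e1 e2 /dlog evD evN (evM (wdw G)) (evM (zdz G)) -/a -/b; ring.
exact: dG.
Qed.

End Tangent.

Lemma isolated_zero_derive (R : realType) (g : R -> R) D :
  is_derive (0 : R) 1 g D -> g 0 = 0 -> D != 0 ->
  exists2 d, 0 < d & forall s, `|s| < d -> s != 0 -> g s != 0.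
Proof.
move=> [dg eD] g0 D0; rewrite -eD in D0.
have [d /= d0 h] := cvgr_neq0 _ dg D0; exists d => // s sd s0.
have := h s; rewrite /= sub0r normrN => /(_ sd s0).
by rewrite addr0 g0 subr0 [s%:A]mulr1 => /eqP e; apply/eqP => gs; apply: e; rewrite gs scaler0.
Qed.

(** * Isolated zeros of polynomials on the critical locus *)

Section LocalDivision.
Variables (R : realType).
Local Notation C := R[i].
Implicit Types (F L G : {poly {poly C}}).

Lemma common_factor F L : F != 0 -> exists G F2 L2 U V (c1 c2 c3 : {poly C}),
  [/\ c1 != 0 /\ c2 != 0, c3 != 0, c1 *: F = F2 * G, c2 *: L = L2 * G
    & U * F2 + V * L2 = c3%:P].
Proof.
move=> F0; pose G := gcdp F L.
have G0 : G != 0 by rewrite gcdp_eq0 negb_and F0.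
have /Pdiv.Idomain.dvdpP[[c1 F2] /= c10 eF] : G %| F by apply: dvdp_gcdl.
have /Pdiv.Idomain.dvdpP[[c2 L2] /= c20 eL] : G %| L by apply: dvdp_gcdr.
have [[u v] /= /eqpP[[k1 k2] /= /andP[k10 k20] eB]] := Bezoutp F L.
exists G, F2, L2, (k1 * c2 *: u), (k1 * c1 *: v), c1, c2, (k2 * c1 * c2).
split=> //; first by rewrite !mulf_neq0.
apply: (mulIf G0); rewrite -/G in eB; move: eF eL eB; rewrite -!mul_polyC !rmorphM /= => eF eL eB.
transitivity (c1%:P * c2%:P * (k1%:P * (u * F + v * L))).
  transitivity (k1%:P * (c2%:P * u * (F2 * G) + c1%:P * v * (L2 * G))); first by ring.
  by rewrite -eF -eL; ring.
by rewrite eB; ring.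
Qed.

Section TopologicalPoint.
Variables (T : topologicalType) (u1 u2 : T -> C).
Implicit Types (x y : T).

Lemma ccont_ev2 G x : ccont u1 x -> ccont u2 x ->
  ccont (fun y => ev G (u1 y, u2 y)) x.
Proof.
move=> c1 c2; elim/poly_ind: G => [|G c IH].
  rewrite (_ : (fun _ => _) = fun=> 0); first exact: ccont_cst.
  by apply/funext => y; rewrite /ev !hornerE.
rewrite (_ : (fun _ => _) = fun y => ev G (u1 y, u2 y) * u2 y + c.[u1 y]).
  apply: ccontD; first exact: ccontM.
  elim/poly_ind: c => [|c k IHc].
    rewrite (_ : (fun _ => _) = fun=> 0); first exact: ccont_cst.
    by apply/funext => y; rewrite horner0.
  rewrite (_ : (fun _ => _) = fun y => c.[u1 y] * u1 y + k).
    by apply: ccontD; [apply: ccontM|apply: ccont_cst].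
  by apply/funext => y; rewrite hornerMXaddC.
by apply/funext => y; rewrite evD evM ev_X evC.
Qed.

(* Let G be a gcd of F and L over the field of fractions.  Where denominators do
   not vanish, a common zero of F and L lies on G = 0, and as it is a simple
   zero of F, all nearby zeros of F are zeros of G, hence of L. *)
Lemma local_division F L x : F != 0 -> ccont u1 x -> ccont u2 x ->
  ev F (u1 x, u2 x) = 0 -> ev (dw F) (u1 x, u2 x) != 0 ->
  (forall y z, u1 y = u1 z -> u2 y = u2 z -> y = z) ->
  \forall y \near x, y <> x -> ev F (u1 y, u2 y) = 0 -> ev L (u1 y, u2 y) = 0 ->
    ccont u1 y -> ccont u2 y -> ev (dw F) (u1 y, u2 y) != 0 ->
    \forall z \near y, ev F (u1 z, u2 z) = 0 -> ev L (u1 z, u2 z) = 0.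
Proof.
move=> F0 c1 c2 Fx Fwx inj_u.
have [G [F2 [L2 [U [V [k1 [k2 [k3 [[k10 k20] k30 eF eL eB]]]]]]]]] := common_factor L F0.
have q0 : k1 * k2 * k3 != 0 by rewrite !mulf_neq0.
have n1 := poly_isolated_root q0 c1.
pose Q := map_poly (horner_eval (u1 x)) F.
have Q0 : Q != 0.
  apply: contra_neq Fwx => Q0; rewrite -deriv_fiber_w -/Q Q0.
  by rewrite deriv0 horner0.
have n2 := poly_isolated_root Q0 c2.
near=> y => yx Fy Ly c1y c2y Fwy.
(* A zero of the denominators this close to [x] forces u1 y = u1 x. Then u2 y is a root of the
   nonzero fibre polynomial [Q] near u2 x, so u2 y = u2 x and y = x. *)
have qy : (k1 * k2 * k3).[u1 y] != 0.
  apply/eqP => qy; have e1 : u1 y = u1 x by move: qy; near: y.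
  have Qy : Q.[u2 y] = 0 by rewrite horner_map_eval -e1.
  by apply: yx; apply: inj_u => //; move: Qy; near: y.
move: qy; rewrite !hornerM !mulf_eq0 !negb_or => /andP[/andP[k1y k2y] k3y].
have evF p : k1.[p.1] * ev F p = ev F2 p * ev G p by rewrite -evZ eF evM.
have evL p : k2.[p.1] * ev L p = ev L2 p * ev G p by rewrite -evZ eL evM.
have Gy : ev G (u1 y, u2 y) = 0.
  apply: contraNeq k3y => Gy; rewrite -[k3.[_]](evC k3 (u1 y, u2 y)) -eB evD !evM.
  have /eqP := evF (u1 y, u2 y); rewrite Fy mulr0 eq_sym mulf_eq0 (negPf Gy) orbF => /eqP->.
  have /eqP := evL (u1 y, u2 y); rewrite Ly mulr0 eq_sym mulf_eq0 (negPf Gy) orbF => /eqP->.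
  by rewrite !mulr0 addr0.
have F2y : ev F2 (u1 y, u2 y) != 0.
  apply: contraNneq Fwy => F2y.
  have := congr1 (fun H => ev (dw H) (u1 y, u2 y)) eF.
  rewrite /dw derivZ derivM evZ evD !evM F2y Gy mulr0 mul0r addr0 => /eqP.
  by rewrite mulf_eq0 (negPf k1y).
have n3 := near_neq0 (ccont_ev2 F2 c1y c2y) F2y.
have n4 : \forall z \near y, k2.[u1 z] != 0.
  have := near_neq0 (ccont_ev2 k2%:P c1y c2y); rewrite evC /= => /(_ k2y).
  by apply: filterS => z; rewrite evC.
near=> z => Fz.
have F2z : ev F2 (u1 z, u2 z) != 0 by near: z; exact: n3.
have k2z : k2.[u1 z] != 0 by near: z; exact: n4.
have Gz : ev G (u1 z, u2 z) = 0.
  have /eqP := evF (u1 z, u2 z); rewrite Fz mulr0 eq_sym mulf_eq0 (negPf F2z).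
  by move=> /eqP.
have /eqP := evL (u1 z, u2 z); rewrite Gz mulr0 mulf_eq0 (negPf k2z).
by move=> /eqP.
Unshelve. all: by end_near. Qed.

End TopologicalPoint.
End LocalDivision.

Lemma cderivV (R : realType) (V : normedModType R) (u : V -> R[i]) x v du :
  cderiv u x v du -> u x != 0 -> cderiv (fun y => (u y)^-1) x v (- du / u x ^+ 2).
Proof.
move=> [u1 u2] ux0.
pose q := (fun y => Re (u y)) * (fun y => Re (u y)) +
          (fun y => Im (u y)) * (fun y => Im (u y)).
have qE y : q y = sqnorm (u y) by rewrite /q /sqnorm !expr2.
have q0 : q x != 0 by rewrite qE sqnorm_eq0.
have dq : is_derive x v q (2 * (Re (u x) * Re du + Im (u x) * Im du)).
  apply: (is_derive_eq (is_deriveD (is_deriveM u1 u1) (is_deriveM u2 u2))).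
  by rewrite /GRing.scale /=; ring.
have dqV : is_derive x v (fun y => (q y)^-1)
    (- (q x) ^- 2 * (2 * (Re (u x) * Re du + Im (u x) * Im du))).
  case: dq => d1 d2; split; first exact: derivableV.
  by rewrite deriveV // d2.
have sn0 : Re (u x) ^+ 2 + Im (u x) ^+ 2 != 0 by rewrite -/(sqnorm (u x)) sqnorm_eq0.
have eV : (- du / u x ^+ 2) = - (du * ((u x)^-1 * (u x)^-1)).
  by rewrite expr2 invfM mulNr.
split.
- rewrite (_ : (fun _ => _) = (fun y => Re (u y)) * (fun y => (q y)^-1)).
    apply: (is_derive_eq (is_deriveM u1 dqV)); rewrite eV cReN !(cReM, cImM) !cReV !cImV.
    rewrite /GRing.scale /= qE /sqnorm; field; exact: sn0.
  by apply/funext => y; rewrite cReV -qE.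
- rewrite (_ : (fun _ => _) = - ((fun y => Im (u y)) * (fun y => (q y)^-1))).
    apply: (is_derive_eq (is_deriveN (is_deriveM u2 dqV))); rewrite eV cImN !(cReM, cImM) !cReV !cImV.
    rewrite /GRing.scale /= qE /sqnorm; field; exact: sn0.
  by apply/funext => y; rewrite cImV -qE.
Qed.

Section CrossProduct.
Variable R : realType.
Implicit Types (a b : R[i]) (r s : R).

Lemma cross_eq0P a b : cross a b = 0 <->
  exists r s, (r != 0) || (s != 0) /\ r%:C * a + s%:C * b = 0.
Proof.
split=> [|[r [s [rs e]]]].
  rewrite /cross => h.
  have [b0|b0] := eqVneq b 0.
    by exists 0, 1; rewrite oner_neq0 orbT b0 mulr0 mul0r addr0.
  exists (sqnorm b), (- (Re a * Re b + Im a * Im b)); split.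
    by rewrite sqnorm_eq0 b0.
  apply/complex_eqP; rewrite cReD cImD !cReM !cImM /sqnorm /=.
  have h' : Im a * Re b = Re a * Im b by lra.
  by split; ring: h'.
have e1 := congr1 (@complex.Re R) e; have e2 := congr1 (@complex.Im R) e.
rewrite cReD !cReM /= !mul0r !subr0 in e1; rewrite cImD !cImM /= !mul0r !addr0 in e2.
rewrite /cross; case/orP: rs => n0; apply: (mulfI n0); rewrite mulr0.
- have h1 : r * Re a = - (s * Re b) by lra.
  have h2 : r * Im a = - (s * Im b) by lra.
  by rewrite mulrBr !mulrA h1 h2; ring.
- have h1 : s * Re b = - (r * Re a) by lra.
  have h2 : s * Im b = - (r * Im a) by lra.
  by rewrite mulrBr [s * (_ * _)]mulrCA h1 [s * (_ * _)]mulrCA h2; ring.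
Qed.

End CrossProduct.

Section RealCriticalCurve.
Variables (R : realType) (F : {poly {poly R[i]}}) (S : set 'rV[R]_4).
Local Notation C := R[i].
Local Notation A := (zdz F).
Local Notation B := (wdw F).
Implicit Types (x y : 'rV[R]_4) (G : {poly {poly C}}).

Hypothesis SP : forall x, S x <-> [/\ torus (cpoint x), ev F (cpoint x) = 0
  & cross (ev A (cpoint x)) (ev B (cpoint x)) = 0].
Hypothesis log_gradient : forall x, torus (cpoint x) -> ev F (cpoint x) = 0 ->
  ev A (cpoint x) != 0 \/ ev B (cpoint x) != 0.
Hypothesis S_manifold : smooth_1manifold S.

(* An arc cannot contain solutions of F = 0 whose coordinate [pr] moves in two
   independent directions. *)
Lemma arc_one_direction (pr : C * C -> C) y gamma :
  local_param S y gamma ->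
  (forall (e : C) (V : set 'rV[R]_4), nbhs y V ->
    \forall t \near (0 : R), exists x, [/\ V x, ev F (cpoint x) = 0
      & pr (cpoint x) - pr (cpoint y) = t%:C * e]) ->
  cderiv (fun s => pr (cpoint (gamma s))) 0 1 (pr (cpoint ('D_1 gamma 0))) ->
  (\forall x \near y, ev F (cpoint x) = 0 -> S x) ->
  pr (cpoint ('D_1 gamma 0)) = 0.
Proof.
move=> lp branch dpr CS; set D := pr _ in dpr *.
have g0 := local_param0 lp.
have key (e : C) : e != 0 -> cross D e = 0.
  move=> e0; apply/eqP; apply: contraT => D0.
  (* [g] measures the displacement transverse to [e]. If its derivative at 0 were nonzero, its zero
     there would be isolated, whereas the branch in direction [e] yields further points of the arc
     with g = 0. *)
  pose g s := cross (pr (cpoint (gamma s)) - pr (cpoint y)) e.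
  have dg : is_derive (0 : R) 1 g (cross D e).
    have := cderivM (cderivD dpr (cderiv_cst (- pr (cpoint y)) (0 : R) (1 : R)))
      (cderiv_cst (Re e -i* Im e) (0 : R) (1 : R)).
    rewrite mulr0 !addr0 => -[_].
    have -> : Im (D * (Re e -i* Im e)) = cross D e by rewrite cImM /cross /=; ring.
    congr (is_derive _ _ _ _); apply/funext => s.
    by rewrite /g /cross [LHS]cImM /=; ring.
  have gg0 : g 0 = 0 by rewrite /g g0 subrr /cross /= !mul0r subrr.
  have [d d0 dne] := isolated_zero_derive dg gg0 D0.
  have n1 := local_param_onto lp d0.
  have nV : nbhs y [set x | ev F (cpoint x) = 0 -> exists2 s, `|s| < d & gamma s = x].
    near=> x => Fx; have Sx : S x by move: Fx; near: x.
    by move: Sx; near: x.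
  have /nbhs_ballP[r /= r0 hr] := branch e _ nV.
  have [|x [Vx Fx ex]] := hr (r / 2).
    by rewrite /ball /= sub0r normrN gtr0_norm ?divr_gt0 // ltr_pdivrMr // ltr_pMr ?ltr1n.
  have [s sd gs] := Vx Fx.
  have s0 : s != 0.
    apply: contra_neq e0 => s0; move: ex; rewrite -gs s0 g0 subrr => /esym/eqP.
    rewrite mulf_eq0 => /orP[/eqP/complex_eqP[/= h _]|/eqP //].
    by exfalso; move: r0; lra.
  have := dne s sd s0; rewrite /g gs ex /cross; case: (e) => a b /=.
  by rewrite !mul0r subr0 addr0 => /eqP[]; ring.
have h1 := key 1 (oner_neq0 _).
have h2 : cross D (0 +i* 1) = 0.
  by apply: key; rewrite eq_complex /= oner_eq0 andbF.
apply/complex_eqP; move: h1 h2; rewrite /cross /= => h1 h2.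
by split; lra.
Unshelve. all: by end_near. Qed.

(** The coordinate over which the curve is locally a graph would have zero velocity along the arc by
    [arc_one_direction]. This coordinate determines the factor [sg] of [log_velocity], so the whole
    velocity would vanish. *)
Lemma critical_no_open_patch y : S y ->
  ~ \forall x \near y, ev F (cpoint x) = 0 -> S x.
Proof.
move=> Sy CS; have [gamma lp] := S_manifold Sy; have g0 := local_param0 lp.
rewrite -g0 in Sy CS lp; have [Ty Fy _] := (SP (gamma 0)).1 Sy.
have dg := local_param_derivable lp 0; have [c1 c2] := cderiv_cpoint dg.
have inC t : ev F (cpoint (gamma t)) = 0 by have /SP[] := local_param_in lp t.
have grad := log_gradient Ty Fy; have [z0 w0] := Ty.
have [sg [e1 e2 _]] := log_velocity Ty inC grad dg.
have D0 := local_param_neq0 lp 0.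
have sg0 : sg = 0.
  case: grad => n0.
  - have Fz : ev (dz F) (cpoint (gamma 0)) != 0.
      by move: n0; rewrite ev_zdz; apply: contra_neq => ->; rewrite mulr0.
    have D2 : (cpoint ('D_1 gamma 0)).2 = 0 := @arc_one_direction snd _ _ lp
      (fun e V nV => branch_z e Fy Fz nV) c2 CS.
    rewrite D2 mul0r in e2; move: e2 => /esym/eqP.
    by rewrite mulf_eq0 (negPf n0) orbF => /eqP.
  - have Fw : ev (dw F) (cpoint (gamma 0)) != 0.
      by move: n0; rewrite ev_wdw; apply: contra_neq => ->; rewrite mulr0.
    have D1 : (cpoint ('D_1 gamma 0)).1 = 0 := @arc_one_direction fst _ _ lp
      (fun e V nV => branch_w e Fy Fw nV) c1 CS.
    rewrite D1 mul0r in e1; move: e1 => /esym/eqP.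
    by rewrite oppr_eq0 mulf_eq0 (negPf n0) orbF => /eqP.
move: e1 e2; rewrite sg0 !mul0r oppr0 => /eqP; rewrite mulf_eq0 invr_eq0 (negPf z0) orbF => /eqP e1.
move=> /eqP; rewrite mulf_eq0 invr_eq0 (negPf w0) orbF => /eqP e2.
case/eqP: D0; apply: cpoint_inj; rewrite [LHS]surjective_pairing e1 e2.
by rewrite /cpoint !mxE.
Qed.

End RealCriticalCurve.

Lemma ev_swapXY (R : realType) (G : {poly {poly R[i]}}) p :
  ev (swapXY G) (p.2, p.1) = ev G p.
Proof. by rewrite {1}/ev /= horner_swapXY horner_map_eval -surjective_pairing. Qed.

Lemma dw_swapXY (K : comNzRingType) (G : {poly {poly K}}) :
  dw (swapXY G) = swapXY (dz G).
Proof. by apply: bipoly_eq => i j; rewrite coef_dw !coef_swapXY coef_dz. Qed.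

Lemma derive_zero_constant (R : realType) (g : R -> R) d :
  (forall t, `|t| < d -> is_derive t (1 : R) g 0) ->
  forall t, `|t| < d -> g t = g 0.
Proof.
move=> dg; have cst a b : a <= b -> `|a| < d -> `|b| < d -> g b = g a.
  move=> ab ad bd.
  have inab t : t \in `[a, b] -> `|t| < d.
    rewrite in_itv /= => /andP[a1 b1].
    move: ad bd; rewrite !ltr_norml => /andP[h1 h2] /andP[h3 h4].
    by apply/andP; split; lra.
  have [||c _] := @MVT_segment R g (fun=> 0) a b ab.
  - by move=> t h; apply: dg; apply: inab; apply: subset_itv_oo_cc.
  - by apply: derivable_within_continuous => t /inab/dg[].
  by rewrite mul0r => /eqP; rewrite subr_eq0 => /eqP.
move=> t td; have d0 : `|0 : R| < d by rewrite normr0 (le_lt_trans _ td).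
by have [t0|/ltW t0] := leP 0 t; [apply: cst|apply/esym/cst].
Qed.

Section RealCriticalCurve.
Variables (R : realType) (F : {poly {poly R[i]}}) (S : set 'rV[R]_4).
Local Notation C := R[i].
Local Notation A := (zdz F).
Local Notation B := (wdw F).
Implicit Types (x y : 'rV[R]_4) (G L : {poly {poly C}}).

Hypothesis F0 : F != 0.
Hypothesis SP : forall x, S x <-> [/\ torus (cpoint x), ev F (cpoint x) = 0
  & cross (ev A (cpoint x)) (ev B (cpoint x)) = 0].
Hypothesis log_gradient : forall x, torus (cpoint x) -> ev F (cpoint x) = 0 ->
  ev A (cpoint x) != 0 \/ ev B (cpoint x) != 0.
Hypothesis S_manifold : smooth_1manifold S.

(** This is [local_division] in a coordinate where [F] has a simple zero; when that is z, the
    variables are exchanged by [swapXY]. *)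
Lemma critical_division L x : S x ->
  \forall y \near x, S y -> y <> x -> ev L (cpoint y) = 0 ->
    \forall z \near y, ev F (cpoint z) = 0 -> ev L (cpoint z) = 0.
Proof.
move=> Sx; have [Tx Fx _] := (SP x).1 Sx; have grad := log_gradient Tx Fx.
have cc1 y := cdiff_continuous (cdiff_cpoint1 y).
have cc2 y := cdiff_continuous (cdiff_cpoint2 y).
have inj12 y z : (cpoint y).1 = (cpoint z).1 -> (cpoint y).2 = (cpoint z).2 -> y = z.
  move=> e1 e2; apply: cpoint_inj.
  by rewrite [LHS]surjective_pairing [RHS]surjective_pairing e1 e2.
rewrite ev_zdz ev_wdw in grad; case: grad => n0.
- have Fz : ev (dz F) (cpoint x) != 0 by apply: contra_neq n0 => ->; rewrite mulr0.
  have sF0 : swapXY F != 0.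
    by apply: contra_neq F0 => e; rewrite -[F]swapXYK e rmorph0.
  have Fx' : ev (swapXY F) ((cpoint x).2, (cpoint x).1) = 0 by rewrite ev_swapXY.
  have Fz' : ev (dw (swapXY F)) ((cpoint x).2, (cpoint x).1) != 0.
    by rewrite dw_swapXY ev_swapXY.
  have n1 := @local_division R _ (fun y => (cpoint y).2) (fun y => (cpoint y).1)
    _ (swapXY L) x sF0 (cc2 x) (cc1 x) Fx' Fz' (fun y z e2 e1 => inj12 y z e1 e2).
  have n2 := near_neq0 (ccont_ev (dz F) x) Fz.
  near=> y => Sy yx Ly; have [_ Fy _] := (SP y).1 Sy.
  have Fyz : ev (dz F) (cpoint y) != 0 by near: y; exact: n2.
  have near_y : \forall z \near y,
      ev (swapXY F) ((cpoint z).2, (cpoint z).1) = 0 ->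
      ev (swapXY L) ((cpoint z).2, (cpoint z).1) = 0.
    have : ev (swapXY F) ((cpoint y).2, (cpoint y).1) = 0 by rewrite ev_swapXY.
    have : ev (swapXY L) ((cpoint y).2, (cpoint y).1) = 0 by rewrite ev_swapXY.
    have : ev (dw (swapXY F)) ((cpoint y).2, (cpoint y).1) != 0.
      by rewrite dw_swapXY ev_swapXY.
    move: (cc1 y) (cc2 y) => h1 h2 h3 h4 h5; move: h5 h4 h2 h1 h3.
    by move: yx; near: y; exact: n1.
  by apply: filterS near_y => z; rewrite !ev_swapXY.
- have Fw : ev (dw F) (cpoint x) != 0 by apply: contra_neq n0 => ->; rewrite mulr0.
  have n1 := @local_division R _ (fun y => (cpoint y).1) (fun y => (cpoint y).2)
    F L x F0 (cc1 x) (cc2 x) Fx Fw inj12.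
  have n2 := near_neq0 (ccont_ev (dw F) x) Fw.
  near=> y => Sy yx Ly; have [_ Fy _] := (SP y).1 Sy.
  have Fyw : ev (dw F) (cpoint y) != 0 by near: y; exact: n2.
  move: (cc1 y) (cc2 y) => h1 h2; move: Fy Ly h1 h2 Fyw.
  by move: yx; near: y; exact: n1.
Unshelve. all: by end_near. Qed.

Lemma linear_form_isolated (r s : R) x : S x -> (r != 0) || (s != 0) ->
  \forall y \near x, S y -> y <> x ->
    r%:C * ev A (cpoint y) + s%:C * ev B (cpoint y) != 0.
Proof.
move=> Sx rs; have := critical_division (r%:C%:P%:P * A + s%:C%:P%:P * B) Sx.
apply: filterS => y Ly Sy yx; apply/eqP => l0.
have [Ty Fy _] := (SP y).1 Sy.
have evl z : ev (r%:C%:P%:P * A + s%:C%:P%:P * B) z =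
    r%:C * ev A z + s%:C * ev B z.
  by rewrite evD (evM r%:C%:P%:P) (evM s%:C%:P%:P) !evCC.
apply: (critical_no_open_patch SP log_gradient S_manifold Sy).
have n1 : \forall z \near y, ev F (cpoint z) = 0 ->
    ev (r%:C%:P%:P * A + s%:C%:P%:P * B) (cpoint z) = 0.
  by apply: Ly => //; rewrite evl.
have n2 := near_torus Ty.
near=> z => Fz; apply/SP; split=> //; first by near: z; exact: n2.
apply/cross_eq0P; exists r, s; split=> //; rewrite -evl.
by move: Fz; near: z; exact: n1.
Unshelve. all: by end_near. Qed.

Definition wronskian : {poly {poly C}} := B * dlog F A - A * dlog F B.

(** Otherwise W vanishes on a patch around some y, and the quotient of two real linear forms in A
    and B is constant along the arc of [S] through y. With a numerator vanishing at y and a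
    denominator that does not, the numerator vanishes along the arc, against
    [linear_form_isolated]. *)
Lemma wronskian_isolated x : S x ->
  \forall y \near x, S y -> y <> x -> ev wronskian (cpoint y) != 0.
Proof.
move=> Sx; have := critical_division wronskian Sx.
apply: filterS => y Wy Sy yx; apply/eqP => W0.
have {}Wy := Wy Sy yx W0; have [Ty Fy cr] := (SP y).1 Sy.
have [r [s [rs l0]]] := (cross_eq0P _ _).1 cr.
have [r' [s' [rs' l'0]]] : exists r' s' : R, (r' != 0) || (s' != 0) /\
    r'%:C * ev A (cpoint y) + s'%:C * ev B (cpoint y) != 0.
  have [n0|n0] := log_gradient Ty Fy.
    by exists 1, 0; rewrite oner_neq0 mul1r mul0r addr0.
  by exists 0, 1; rewrite oner_neq0 orbT mul1r mul0r add0r.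
have [gamma lp] := S_manifold Sy; have g0 := local_param0 lp.
have cg := local_param_continuous lp 0.
pose l (a b : R) t := a%:C * ev A (cpoint (gamma t)) + b%:C * ev B (cpoint (gamma t)).
have inC t : ev F (cpoint (gamma t)) = 0 by have /SP[] := local_param_in lp t.
have near_g (P : set 'rV[R]_4) : nbhs y P -> \forall t \near (0 : R), P (gamma t).
  by rewrite -g0; apply: cg.
have n1 : \forall t \near (0 : R), ev wronskian (cpoint (gamma t)) = 0.
  have h := near_g _ Wy; apply: filterS h => t; apply; exact: inC.
have cl z : ccont (fun z => r'%:C * ev A (cpoint z) + s'%:C * ev B (cpoint z)) z.
  by apply: ccontD; apply: ccontM (ccont_cst _ _) (ccont_ev _ _).
have n2 : \forall t \near (0 : R), l r' s' t != 0.
  exact: near_g (near_neq0 (cl y) l'0).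
have n3 : \forall t \near (0 : R), t != 0 -> l r s t != 0.
  have h := near_g _ (linear_form_isolated Sy rs); apply: filterS h => t h t0.
  apply: h; first exact: local_param_in lp t.
  by rewrite -g0 => /(local_param_inj lp) t_0; rewrite t_0 eqxx in t0.
have [d /= d0 hd] : nbhs (0 : R) [set t | [/\ ev wronskian (cpoint (gamma t)) = 0,
    l r' s' t != 0 & (t != 0 -> l r s t != 0)]].
  by near=> t; split; near: t.
have {}hd t : `|t| < d -> [/\ ev wronskian (cpoint (gamma t)) = 0,
    l r' s' t != 0 & (t != 0 -> l r s t != 0)].
  by move=> td; apply: hd; rewrite /= sub0r normrN.
have dq t : `|t| < d -> cderiv (fun t => l r s t * (l r' s' t)^-1) t 1 0.
  move=> /hd[Wt lt0 _].
  have /SP[Tt Ft _] := local_param_in lp t.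
  have [sg [_ _ dG]] := log_velocity Tt inC (log_gradient Tt Ft)
    (local_param_derivable lp t).
  have dl a b : cderiv (l a b) t 1
      (sg * (a%:C * ev (dlog F A) (cpoint (gamma t)) +
             b%:C * ev (dlog F B) (cpoint (gamma t)))).
    have := cderivD (cderivM (cderiv_cst a%:C t 1) (dG A))
                    (cderivM (cderiv_cst b%:C t 1) (dG B)).
    by congr (cderiv _ _ _ _); ring.
  have := cderivM (dl r s) (cderivV (dl r' s') lt0).
  congr (cderiv _ _ _ _).
  have W0' : ev B (cpoint (gamma t)) * ev (dlog F A) (cpoint (gamma t)) =
      ev A (cpoint (gamma t)) * ev (dlog F B) (cpoint (gamma t)).
    apply/eqP; rewrite -subr_eq0 -(evM B) -(evM A) -evN -evD; exact/eqP.
  move: lt0; rewrite /l; move: (ev A _) (ev B _) (ev (dlog F A) _) (ev (dlog F B) _) W0'.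
  move=> a b a' b' e n0.
  transitivity (sg * (r%:C * s'%:C - s%:C * r'%:C) * (b * a' - a * b') /
    (r'%:C * a + s'%:C * b) ^+ 2); first by field.
  by rewrite e subrr mulr0 mul0r.
have q0 : l r s 0 * (l r' s' 0)^-1 = 0 by rewrite /l g0 l0 mul0r.
have hd2 : `|d / 2| < d by rewrite gtr0_norm ?divr_gt0 // ltr_pdivrMr // ltr_pMr ?ltr1n.
have qd : l r s (d / 2) * (l r' s' (d / 2))^-1 = 0.
  apply/complex_eqP; rewrite -q0; split.
    apply: (@derive_zero_constant R (fun t => Re (l r s t * (l r' s' t)^-1)) d) => //.
    by move=> t /dq[].
  apply: (@derive_zero_constant R (fun t => Im (l r s t * (l r' s' t)^-1)) d) => //.
  by move=> t /dq[].
have [_ h1 h2] := hd _ hd2.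
move: qd => /eqP; rewrite mulf_eq0 invr_eq0 (negPf h1) orbF.
by apply/negP; apply: h2; rewrite gt_eqF ?divr_gt0.
Unshelve. all: by end_near. Qed.

Lemma critical_not_isolated x (V : set 'rV[R]_4) : S x -> nbhs x V ->
  exists y, [/\ S y, y <> x & V y].
Proof.
move=> Sx xV; have [gamma lp] := S_manifold Sx; have g0 := local_param0 lp.
have cg := local_param_continuous lp 0.
have [d /= d0 hd] : nbhs (0 : R) [set t | V (gamma t)] by apply: cg; rewrite g0.
have hd2 : `|d / 2| < d by rewrite gtr0_norm ?divr_gt0 // ltr_pdivrMr // ltr_pMr ?ltr1n.
exists (gamma (d / 2)); split; first exact: local_param_in lp _.
- rewrite -g0 => /(local_param_inj lp) e; move: d0; lra.
- by apply: hd; rewrite /= sub0r normrN.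
Qed.

Variable c : R.

(* Replacing B by B + c A leaves [wronskian] unchanged; a suitable [c] makes the
   slope finite at any given finite set of points. *)
Definition sheared : {poly {poly C}} := B + c%:C%:P%:P * A.

Lemma ev_sheared p : ev sheared p = ev B p + c%:C * ev A p.
Proof. by rewrite evD (evM c%:C%:P%:P) evCC. Qed.

(** For real [a] this is a real linear form in A and B, with nonzero coefficients (1 - a c, -a). For
    nonreal [a] no point of [S] qualifies, the slope being real there. *)
Lemma slope_isolated (a : C) x : S x -> \forall y \near x, S y -> y <> x ->
  ev A (cpoint y) - a * ev sheared (cpoint y) != 0.
Proof.
move=> Sx; have [a0|a0] := eqVneq (Im a) 0.
  have ea : a = (Re a)%:C by apply/complex_eqP.
  have := @linear_form_isolated (1 - Re a * c) (- Re a) x Sx.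
  have -> : (1 - Re a * c != 0) || (- Re a != 0).
    by rewrite oppr_eq0; case: (eqVneq (Re a) 0) => [->|]; rewrite ?mul0r ?subr0 ?oner_neq0 ?orbT.
  move=> /(_ isT); apply: filterS => y h Sy yx; have := h Sy yx; apply: contra_neq.
  by rewrite ev_sheared ea rmorphB rmorphN rmorphM rmorph1 /= => <-; ring.
near=> y => Sy _; have [Ty Fy /cross_eq0P[r [s [rs e]]]] := (SP y).1 Sy.
apply/eqP => h.
have {}h : ev A (cpoint y) = a * ev sheared (cpoint y) by apply: subr0_eq.
have e' : (r - s * c)%:C * ev A (cpoint y) + s%:C * ev sheared (cpoint y) = 0.
  by rewrite ev_sheared -e rmorphB rmorphM /=; ring.
have [b0|b0] := eqVneq (ev sheared (cpoint y)) 0.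
  rewrite b0 mulr0 in h; move: b0; rewrite ev_sheared h mulr0 addr0 => hB.
  by have := log_gradient Ty Fy; rewrite h hB eqxx; case.
move: e'; rewrite h mulrA -mulrDl => /eqP; rewrite mulf_eq0 (negPf b0) orbF => /eqP h2.
have h3 := congr1 (@complex.Im R) h2; have h4 := congr1 (@complex.Re R) h2.
move: h3 h4; rewrite cImD cReD cImM cReM /= !mul0r subr0 !addr0 => /eqP.
rewrite mulf_eq0 (negPf a0) orbF => /eqP rsc; rewrite rsc mul0r add0r => s0.
by move: rs; rewrite s0 eqxx orbF; move: rsc; rewrite s0 mul0r subr0 => ->; rewrite eqxx.
Unshelve. all: by end_near. Qed.

Lemma generic_slope (r : {poly C}) x : r != 0 -> S x ->
  \forall y \near x, S y -> y <> x ->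
    ev sheared (cpoint y) != 0 /\ r.[ev A (cpoint y) / ev sheared (cpoint y)] != 0.
Proof.
move=> r0 Sx; have [rs er] := closed_field_poly_normal r.
have n1 : \forall y \near x, S y -> y <> x -> ev sheared (cpoint y) != 0.
  have := @linear_form_isolated c 1 x Sx; rewrite oner_neq0 orbT => /(_ isT).
  apply: filterS => y h Sy yx; have := h Sy yx.
  by rewrite ev_sheared mul1r addrC.
have n2 : \forall y \near x, S y -> y <> x ->
    all (fun a => ev A (cpoint y) - a * ev sheared (cpoint y) != 0) rs.
  elim: {er} rs => [|a rs IH]; first by near=> y.
  have n3 := @slope_isolated a x Sx.
  near=> y => Sy yx /=; apply/andP; split; first by move: Sy yx; near: y; exact: n3.
  by move: Sy yx; near: y; exact: IH.
near=> y => Sy yx.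
have B0 : ev sheared (cpoint y) != 0 by move: Sy yx; near: y; exact: n1.
split=> //; rewrite er hornerZ mulf_neq0 ?lead_coef_eq0 //.
rewrite -rootE root_prod_XsubC; apply/negP => ain.
have /allP/(_ _ ain) : all (fun a => ev A (cpoint y) - a * ev sheared (cpoint y) != 0) rs.
  by move: Sy yx; near: y; exact: n2.
by rewrite divfK // subrr eqxx.
Unshelve. all: by end_near. Qed.

(** Points of [S] accumulate at [x], and near [x] neither the denominator nor r(A / Bc) vanishes at
    them; if G were nonzero at [x], it would be nonzero at some of them. *)
Lemma critical_torsion_free (r : {poly C}) G : r != 0 ->
  (forall y, S y -> ev sheared (cpoint y) != 0 ->
    r.[ev A (cpoint y) / ev sheared (cpoint y)] * ev G (cpoint y) = 0) ->
  forall x, S x -> ev G (cpoint x) = 0.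
Proof.
move=> r0 rG x Sx; apply/eqP; apply: contraT => Gx.
have n1 := near_neq0 (ccont_ev G x) Gx.
have [y [Sy yx [Gy /(_ Sy yx)[B0 ry]]]] :=
  critical_not_isolated Sx (filterI n1 (generic_slope r0 Sx)).
by have /eqP := rG y Sy B0; rewrite mulf_eq0 (negPf ry) (negPf Gy).
Qed.

End RealCriticalCurve.

(** * Ramification points *)

Section Ramification.
Variables (R : realType) (f : laurent R) (F : {poly {poly R[i]}}) (c : R).
Local Notation C := R[i].
Local Notation A := (zdz F).
Local Notation B := (wdw F).
Local Notation W := (wronskian F).
Local Notation Bc := (sheared F c).
Local Notation S := (critical_locus f).
Implicit Types (x y : 'rV[R]_4).

Hypothesis F0 : F != 0.
Hypothesis SP : forall x, S x <-> [/\ torus (cpoint x), ev F (cpoint x) = 0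
  & cross (ev A (cpoint x)) (ev B (cpoint x)) = 0].
Hypothesis log_gradient : forall x, torus (cpoint x) -> ev F (cpoint x) = 0 ->
  ev A (cpoint x) != 0 \/ ev B (cpoint x) != 0.
Hypothesis S_manifold : smooth_1manifold S.

(** The function phi, with the sheared denominator. *)
Definition nwronskian x : C := ev W (cpoint x) / ev Bc (cpoint x) ^+ 3.

Lemma critical_slope x : S x -> ev Bc (cpoint x) != 0 ->
  Im (ev A (cpoint x) / ev Bc (cpoint x)) = 0.
Proof.
move=> /SP[_ _]; rewrite ev_sheared /cross => h b0.
rewrite cImM cReV cImV; move: (sqnorm _) => n.
rewrite cReD cImD cReM cImM /= !mul0r subr0 addr0.
move: h; move: (ev A _) (ev B _) => [a a'] [b b'] /= h.
transitivity ((a' * b - a * b') / n); first by ring.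
by rewrite h mul0r.
Qed.

Lemma wronskian_sheared p :
  ev (dlog F A) p * ev Bc p - ev A p * ev (dlog F Bc) p = ev W p.
Proof.
have dB : dlog F Bc = dlog F B + c%:C%:P%:P * dlog F A.
  by rewrite /dlog zdzD wdwD zdzCM wdwCM; ring.
rewrite ev_sheared dB (evD (dlog F B)) (evM c%:C%:P%:P) evCC /wronskian.
rewrite (evD (B * _)) (evN (A * _)) (evM B) (evM A).
by ring.
Qed.

Lemma derive_Log (gamma : R -> 'rV[R]_4) (s : R) : (forall t, S (gamma t)) -> derivable gamma s 1 ->
  'D_1 (@Log R \o gamma) s = \row_(i < 2)
    (if i == 0 then Re ((cpoint ('D_1 gamma s)).1 / (cpoint (gamma s)).1)
     else Re ((cpoint ('D_1 gamma s)).2 / (cpoint (gamma s)).2)).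
Proof.
move=> Sg dg; have [c1 c2] := cderiv_cpoint dg.
have /SP[[z0 w0] _ _] := Sg s.
have d1 := is_derive_ln_normc c1 z0; have d2 := is_derive_ln_normc c2 w0.
have comp i : (fun t => (@Log R \o gamma) t 0 i) =
    if i == 0 then (fun t => ln (Normc.normc (cpoint (gamma t)).1))
    else (fun t => ln (Normc.normc (cpoint (gamma t)).2)).
  by case: ifP => i0; apply/funext => t /=; rewrite mxE i0.
rewrite derive_mx.
  by apply/rowP => i; rewrite !mxE comp; case: ifP => _; apply: derive_val.
apply/derivable_mxP => i j; rewrite ord1 comp.
by case: ifP => _; [case: d1|case: d2].
Qed.

(* Along [S], the velocity of Log is [Re sigma] times a nonzero real vector and
   [sigma * nwronskian] is the derivative of the real slope [A / Bc]. *)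
Lemma ramification_velocity x gamma s : local_param S x gamma ->
  ev Bc (cpoint (gamma s)) != 0 ->
  exists sigma : C, [/\ sigma != 0, Im (sigma * nwronskian (gamma s)) = 0
    & derive1 (@Log R \o gamma) s = 0 <-> Re sigma = 0].
Proof.
move=> lp b0; have Sg := local_param_in lp; have dg := local_param_derivable lp s.
have /SP[Ts Fs cr] := Sg s.
have inC t : ev F (cpoint (gamma t)) = 0 by have /SP[] := Sg t.
have [sg [e1 e2 dG]] := log_velocity Ts inC (log_gradient Ts Fs) dg.
exists (sg * ev Bc (cpoint (gamma s))).
have sg0 : sg != 0.
  apply/eqP => sg0; move: e1 e2; rewrite sg0 !mul0r oppr0; have [z0 w0] := Ts.
  move=> /eqP; rewrite mulf_eq0 invr_eq0 (negPf z0) orbF => /eqP e1.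
  move=> /eqP; rewrite mulf_eq0 invr_eq0 (negPf w0) orbF => /eqP e2.
  case/eqP: (local_param_neq0 lp s); apply: cpoint_inj.
  by rewrite [LHS]surjective_pairing e1 e2 /cpoint !mxE.
split; first by rewrite mulf_neq0.
  have dt := cderivM (dG A) (cderivV (dG Bc) b0).
  have -> : sg * ev Bc (cpoint (gamma s)) * nwronskian (gamma s) =
      sg * ev (dlog F A) (cpoint (gamma s)) / ev Bc (cpoint (gamma s)) +
      ev A (cpoint (gamma s)) *
        (- (sg * ev (dlog F Bc) (cpoint (gamma s))) / ev Bc (cpoint (gamma s)) ^+ 2).
    by rewrite /nwronskian -wronskian_sheared; field.
  have [_ dI] := dt.
  apply/esym; rewrite -(derive_val (is_derive := dI)).
  have cB := ccont_comp (local_param_continuous lp s) (ccont_ev Bc (gamma s)).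
  have nB := near_neq0 cB b0.
  have nI : \forall t \near s,
      Im (ev A (cpoint (gamma t)) * (ev Bc (cpoint (gamma t)))^-1) = cst (0 : R) t.
    by apply: filterS nB => t bt; apply: critical_slope.
  by rewrite (near_eq_derive (1 : R) nI) derive_cst.
rewrite derive1E derive_Log // e1 e2.
have eA : ev A (cpoint (gamma s)) =
    (Re (ev A (cpoint (gamma s)) / ev Bc (cpoint (gamma s))))%:C * ev Bc (cpoint (gamma s)).
  rewrite -[LHS](divfK b0); congr (_ * _); apply/complex_eqP; split=> //=.
  by rewrite critical_slope.
move: eA; move: (Re (ev A (cpoint (gamma s)) / ev Bc (cpoint (gamma s)))) => t eA.
have eB : ev B (cpoint (gamma s)) = (1 - c * t)%:C * ev Bc (cpoint (gamma s)).
  have h := ev_sheared F c (cpoint (gamma s)); rewrite eA in h.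
  apply: (addIr (c%:C * (t%:C * ev Bc (cpoint (gamma s))))); rewrite -h.
  by rewrite rmorphB rmorphM rmorph1 /=; ring.
have reB : Re (- (sg * ev B (cpoint (gamma s)))) =
    - (1 - c * t) * Re (sg * ev Bc (cpoint (gamma s))).
  by rewrite eB !(cReN, cReM, cImM) /=; ring.
have reA : Re (sg * ev A (cpoint (gamma s))) =
    t * Re (sg * ev Bc (cpoint (gamma s))).
  by rewrite eA !(cReN, cReM, cImM) /=; ring.
rewrite reA reB; set rs := Re _; split=> [/rowP e|->]; last first.
  by apply/rowP => i; rewrite !mxE !mulr0 if_same.
have := e 0; have := e 1; rewrite !mxE /= => h1 h0.
(* The real vector (-(1 - c t), t) cannot vanish, because c t + (1 - c t) = 1; the same combination
   recovers [rs]. *)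
have -> : rs = c * (t * rs) - (- (1 - c * t) * rs) by ring.
by rewrite h1 h0 mulr0 subr0.
Qed.

(** Here [sigma] is nonzero and purely imaginary, and sigma phi is real. *)
Lemma ramification_phi x : ramification_points f x -> ev Bc (cpoint x) != 0 ->
  Re (nwronskian x) = 0.
Proof.
move=> [Sx [gamma lp dL]] b0; have g0 := local_param0 lp.
have b0' : ev Bc (cpoint (gamma 0)) != 0 by rewrite g0.
have [sg [sg0 im /iffLR/(_ dL) re]] := ramification_velocity lp b0'; move: im; rewrite g0 cImM re mul0r add0r => /eqP.
rewrite mulf_eq0 => /orP[/eqP i0|/eqP //].
by case/eqP: sg0; apply/complex_eqP.
Qed.

Lemma phi_ramification y : S y -> ev Bc (cpoint y) != 0 -> Re (nwronskian y) = 0 ->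
  ev W (cpoint y) != 0 -> ramification_points f y.
Proof.
move=> Sy b0 re w0; split=> //; have [gamma lp] := S_manifold Sy.
have g0 := local_param0 lp; exists gamma => //.
have b0' : ev Bc (cpoint (gamma 0)) != 0 by rewrite g0.
have [sg [sg0 im h]] := ramification_velocity lp b0'; apply/h.
move: im; rewrite g0 cImM re mulr0 addr0 => /eqP; rewrite mulf_eq0 => /orP[/eqP //|/eqP i0].
have : nwronskian y = 0 by apply/complex_eqP.
by move=> /eqP; rewrite mulf_eq0 (negPf w0) invr_eq0 expf_eq0 (negPf b0).
Qed.

Lemma phi_isolated_zero x : ramification_points f `<=` isolated (ramification_points f) ->
  ramification_points f x -> ev Bc (cpoint x) != 0 ->
  \forall y \near x, S y -> y <> x -> Re (nwronskian y) != 0.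
Proof.
move=> iso rx b0; have [Sx _] := rx.
have [_ [V nV VE]] := iso x rx.
have n1 := wronskian_isolated F0 SP log_gradient S_manifold Sx.
have n2 := near_neq0 (ccont_ev Bc x) b0.
near=> y => Sy yx; apply/eqP => re.
have wy : ev W (cpoint y) != 0 by move: Sy yx; near: y; exact: n1.
have by0 : ev Bc (cpoint y) != 0 by near: y; exact: n2.
have ry := phi_ramification Sy by0 re wy.
have Vy : V y by near: y; exact: nV.
by apply: yx; have : (V `&` ramification_points f) y by []; rewrite VE.
Unshelve. all: by end_near. Qed.

End Ramification.

Lemma exists_notin (T : eqType) (g : nat -> T) (bad : seq T) :
  injective g -> exists k, g k \notin bad.
Proof.
move=> inj_g; apply: contrapT => /forallNP all_bad.
have sub : {subset map g (iota 0 (size bad).+1) <= bad}.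
  by move=> x /mapP[k _ ->]; have /negP := all_bad k; rewrite negbK.
have := uniq_leq_size _ sub; rewrite map_inj_uniq // iota_uniq => /(_ isT).
by rewrite size_map size_iota ltnn.
Qed.

Section ArcValues.
Variables (R : realType) (f : laurent R) (F : {poly {poly R[i]}}) (c : R).
Local Notation C := R[i].
Local Notation A := (zdz F).
Local Notation B := (wdw F).
Local Notation W := (wronskian F).
Local Notation Bc := (sheared F c).
Local Notation S := (critical_locus f).
Local Notation phi := (nwronskian F c).
Implicit Types (x y : 'rV[R]_4).

Hypothesis F0 : F != 0.
Hypothesis SP : forall x, S x <-> [/\ torus (cpoint x), ev F (cpoint x) = 0
  & cross (ev A (cpoint x)) (ev B (cpoint x)) = 0].
Hypothesis log_gradient : forall x, torus (cpoint x) -> ev F (cpoint x) = 0 ->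
  ev A (cpoint x) != 0 \/ ev B (cpoint x) != 0.
Hypothesis S_manifold : smooth_1manifold S.

(* An isolated zero of [Re phi] on an arc of [S] splits, on each of its two
   sides, into a zero of [(Re phi)^2 - eps^2]. *)
Lemma perturbed_points x (V : set 'rV[R]_4) :
  ramification_points f `<=` isolated (ramification_points f) ->
  ramification_points f x -> ev Bc (cpoint x) != 0 -> nbhs x V ->
  exists2 e0 : R, 0 < e0 & forall e, 0 < e < e0 -> exists y1 y2,
    [/\ y1 <> y2, [/\ S y1, V y1 & ev Bc (cpoint y1) != 0],
        [/\ S y2, V y2 & ev Bc (cpoint y2) != 0],
        Re (phi y1) ^+ 2 = e ^+ 2 & Re (phi y2) ^+ 2 = e ^+ 2].
Proof.
move=> iso rx b0 nV; have Sx := rx.1; have [gamma lp] := S_manifold Sx.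
have g0 := local_param0 lp.
have near_g (P : set 'rV[R]_4) : nbhs x P -> \forall t \near (0 : R), P (gamma t).
  by rewrite -g0 => h; exact: (local_param_continuous lp 0 _ h).
have n1 := near_g _ (phi_isolated_zero F0 SP log_gradient S_manifold iso rx b0).
have n2 := near_g _ (near_neq0 (ccont_ev Bc x) b0).
have n3 := near_g _ nV.
have [d /= d0 hd] : nbhs (0 : R) [set t | [/\ t != 0 -> Re (phi (gamma t)) != 0,
    ev Bc (cpoint (gamma t)) != 0 & V (gamma t)]].
  near=> t; split; [|by near: t; exact: n2|by near: t; exact: n3].
  have h : S (gamma t) -> gamma t <> x -> Re (phi (gamma t)) != 0.
    by near: t; exact: n1.
  move=> t0; apply: h; first exact: local_param_in lp t.
  by rewrite -g0 => /(local_param_inj lp) t_0; rewrite t_0 eqxx in t0.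
have {}hd t : `|t| < d -> [/\ t != 0 -> Re (phi (gamma t)) != 0,
    ev Bc (cpoint (gamma t)) != 0 & V (gamma t)].
  by move=> td; apply: hd; rewrite /= sub0r normrN.
(* Squaring spares a case distinction: Re phi may or may not change sign at 0. *)
pose g t := Re (phi (gamma t)) ^+ 2.
have gg0 : g 0 = 0.
  by rewrite /g g0 (ramification_phi SP log_gradient rx b0) expr0n.
have cg t : `|t| < d -> {for t, continuous g}.
  move=> /hd[_ bt _]; have cl := local_param_continuous lp t.
  have cW := ccont_comp cl (ccont_ev W (gamma t)).
  have cB := ccont_comp cl (ccont_ev Bc (gamma t)).
  have cB3 := ccontM cB (ccontM cB cB).
  have [c1 _] := ccontM cW (ccontV cB3 (mulf_neq0 bt (mulf_neq0 bt bt))).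
  rewrite (_ : g = fun s => Re (ev W (cpoint (gamma s)) * (ev Bc (cpoint (gamma s)) *
      (ev Bc (cpoint (gamma s)) * ev Bc (cpoint (gamma s))))^-1) ^+ 2).
    exact: (continuousM c1 c1).
  by apply/funext => s; rewrite /g /nwronskian; congr (Re (_ / _) ^+ 2); rewrite exprS expr2.
pose s1 := d / 2; have s10 : 0 < s1 by rewrite divr_gt0.
have s1d : s1 < d by rewrite ltr_pdivrMr // ltr_pMr ?ltr1n.
have small t : `|t| <= s1 -> `|t| < d by move=> /le_lt_trans; apply.
have gp : 0 < g s1.
  rewrite lt_def sqr_ge0 andbT sqrf_eq0.
  by have [|h _ _] := hd s1; [rewrite gtr0_norm|apply: h; rewrite gt_eqF].
have gm : 0 < g (- s1).
  rewrite lt_def sqr_ge0 andbT sqrf_eq0.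
  have [|h _ _] := hd (- s1); first by rewrite normrN gtr0_norm.
  by apply: h; rewrite oppr_eq0 gt_eqF.
(* For 0 < e < e0 one has e^2 <= e, below the values of [g] at both ends, so the intermediate value
   theorem applies on each side of 0. *)
pose e0 := Num.min 1 (Num.min (g s1) (g (- s1))).
have e00 : 0 < e0 by rewrite !lt_min ltr01 gp gm.
exists e0 => // e /andP[e_gt0]; rewrite !lt_min => /and3P[e1 ep em].
have e2 : e ^+ 2 <= e by rewrite expr2 ger_pMl // ltW.
have e2_gt0 : 0 < e ^+ 2 by rewrite exprn_gt0.
have [t1] : exists2 t, t \in `[0, s1] & g t = e ^+ 2.
  apply: IVT; first exact: ltW.
    apply: continuous_in_subspaceT => t; rewrite inE /= in_itv /= => /andP[t0 ts].
    by apply: cg; apply: small; rewrite ger0_norm.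
  rewrite gg0 ge_min le_max ltW //=; apply/orP; right; lra.
rewrite in_itv /= => /andP[t10 t1s] gt1.
have [t2] : exists2 t, t \in `[- s1, 0] & g t = e ^+ 2.
  apply: IVT; first by rewrite oppr_le0 ltW.
    apply: continuous_in_subspaceT => t; rewrite inE /= in_itv /= => /andP[t0 ts].
    by apply: cg; apply: small; rewrite ler0_norm // lerNl.
  rewrite gg0 ge_min le_max [0 <= _]ltW ?orbT //=; apply/orP; left; lra.
rewrite in_itv /= => /andP[t2s t20] gt2.
have ne t : g t = e ^+ 2 -> t != 0.
  by apply: contra_eq_neq => ->; rewrite gg0 lt_eqF.
have t1d : `|t1| < d by apply: small; rewrite ger0_norm.
have t2d : `|t2| < d by apply: small; rewrite ler0_norm // lerNl.
have [_ b1 V1] := hd _ t1d; have [_ b2 V2] := hd _ t2d.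
exists (gamma t1), (gamma t2); split.
- move=> /(local_param_inj lp) e12; have /eqP := ne t1 gt1; apply.
  by apply/eqP; rewrite eq_le t10 e12 t20.
- by split; [exact: (local_param_in lp t1)|exact: V1|exact: b1].
- by split; [exact: (local_param_in lp t2)|exact: V2|exact: b2].
- exact: gt1.
- exact: gt2.
Unshelve. all: by end_near. Qed.

End ArcValues.

(** * The count *)

Section Counting.
Variables (R : realType) (f : laurent R) (F : {poly {poly R[i]}}) (d : nat).
Local Notation C := R[i].
Local Notation A := (zdz F).
Local Notation B := (wdw F).
Local Notation W := (wronskian F).
Local Notation S := (critical_locus f).
Implicit Types (x y : 'rV[R]_4).

Hypothesis F0 : F != 0.
Hypothesis Fd : tdeg_le d F.
Hypothesis d0 : (0 < d)%N.
Hypothesis SP : forall x, S x <-> [/\ torus (cpoint x), ev F (cpoint x) = 0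
  & cross (ev A (cpoint x)) (ev B (cpoint x)) = 0].
Hypothesis log_gradient : forall x, torus (cpoint x) -> ev F (cpoint x) = 0 ->
  ev A (cpoint x) != 0 \/ ev B (cpoint x) != 0.
Hypothesis S_manifold : smooth_1manifold S.

(** Each point excludes at most the one value c = -B / A, so some natural number works for all of
    them. *)
Lemma ex_shear n (xs : 'I_n -> 'rV[R]_4) : (forall i, S (xs i)) ->
  exists c : R, forall i, ev (sheared F c) (cpoint (xs i)) != 0.
Proof.
move=> Sxs.
have [k kbad] := @exists_notin R (fun k => k%:R)
  [seq - Re (ev B (cpoint (xs i)) / ev A (cpoint (xs i))) | i <- enum 'I_n]
  (mulrIn (oner_neq0 _)).
exists k%:R => i; rewrite ev_sheared; apply: contra kbad => /eqP e.
apply/mapP; exists i; first by rewrite mem_enum.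
have /SP[Ti Fi _] := Sxs i.
have [A0|A0] := eqVneq (ev A (cpoint (xs i))) 0.
  have := log_gradient Ti Fi; rewrite A0 eqxx => -[//|].
  by move: e; rewrite A0 mulr0 addr0 => ->; rewrite eqxx.
have -> : ev B (cpoint (xs i)) = - (k%:R%:C * ev A (cpoint (xs i))).
  by apply/eqP; rewrite -addr_eq0 e.
by rewrite mulNr mulfK // opprK.
Qed.

Lemma tdeg_dlog k G : tdeg_le k G -> tdeg_le (k + d) (dlog F G).
Proof.
move=> Gk; apply: wdeg_leB; apply: wdeg_leM;
  by [apply: wdeg_le_wdw|apply: wdeg_le_zdz].
Qed.

Lemma tdeg_wronskian : tdeg_le (3 * d) W.
Proof.
have -> : (3 * d = d + (d + d))%N by lia.
by apply: wdeg_leB; apply: wdeg_leM; try apply: tdeg_dlog;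
  try apply: wdeg_le_wdw; try apply: wdeg_le_zdz.
Qed.

Lemma tdeg_sheared c : tdeg_le d (sheared F c).
Proof.
apply: wdeg_leD; first exact: wdeg_le_wdw.
by apply: wdeg_leCM; apply: wdeg_le_zdz.
Qed.

Definition separated n (xs : 'I_n -> 'rV[R]_4) (i : 'I_n) : set 'rV[R]_4 :=
  [set y | forall j, j != i -> `|xs i - y| < `|xs i - xs j| / 2].

Lemma nbhs_separated n (xs : 'I_n -> 'rV[R]_4) i : injective xs ->
  nbhs (xs i) (separated xs i).
Proof.
move=> inj_xs; rewrite /separated.
have h (j : 'I_n) : \forall y \near xs i, j != i -> `|xs i - y| < `|xs i - xs j| / 2.
  have [->|ji] := eqVneq j i; first by near=> y.
  have lt0 : 0 < `|xs i - xs j| / 2.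
    by rewrite divr_gt0 // normr_gt0 subr_eq0; apply: contra_neq ji => /inj_xs.
  have cid : id @ xs i --> xs i by exact: cvg_id.
  by move/cvgrPdist_lt : cid => /(_ _ lt0); apply: filterS.
exact: (filter_forall (nbhs_filter (xs i)) h).
Unshelve. all: by end_near. Qed.

Lemma separated_disjoint n (xs : 'I_n -> 'rV[R]_4) i j y :
  separated xs i y -> separated xs j y -> i = j.
Proof.
move=> hi hj; apply/eqP; apply: contraT => ij.
have h1 : `|xs i - y| < `|xs i - xs j| / 2 by apply: hi; rewrite eq_sym.
have h2 := hj i ij; rewrite (distrC (xs j) y) (distrC (xs j) (xs i)) in h2.
have := ler_normD (xs i - y) (y - xs j); rewrite subrKA => h3.
by move: h1 h2 h3; set a := `|_|; set b := `|_|; set e := `|_|; lra.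
Qed.

Lemma reflected_zero c (P : {poly {poly C}}) y (e : R) : S y ->
  ev (sheared F c) (cpoint y) != 0 ->
  ev P (chart_point A (sheared F c) W (cpoint y)) = 0 ->
  Re (nwronskian F c y) = e ->
  ev (reflected (2 * e)%:C P) (chart_point A (sheared F c) W (cpoint y)) = 0.
Proof.
move=> Sy b0 P0 re; rewrite ev_reflected /chart_point /=.
have conjE (z : C) : Num.conj z = Re z -i* Im z by case: z.
have tr : Num.conj (ev A (cpoint y) / ev (sheared F c) (cpoint y)) =
    ev A (cpoint y) / ev (sheared F c) (cpoint y).
  apply/complex_eqP; rewrite conjE; split=> //=.
  by rewrite (critical_slope SP Sy b0) oppr0.
have ur : (2 * e)%:C - nwronskian F c y = Num.conj (nwronskian F c y).
  apply/complex_eqP; rewrite conjE cReD cImD cReN cImN re /=.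
  by split; ring.
move: P0 ur tr; rewrite /chart_point -/(nwronskian F c y).
move: (nwronskian F c y) (_ / _) => u t P0 ur tr; rewrite ur -{1}tr.
by rewrite -[LHS]/(ev (conj_poly P) (Num.conj (t, u).1, Num.conj (t, u).2))
  ev_conj_poly P0 conjC0.
Qed.

(** For one small generic [e], each [xs i] yields two points of [S] with (Re phi)^2 = e^2. All are
    zeros of [Pi], one factor of which serves Re phi = e and the other Re phi = -e. As [Pi] has
    degree at most 2 d M, [zeros_bound] gives 2 n <= 2 d^2 M. *)
Lemma ramification_count n (xs : 'I_n -> 'rV[R]_4) :
  ramification_points f `<=` isolated (ramification_points f) ->
  injective xs -> (forall i, ramification_points f (xs i)) ->
  (n <= 3 * d ^ 4)%N.
Proof.
move=> iso inj_xs rxs; case: n xs inj_xs rxs => [//|n] xs inj_xs rxs.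
have Sxs i : S (xs i) := (rxs i).1.
have [c Bc0] := ex_shear Sxs.
pose Bc := sheared F c; pose S' (p : C * C) := exists2 x, S x & cpoint x = p.
have FS' p : S' p -> ev F p = 0 by move=> [x /SP[_ Fx _] <-].
have tf (r : {poly C}) G : r != 0 ->
    (forall p, S' p -> ev Bc p != 0 -> r.[ev A p / ev Bc p] * ev G p = 0) ->
    forall p, S' p -> ev G p = 0.
  move=> r0 rG p [x Sx <-].
  apply: (critical_torsion_free F0 SP log_gradient S_manifold r0 _ Sx) => y Sy b0.
  by apply: rG => //; exists y.
have [P [M [rP P0 PM leM]]] := relation_weight
  (wdeg_le_zdz Fd) (tdeg_sheared c) tdeg_wronskian F0 Fd FS' tf d0.
(* Were [P] a polynomial in t alone, torsion-freeness would make the constant 1 vanish on [S]. *)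
have sP : (1 < size P)%N.
  rewrite ltnNge; apply/negP => sP; have eP := size1_polyC sP.
  have r0 : P`_0 != 0 by apply: contra_neq P0 => e; rewrite eP e.
  have : ev (1 : {poly {poly C}}) (cpoint (xs ord0)) = 0.
    apply: (tf P`_0 1 r0); last by exists (xs ord0).
    move=> p Sp b0; have := rP p Sp b0; rewrite eP evC /= coefC /= => ->.
    by rewrite mul0r.
  by move=> /eqP; rewrite -[1]/(1%:P%:P) evCC oner_eq0.
have [bad Pbad] := reflected_coprime sP.
have h_pert i := perturbed_points F0 SP log_gradient S_manifold iso (rxs i) (Bc0 i)
  (nbhs_separated i inj_xs).
pose E i := sval (cid2 (h_pert i)).
have E0 i : 0 < E i by rewrite /E; case: cid2.
have EP i e : 0 < e < E i -> exists y1 y2,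
    [/\ y1 <> y2, [/\ S y1, separated xs i y1 & ev Bc (cpoint y1) != 0],
        [/\ S y2, separated xs i y2 & ev Bc (cpoint y2) != 0],
        Re (nwronskian F c y1) ^+ 2 = e ^+ 2 & Re (nwronskian F c y2) ^+ 2 = e ^+ 2].
  by rewrite /E; case: cid2 => /= e0 _; apply.
pose e0 := \big[Num.min/1]_(i < n.+1) E i.
have e00 : 0 < e0.
  by rewrite /e0; elim/big_ind: _ => // a b a0 b0; rewrite lt_min a0 b0.
have e0E i : e0 <= E i by rewrite /e0 (bigD1 i) //= ge_min lexx.
(* The candidates e0 / (k + 2) are all strictly below [e0]. There are infinitely many, so for one of
   them neither 2 e nor -2 e is bad. *)
have inj_e : injective (fun k : nat => (2 * (e0 / k.+2%:R))%:C).
  move=> k l /complexI /(mulfI _) => /(_ (lt0r_neq0 (ltr0n _ 2))).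
  by move=> /(mulfI (lt0r_neq0 e00))/invr_inj/eqP; rewrite eqr_nat => /eqP[].
have [k] := exists_notin (bad ++ map -%R bad) inj_e.
set e := e0 / k.+2%:R; rewrite mem_cat negb_or => /andP[ebad eNbad].
have e_gt0 : 0 < e by rewrite divr_gt0.
have e_lt i : 0 < e < E i.
  rewrite e_gt0 /= (lt_le_trans _ (e0E i)) // ltr_pdivrMr // ltr_pMr //.
  by rewrite ltr1n.
have eNbad' : (2 * (- e))%:C \notin bad.
  apply: contra eNbad => h; apply/mapP; exists (2 * (- e))%:C => //.
  by rewrite mulrN rmorphN opprK.
have [r1 [U1 [V1 [r10 e1]]]] := Pbad _ ebad.
have [r2 [U2 [V2 [r20 e2]]]] := Pbad _ eNbad'.
have zero1 y := @reflected_zero c P y e; have zero2 y := @reflected_zero c P y (- e).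
have Q1M : wt_le M (reflected (2 * e)%:C P) by apply: wt_reflected.
have Q2M : wt_le M (reflected (2 * - e)%:C P) by apply: wt_reflected.
move: e1 e2 zero1 zero2 Q1M Q2M; rewrite -/Bc.
move: (reflected (2 * e)%:C P) (reflected (2 * - e)%:C P) => Q1 Q2.
move=> e1 e2 zero1 zero2 Q1M Q2M.
pose Pi := homog A Bc W M Q1 * homog A Bc W M Q2.
have PiD : tdeg_le (d * M + d * M) Pi.
  have tH Q : wt_le M Q -> tdeg_le (d * M) (homog A Bc W M Q).
    exact: (tdeg_homog (wdeg_le_zdz Fd) (tdeg_sheared c) tdeg_wronskian).
  exact: wdeg_leM (tH _ Q1M) (tH _ Q2M).
have PiE p : ev Bc p != 0 -> ev Pi p = ev Bc p ^+ M * ev Bc p ^+ M *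
    (ev Q1 (chart_point A Bc W p) * ev Q2 (chart_point A Bc W p)).
  move=> b0; rewrite /Pi (evM (homog A Bc W M Q1) (homog A Bc W M Q2)).
  rewrite (ev_homog A W Q1M b0) (ev_homog A W Q2M b0); exact: mulrACA.
(* On [S] the relation P vanishes, so U P + V Q = r becomes r(t) = V Q for each sign. Hence Pi G = 0
   gives r1(t) r2(t) G = 0 where [Bc] is nonzero, and torsion-freeness concludes. *)
have Pireg G : (forall p, S' p -> ev (Pi * G) p = 0) ->
    forall p, S' p -> ev G p = 0.
  move=> PG; apply: (tf (r1 * r2)); first by rewrite mulf_neq0.
  move=> p Sp b0; have := PG p Sp; rewrite (evM Pi G) (PiE p b0) => Q0.
  set q := chart_point A Bc W p in Q0.
  have h1 : r1.[ev A p / ev Bc p] = ev V1 q * ev Q1 q.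
    rewrite -[LHS](evC r1 q) -e1 (evD (U1 * P)) (evM U1 P) (evM V1 Q1).
    by rewrite (rP p Sp b0) mulr0 add0r.
  have h2 : r2.[ev A p / ev Bc p] = ev V2 q * ev Q2 q.
    rewrite -[LHS](evC r2 q) -e2 (evD (U2 * P)) (evM U2 P) (evM V2 Q2).
    by rewrite (rP p Sp b0) mulr0 add0r.
  rewrite hornerM h1 h2; apply: (mulfI (expf_neq0 M b0)); apply: (mulfI (expf_neq0 M b0)).
  rewrite !mulr0 -[RHS](mulr0 (ev V1 q * ev V2 q)) -[in RHS]Q0; ring.
have /choice[yy yyP] : forall i : 'I_n.+1, exists p : 'rV[R]_4 * 'rV[R]_4,
    [/\ p.1 <> p.2, [/\ S p.1, separated xs i p.1 & ev Bc (cpoint p.1) != 0],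
        [/\ S p.2, separated xs i p.2 & ev Bc (cpoint p.2) != 0],
        Re (nwronskian F c p.1) ^+ 2 = e ^+ 2 & Re (nwronskian F c p.2) ^+ 2 = e ^+ 2].
  by move=> i; have [y1 [y2 h]] := EP i e (e_lt i); exists (y1, y2).
pose ys (u : 'I_n.+1 * bool) := if u.2 then (yy u.1).1 else (yy u.1).2.
have ysP u : [/\ S (ys u), separated xs u.1 (ys u), ev Bc (cpoint (ys u)) != 0
    & Re (nwronskian F c (ys u)) ^+ 2 = e ^+ 2].
  case: u => i b; have [_ [a1 a2 a3] [b1 b2 b3] c1 c2] := yyP i; rewrite /ys.
  case: b; first by split; [exact: a1|exact: a2|exact: a3|exact: c1].
  by split; [exact: b1|exact: b2|exact: b3|exact: c2].
have inj_ys : injective ys.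
  move=> [i b] [j b'] eij.
  have [_ si _ _] := ysP (i, b); have [_ sj _ _] := ysP (j, b').
  rewrite eij in si; have eq_ij := separated_disjoint si sj.
  rewrite /= in eq_ij; clear si sj; subst i; have [ne _ _ _ _] := yyP j.
  move: eij; rewrite /ys /=; case: b b' => -[] e12; first by [].
  - by case: ne.
  - by case: ne; rewrite e12.
  - by [].
have Piys u : ev Pi (cpoint (ys u)) = 0.
  have [Sy _ by0 re2] := ysP u.
  have rPy : ev P (chart_point A Bc W (cpoint (ys u))) = 0.
    by apply: rP => //; exists (ys u).
  rewrite (PiE _ by0).
  have /orP[/eqP re|/eqP re] : (Re (nwronskian F c (ys u)) == e) || (Re (nwronskian F c (ys u)) == - e).
    by rewrite -eqf_sqr re2.
  - by rewrite (zero1 _ Sy by0 rPy re) mul0r mulr0.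
  - by rewrite (zero2 _ Sy by0 rPy re) !mulr0.
pose pts (l : 'I_#|{: 'I_n.+1 * bool}|) := cpoint (ys (enum_val l)).
have inj_pts : injective pts.
  by move=> l l' /cpoint_inj/inj_ys/enum_val_inj.
have bound : (#|{: 'I_n.+1 * bool}| <= d * (d * M + d * M))%N.
  apply: (zeros_bound F0 Fd FS' PiD Pireg inj_pts) => l; last exact: Piys.
  by exists (ys (enum_val l)) => //; have [] := ysP (enum_val l).
have : (d ^ 2 * M <= d ^ 2 * (3 * d ^ 2))%N by rewrite leq_mul2l leM orbT.
move: bound; rewrite card_prod card_ord card_bool; lia.
Qed.

End Counting.

Local Close Scope complex_scope.

(** Distinct cusp values have distinct lifts, so every finite set of cusp values has at most N
    elements. This also excludes the infinite case, where the counting measure is infinite. *)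
Lemma kappa_le (R : realType) (f : laurent R) N :
  (forall n (xs : 'I_n -> 'rV[R]_4), injective xs ->
     (forall i, ramification_points f (xs i)) -> (n <= N)%N) ->
  (kappa f <= N%:R%:E)%E.
Proof.
move=> countN.
have fsetN (X : {fset 'rV[R]_2}) : [set` X] `<=` cusp_values f -> (#|` X| <= N)%N.
  move=> XK.
  have /choice[g gP] : forall i : 'I_#|` X|, exists x : 'rV[R]_4,
      ramification_points f x /\ Log x = nth 0 (enum_fset X) i.
    move=> i; have [|x rx ex] := XK (nth 0 (enum_fset X) i); last by exists x.
    by rewrite /= mem_nth.
  apply: (countN _ g) => [i j eij|i]; last by have [] := gP i.
  apply: val_inj; apply/eqP; rewrite -(nth_uniq 0 (ltn_ord i) (ltn_ord j) (fset_uniq X)).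
  by rewrite -(gP i).2 -(gP j).2 eij.
rewrite /kappa /counting. case: asboolP => fin.
  have sub : [set` fset_set (cusp_values f)] `<=` cusp_values f by rewrite fset_setK.
  by rewrite lee_fin ler_nat (fsetN _ sub).
have [X XK cX] := infinite_set_fset N.+1 fin.
by move: cX; rewrite leqNgt ltnS (fsetN _ XK).
Qed.

Lemma kappa_bound (R : realType) (f : laurent R) d : (1 <= d)%N ->
  has_projective_degree f d -> smooth_in_torus f ->
  smooth_1manifold (critical_locus f) ->
  ramification_points f `<=` isolated (ramification_points f) ->
  (kappa f <= (3 * d%:R ^+ 4)%:E)%E.
Proof.
move=> d1 fd sm mfd iso.
have [F [m [Fd F0 evF evAF evBF]]] := polynomial_model fd.
have -> : 3 * d%:R ^+ 4 = (3 * d ^ 4)%:R :> R by rewrite natrM natrX.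
have SP x : critical_locus f x <-> [/\ torus (cpoint x), ev F (cpoint x) = 0
    & cross (ev (zdz F) (cpoint x)) (ev (wdw F) (cpoint x)) = 0].
  have crit := @critical_locusP R f F m evF evAF evBF x sm.
  split=> [/crit[/(curveP evF)[Tx Fx] cr] //|[Tx Fx cr]].
  by apply/crit; split=> //; apply/(curveP evF).
have grad x : torus (cpoint x) -> ev F (cpoint x) = 0 ->
    ev (zdz F) (cpoint x) != 0 \/ ev (wdw F) (cpoint x) != 0.
  by move=> Tx Fx; apply: (log_gradient_neq0 evAF evBF sm); apply/(curveP evF).
apply: kappa_le => n xs inj_xs rxs.
exact: (ramification_count F0 Fd d1 SP grad mfd iso inj_xs rxs).
Qed.

Theorem theorem4p1 (R : realType) :
  exists2 h : nat -> R,
    (h : nat -> R^o) =O_\oo ((fun d => d%:R^-1) : nat -> R^o) &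
  forall (d : nat) (Delta : set 'rV[R]_2) (f : laurent R),
    (1 <= d)%N ->
    has_projective_degree f d ->
    lattice_polygon Delta ->
    two_dimensional Delta ->
    newton_polygon f = Delta ->
    curve_class Delta f ->
    ramification_points f `<=` isolated (ramification_points f) ->
    [/\ (kappa f <=
           (4 * d%:R ^+ 4 + 8 * d%:R ^+ 3 - 6 * d%:R ^+ 2)%:E)%E,
        4 * d%:R ^+ 4 + 8 * d%:R ^+ 3 - 6 * d%:R ^+ 2
          <= 13 / 2 * d%:R ^+ 4 :> R,
        (3 <= d)%N -> (kappa f <= (6 * d%:R ^+ 4)%:E)%E
      & (kappa f <= ((4 + h d) * d%:R ^+ 4)%:E)%E].
Proof.
exists (fun=> 0).
  apply/eqOP; near=> k; near=> n; rewrite normr0 mulr_ge0 ?normr_ge0 //.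
move=> d Delta f d1 fd _ _ _ [_ sm mfd _ _] iso.
have kb := kappa_bound d1 fd sm mfd iso.
have d_ge1 : 1 <= d%:R :> R by rewrite ler1n.
have d4 : 0 <= d%:R ^+ 4 :> R by apply: exprn_ge0; lra.
split.
- apply: (le_trans kb); rewrite lee_fin.
  have d2 : 0 <= d%:R ^+ 2 :> R by apply: exprn_ge0; lra.
  rewrite -subr_ge0.
  have -> : 4 * d%:R ^+ 4 + 8 * d%:R ^+ 3 - 6 * d%:R ^+ 2 - 3 * d%:R ^+ 4 =
    d%:R ^+ 2 * ((d%:R - 1) * (d%:R + 9) + 3) :> R by ring.
  apply: mulr_ge0 => //; apply: addr_ge0 => //; apply: mulr_ge0; lra.
- rewrite -subr_ge0.
  have -> : 13 / 2 * d%:R ^+ 4 - (4 * d%:R ^+ 4 + 8 * d%:R ^+ 3 - 6 * d%:R ^+ 2) =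
    d%:R ^+ 2 * (5 / 2 * d%:R ^+ 2 - 8 * d%:R + 6) :> R by field.
  apply: mulr_ge0; first by apply: exprn_ge0; lra.
  (* The quadratic factor is (5 d - 6) (d - 2) / 2, negative strictly between 6/5 and 2; hence d = 1
     is checked separately. *)
  case: d d1 {fd kb d4 d_ge1} => [//|[|d]] _; first by rewrite !expr1n; lra.
  have : 2 <= d.+2%:R :> R by rewrite ler_nat.
  move: (d.+2%:R) => t t2; nra.
- by move=> _; apply: (le_trans kb); rewrite lee_fin ler_wpM2r // ler_nat.
- apply: (le_trans kb); rewrite lee_fin addr0 ler_wpM2r // ler_nat.
Unshelve. all: by end_near. Qed.
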